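(* Let $G=(V,E)$ be a countably infinite, locally finite, connected graph with graph distance $d$, and suppose there are $\alpha\ge 1$ and $c_1,c_2>0$ with $c_1 r^{\alpha}\le \sharp B(x,r)\le c_2 r^{\alpha}$ for all $x\in V$, $r\ge 1$. Let $\omega=\{\omega(e)\}_{e\in E}$ be non-negative random conductances defined on a probability space $(\Omega,\mathcal F,\mathbb P)$, and fix a base point $x_0\in V$. Assume that there exist $\Omega_0\in\mathcal F$ with $\mathbb P(\Omega_0)=1$, positive constants $c_{1.1},\dots,c_{1.6},\beta,\epsilon$ with $\epsilon+1<\beta$, and random variables $N_{x,\epsilon}(\omega)$ ($x\in V$, $\omega\in\Omega_0$) such that the following hold. (1) For all $\omega\in\Omega_0$, $x\in V(G^\omega)$ and $r\ge N_{x,\epsilon}(\omega)$: $c_{1.1}r^{\alpha}\le V^\omega(x,r)\le c_{1.2}r^{\alpha}$. (2) For all $\omega\in\Omega_0$ and $x,y\in V(G^\omega)$, $$p_n^\omega(x,y)\le \frac{c_{1.3}}{n^{\alpha/\beta}}\exp\Big[-c_{1.4}\Big(\frac{d(x,y)}{n^{1/\beta}}\Big)^{\beta/(\beta-1)}\Big]\quad\text{whenever } \max\{d(x,y),N_{x,\epsilon}(\omega)\}\le n,$$ and $$p_n^\omega(x,y)+p_{n+1}^\omega(x,y)\ge \frac{c_{1.5}}{n^{\alpha/\beta}}\exp\Big[-c_{1.6}\Big(\frac{d(x,y)}{n^{1/\beta}}\Big)^{\beta/(\beta-1)}\Big]\quad\text{whenever } \max\{d(x,y)^{1+\epsilon},N_{x,\epsilon}(\omega)\}\le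 n.$$ (3) There is a non-increasing function $f_\epsilon(n)$ such that $\mathbb P(N_{x,\epsilon}\ge n)\le f_\epsilon(n)$ for all $x\in V$ and $n\ge1$, and $\sum_{n\ge1}n^{\alpha\beta}f_\epsilon(n)<\infty$. Then for $\mathbb P$-almost every $\omega\in\Omega$ there exist positive constants $C_1=C_1(\omega)$ and $C_2=C_2(\omega)$ such that $$\limsup_{n\to\infty}\frac{d(X_0^\omega,X_n^\omega)}{n^{1/\beta}(\log\log n)^{1-1/\beta}}=C_1,\qquad P_x^\omega\text{-a.s. for all }x\in V(G^\omega),$$ $$\liminf_{n\to\infty}\frac{\max_{0\le\ell\le n}d(X_0^\omega,X_\ell^\omega)}{n^{1/\beta}(\log\log n)^{-1/\beta}}=C_2,\qquad P_x^\omega\text{-a.s. for all }x\in V(G^\omega).$$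
   Context: $d(x,y)$ is the length of a shortest path in $G$ (not depending on $\omega$), and $B(x,r)=\{y\in V: d(x,y)\le r\}$; $\sharp$ denotes cardinality. Write $\omega_{xy}=\omega(e)$ for $e=xy\in E$. $V(G^\omega)$ is the set of vertices $v$ that can be joined to $x_0$ by a path of edges $e$ all with $\omega(e)>0$. The weight of $x$ is $\mu^\omega(x)=\sum_{y: y\sim x}\omega_{xy}$, and $V^\omega(x,r)=\sum_{y\in B(x,r)\cap V(G^\omega)}\mu^\omega(y)$. $\{X_n^\omega\}_{n\ge0}$ is the discrete-time Markov chain on $V(G^\omega)$ with transition probability $P^\omega(x,y)=\omega_{xy}/\mu^\omega(x)$; $P_x^\omega$ is its law started from $X_0^\omega=x$. The heat kernel is $p_n^\omega(x,y)=P_x^\omega(X_n^\omega=y)/\mu^\omega(y)$. *)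

(* Defs.v *)
From HB Require Import structures.
From mathcomp Require Import all_boot all_order all_algebra.
From mathcomp Require Import finmap.
From mathcomp Require Import all_classical all_reals all_analysis.

Set Implicit Arguments.
Unset Strict Implicit.
Unset Printing Implicit Defensive.

Import Order.TTheory GRing.Theory Num.Theory.
Local Open Scope classical_set_scope.
Local Open Scope ring_scope.

(* A graph on V is given by its adjacency relation [e : rel V]. *)

Definition walk_length (V : countType) (e : rel V) (x y : V) : pred nat :=
  fun n => `[< exists p : seq V, [/\ path e x p, last x p = y & size p = n] >].

Definition connected_graph (V : countType) (e : rel V) : Prop :=
  forall x y : V, exists n : nat, walk_length e x y n.

Definition locally_finite (V : countType) (e : rel V) : Prop :=
  forall x : V, finite_set [set y | e x y].

(* The value 0 for disconnected vertices is never used on a connected graph. *)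
Definition gdist (V : countType) (e : rel V) (x y : V) : nat :=
  match pselect (exists n : nat, walk_length e x y n) with
  | left h => ex_minn h
  | right _ => 0%N
  end.

Definition gball (R : realType) (V : countType) (e : rel V) (x : V) (r : R) :
    set V :=
  [set y | (gdist e x y)%:R <= r].

(* A fixed environment is a function [c : V -> V -> R]; the conductance of the
   edge xy is [c x y], and the values of c off the edges are never used. *)

Definition env (R : realType) (V : countType) (T : Type)
    (w : V -> V -> T -> R) (omega : T) : V -> V -> R :=
  fun x y => w x y omega.

Definition open_cluster (R : realType) (V : countType) (e : rel V)
    (c : V -> V -> R) (x0 : V) : set V :=
  [set v | exists p : seq V,
     path (fun a b => e a b && (0 < c a b)) x0 p /\ last x0 p = v].

Definition vweight (R : realType) (V : countType) (e : rel V)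
    (c : V -> V -> R) (x : V) : R :=
  \sum_(y \in [set y | e x y]) c x y.

Definition volume (R : realType) (V : countType) (e : rel V)
    (c : V -> V -> R) (x0 x : V) (r : R) : R :=
  \sum_(y \in gball e x r `&` open_cluster e c x0) vweight e c y.

Definition transition (R : realType) (V : countType) (e : rel V)
    (c : V -> V -> R) (x y : V) : R :=
  if e x y then c x y / vweight e c x else 0.

(* Under Q, the V-valued process X (V countable and discrete) is a Markov chain
   started from x with transition probabilities p. The Markov property is
   written with the conditional probability multiplied out:
   Q(X_0 = s_0, .., X_(n+1) = s_(n+1))
     = Q(X_0 = s_0, .., X_n = s_n) p(s_n, s_(n+1)). *)
Definition markov_chain_from (R : realType) (V : countType)
    (d : measure_display) (W : measurableType d) (Q : probability W R)
    (X : nat -> W -> V) (p : V -> V -> R) (x : V) : Prop :=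
  [/\ forall (n : nat) (y : V), measurable (X n @^-1` [set y]),
      Q (X 0%N @^-1` [set x]) = 1%E &
      forall (n : nat) (s : nat -> V),
        Q [set h | forall i : nat, (i <= n.+1)%N -> X i h = s i] =
        (Q [set h | forall i : nat, (i <= n)%N -> X i h = s i]
           * (p (s n) (s n.+1))%:E)%E ].

Definition heat_kernel (R : realType) (V : countType) (e : rel V)
    (c : V -> V -> R) (d : measure_display) (W : measurableType d)
    (Q : V -> probability W R) (X : nat -> W -> V) (n : nat) (x y : V) : R :=
  fine (Q x (X n @^-1` [set y])) / vweight e c y.

(* Only the values at large n matter in the next two definitions: log log n is
   not positive for n <= 2. *)

Definition limsup_ratio (R : realType) (V : countType) (e : rel V) (beta : R)
    (xs : nat -> V) : \bar R :=
  limn_esup (fun n : nat =>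
    ((gdist e (xs 0%N) (xs n))%:R
      / (n%:R `^ (1 / beta) * ln (ln n%:R) `^ (1 - 1 / beta)))%:E).

Definition liminf_ratio (R : realType) (V : countType) (e : rel V) (beta : R)
    (xs : nat -> V) : \bar R :=
  limn_einf (fun n : nat =>
    ((\max_(l < n.+1) gdist e (xs 0%N) (xs l))%N%:R
      / (n%:R `^ (1 / beta) * ln (ln n%:R) `^ (- (1 / beta))))%:E).

(* Main.v *)
Require Import Defs.
From HB Require Import structures.
From mathcomp Require Import all_boot all_order all_algebra.
From mathcomp Require Import finmap.
From mathcomp Require Import all_classical all_reals all_analysis.
From mathcomp Require Import measurable_realfun.
From mathcomp Require Import ring lra zify.

Set Implicit Arguments.
Unset Strict Implicit.
Unset Printing Implicit Defensive.

Import Order.TTheory GRing.Theory Num.Theory.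
Local Open Scope classical_set_scope.
Local Open Scope ring_scope.

(** Why the theorem holds. Fix an environment and write [phi n] and [psi n] for
    [n^(1/beta) (log log n)^(1 - 1/beta)] and [n^(1/beta) (log log n)^(-1/beta)].

    The heat kernel bounds at a vertex [z] hold only from the random scale [N z]
    on. A ball of radius [n^beta] has at most [c2 n^(alpha beta)] vertices, so the
    moment condition on the tails of [N] and the Borel-Cantelli lemma give, for
    almost every environment, [N z <= 2 rho^(1/beta)] for all [z] within distance
    [rho] of [x0], once [rho] is large ([ae_good_environment]). Since [1 < beta],
    the scale of every vertex that the walk can meet by time [n] is then small
    enough for the bounds to be used there at times comparable with [n].

    In such an environment the chain is studied through its law on path space.
    Four estimates come from the heat kernel:
    - the walk reaches distance [A phi n] by time [n] with probability
      [O((log n)^-2)]: Gaussian tails and a decomposition at the first exit from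
      a ball ([far_le], [exit_le], [pr_exceeds_phi]);
    - it stays within [c psi n] up to time [n] with probability [O((log n)^-2)]:
      in each time [kap r^beta] it leaves a ball of radius [r] with probability
      at least one half ([pr_confined]);
    - it is beyond [c phi n] at time [n] with probability at least of order
      [(log n)^(-1/2)] ([pr_far_phi]);
    - it stays within [C psi n] up to time [n] with probability at least of that
      order: the time is cut into about [log log n] blocks, at the end of each of
      which the walk is back near its start ([pr_stay_psi]).

    Along the times [2^j] the first two probabilities are summable. Along the
    times [2^(k^2)] the last two are of order [1/k], and the Markov property lets
    them be used on the successive time intervals, whatever the past; so the
    events occur infinitely often ([conditional_io]). The past costs nothing,
    because consecutive times [2^(k^2)] have a ratio that tends to infinity faster
    than any power of [log log]. This bounds the upper and lower limits from both
    sides, at least with positive probability.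

    It remains to see that both limits are almost surely constant, with a constant
    that is the same for all starting points. They do not change when the path is
    shifted in time, so an event [A] that they define gives a harmonic function
    [x |-> L x A]. By the lower heat kernel bound the laws of the walk from two
    starting points, at a suitable time, have a common part of mass bounded below;
    two consecutive times are averaged because of a possible period 2. Hence the
    oscillation of that function is contracted by a fixed factor and vanishes
    ([invariant_constant]), which makes [A] independent of every cylinder, hence of
    itself ([invariant_zero_one]). *)

(** * The graph metric *)

Section GraphMetric.
Variables (V : countType) (e : rel V).
Hypotheses (e_sym : symmetric e) (e_conn : connected_graph e).

Lemma gdist_walk x y : walk_length e x y (gdist e x y).
Proof.
rewrite /gdist; case: pselect => [h|]; first by case: ex_minnP.
by case; exact: e_conn.
Qed.

Lemma gdist_min x y n : walk_length e x y n -> (gdist e x y <= n)%N.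
Proof.
rewrite /gdist; case: pselect => // h w; case: ex_minnP => m _; exact.
Qed.

Lemma gdistxx x : gdist e x x = 0%N.
Proof. by apply/eqP; rewrite -leqn0 gdist_min//; apply/asboolP; exists [::]. Qed.

Lemma gdist_triangle y x z : (gdist e x z <= gdist e x y + gdist e y z)%N.
Proof.
have /asboolP[p [p_path p_last p_size]] := gdist_walk x y.
have /asboolP[q [q_path q_last q_size]] := gdist_walk y z.
apply/gdist_min/asboolP; exists (p ++ q).
by rewrite cat_path p_path p_last q_path last_cat p_last q_last size_cat p_size q_size.
Qed.

Lemma gdist_sym x y : gdist e x y = gdist e y x.
Proof.
suff leS u v : (gdist e u v <= gdist e v u)%N.
  by apply/eqP; rewrite eqn_leq !leS.
have /asboolP[p [p_path p_last p_size]] := gdist_walk v u.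
apply/gdist_min/asboolP; exists (rev (belast v p)).
split; last by rewrite size_rev size_belast.
  by rewrite -p_last rev_path; under eq_path do rewrite e_sym.
by case: (p) p_last => [<-//|a l] /=; rewrite rev_cons last_rcons.
Qed.

Lemma gdist_edge x y : e x y -> (gdist e x y <= 1)%N.
Proof.
by move=> exy; apply/gdist_min/asboolP; exists [:: y]; rewrite /= exy.
Qed.

End GraphMetric.

Lemma gball_finite (R : realType) (V : countType) (e : rel V) (a c : R) :
  0 < c ->
  (forall (x : V) (r : R), 1 <= r ->
     c * r `^ a <= (#|` fset_set (gball e x r)|)%:R) ->
  forall (x : V) (r : R), finite_set (gball e x r).
Proof.
move=> c_gt0 card_ge x r.
have ge1 : 1 <= Num.max 1 r by rewrite le_max lexx.
apply: (@sub_finite_set _ _ (gball e x (Num.max 1 r))).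
  by move=> y /le_trans; apply; rewrite le_max lexx orbT.
(* An infinite set has an empty [fset_set], of cardinality 0. *)
apply: contrapT => infinite_ball; have := card_ge x _ ge1.
rewrite /fset_set; case: pselect => // _; rewrite cardfs0.
by apply/negP; rewrite -ltNge mulr_gt0// powR_gt0// (lt_le_trans ltr01).
Qed.

(** * Path space *)

Section PathSpace.
Variable V : countType.

Definition cyl (n : nat) (t : nat -> V) : set (nat -> V) :=
  [set s | forall i, (i <= n)%N -> s i = t i].

Definition cylinders : set (set (nat -> V)) :=
  [set A | A = set0 \/ exists n t, A = cyl n t].

Definition future (n : nat) (s : nat -> V) : nat -> V := fun i => s (n + i)%N.

Definition determined (n : nat) (F : set (nat -> V)) : Prop :=
  forall s t, (forall i, (i <= n)%N -> s i = t i) -> F s -> F t.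

Lemma future_future n m s : future m (future n s) = future (n + m) s.
Proof. by apply/funext => i; rewrite /future addnA. Qed.

Lemma cylinders_setI : setI_closed cylinders.
Proof.
move=> A B [->|[n [t ->]]] [->|[m [u ->]]]; rewrite ?set0I ?setI0; do ?by left.
have [->|/set0P[v [vt vu]]] := eqVneq (cyl n t `&` cyl m u) set0; first by left.
right; exists (maxn n m), v; apply/seteqP; split=> [s [st su] i|s sv].
  rewrite leq_max => /orP[|] im; first by rewrite st// vt.
  by rewrite su// vu.
split=> i im; first by rewrite sv ?vt// leq_max im.
by rewrite sv ?vu// leq_max im orbT.
Qed.

Lemma determined_cyl n t : determined n (cyl n t).
Proof. by move=> s u su st i im; rewrite -su// st. Qed.

Lemma determinedC n F : determined n F -> determined n (~` F).
Proof. by move=> Fn s t st Fs Ft; apply: Fs; apply: Fn Ft => i im; rewrite st. Qed.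

Lemma determined_future n m F : determined m F -> determined (n + m) (future n @^-1` F).
Proof. by move=> Fm s t st; apply: Fm => i im; apply: st; rewrite leq_add2l. Qed.

Definition prefix_code n (s : nat -> V) : nat := choice.pickle (mkseq s n.+1).

(** Since [V] is countable there are countably many prefixes, so an event that
    depends on finitely many coordinates is a countable union of cylinders. *)
Lemma determined_piece n (F : set (nat -> V)) k
    (F_k := F `&` [set s | prefix_code n s = k]) :
  determined n F -> F_k = set0 \/ exists2 s, F s & F_k = cyl n s.
Proof.
move=> Fn; have [->|/set0P[s [Fs sk]]] := eqVneq F_k set0; [by left|right].
exists s => //; apply/seteqP; split=> [t [_ tk] i im|t ts].
  have /(pcan_inj choice.pickleK) ts : prefix_code n t = prefix_code n s by rewrite tk.
  by rewrite -(nth_mkseq (s 0%N) t (_ : (i < n.+1)%N))// ts nth_mkseq.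
split; first by apply: Fn Fs => i im; rewrite ts.
rewrite /= -sk; congr choice.pickle; apply/eq_in_map => i.
by rewrite mem_iota add0n => /ts.
Qed.

Lemma determined_bigcup n (F : set (nat -> V)) :
  F = \bigcup_k (F `&` [set s | prefix_code n s = k]).
Proof.
by apply/seteqP; split=> [s Fs|s [k _ []]//]; exists (prefix_code n s).
Qed.

Lemma trivIset_pieces n (F : set (nat -> V)) (D : nat -> set (nat -> V)) :
  trivIset setT (fun k => F `&` [set s | prefix_code n s = k] `&` D k).
Proof.
by apply/trivIsetP => i j _ _; apply: contra_neqP => /eqP/set0P[s [[[_ <-] _] [[_ <-] _]]].
Qed.

(** Measurable structures are pointed, hence the base point [v0]. *)
Definition paths (v0 : V) : Type := nat -> V.

Variable v0 : V.
HB.instance Definition _ := gen_eqMixin (paths v0).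
HB.instance Definition _ := gen_choiceMixin (paths v0).
HB.instance Definition _ := isPointed.Build (paths v0) (fun=> v0).
HB.instance Definition _ := @isMeasurable.Build (sigma_display cylinders)
  (paths v0) <<s cylinders >> (@sigma_algebra0 _ setT cylinders)
  (@sigma_algebraC (paths v0) cylinders)
  (@sigma_algebra_bigcup _ setT cylinders).

Lemma measurable_cyl n t : measurable (cyl n t : set (paths v0)).
Proof. by apply: sub_gen_smallest; right; exists n, t. Qed.

Lemma measurable_determined n F : determined n F -> measurable (F : set (paths v0)).
Proof.
move=> Fn; rewrite (determined_bigcup n F); apply: bigcup_measurable => k _.
have [->|[s _ ->]] := determined_piece k Fn; first exact: measurable0.
exact: measurable_cyl.
Qed.

Lemma measurable_to_paths d (W : measurableType d) (f : W -> paths v0) :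
  (forall n t, measurable (f @^-1` (cyl n t))) -> measurable_fun setT f.
Proof.
move=> mf; apply: (@measurability _ _ _ _ setT f cylinders) => // _ [A [->|[n [t ->]]] <-].
  by rewrite preimage_set0 setI0; exact: measurable0.
by rewrite setTI; exact: mf.
Qed.

Lemma measurable_future n (B : set (paths v0)) :
  measurable B -> measurable (future n @^-1` B : set (paths v0)).
Proof.
move=> mB; rewrite -[X in measurable X]setTI.
suff mf : measurable_fun setT (future n : paths v0 -> paths v0) by exact: (mf measurableT _ mB).
apply: measurable_to_paths => m t.
apply: (@measurable_determined (n + m)).
by apply: determined_future; exact: determined_cyl.
Qed.

Lemma measurable_fun_determined n d (U : measurableType d) (f : paths v0 -> U) :
  (forall s t, (forall i, (i <= n)%N -> s i = t i) -> f s = f t) ->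
  measurable_fun setT f.
Proof.
move=> fn _ B mB; rewrite setTI; apply: (@measurable_determined n) => s t st /=.
by rewrite (fn s t).
Qed.

End PathSpace.

(** * Real-valued probabilities *)

Section RealProbability.
Context {R : realType} {d : measure_display} {T : measurableType d}.
Variable P : probability T R.
Implicit Types A B : set T.

(** Real values, because the contraction and Markov arguments subtract
    probabilities. *)
Definition pr A : R := fine (P A).

Lemma prE A : measurable A -> P A = (pr A)%:E.
Proof. by move=> mA; rewrite /pr fineK// fin_num_measure. Qed.

Lemma pr_ge0 A : 0 <= pr A.
Proof. exact/fine_ge0/measure_ge0. Qed.

Lemma pr0 : pr set0 = 0.
Proof. by rewrite /pr measure0. Qed.

Lemma prT : pr setT = 1.
Proof. by rewrite /pr probability_setT. Qed.

Lemma le_pr A B : measurable A -> measurable B -> A `<=` B -> pr A <= pr B.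
Proof.
by move=> mA mB AB; rewrite -lee_fin -!prE// le_measure// inE.
Qed.

Lemma pr_le1 A : measurable A -> pr A <= 1.
Proof. by move=> mA; rewrite -prT le_pr. Qed.

Lemma prU_disjoint A B : measurable A -> measurable B -> A `&` B = set0 ->
  pr (A `|` B) = pr A + pr B.
Proof.
move=> mA mB AB0; apply: EFin_inj; rewrite EFinD -!prE//; last exact: measurableU.
by rewrite measureU.
Qed.

Lemma prC A : measurable A -> pr (~` A) = 1 - pr A.
Proof.
move=> mA; rewrite -prT -(setUv A) prU_disjoint ?setICr//; last exact: measurableC.
by rewrite addrC addKr.
Qed.

Lemma pr_split A B : measurable A -> measurable B ->
  pr A = pr (A `&` B) + pr (A `&` ~` B).
Proof.
move=> mA mB; rewrite -prU_disjoint.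
- by rewrite -setIUr setUv setIT.
- exact: measurableI.
- by apply: measurableI => //; exact: measurableC.
- by rewrite setIACA setICr setI0.
Qed.

Lemma prU_le A B : measurable A -> measurable B -> pr (A `|` B) <= pr A + pr B.
Proof.
move=> mA mB; rewrite (pr_split (measurableU _ _ mA mB) mA).
have mU := measurableU _ _ mA mB; have mCA := measurableC mA.
apply: lerD; apply: le_pr => //; do ?exact: measurableI.
by move=> x [[]].
Qed.

Lemma pr_bigcup_le (F : nat -> set T) (b : R) :
  (forall k, measurable (F k)) ->
  (forall n, \sum_(k < n) pr (F k) <= b) -> pr (\bigcup_k F k) <= b.
Proof.
move=> mF Fb; have mUF : measurable (\bigcup_k F k) by exact: bigcup_measurable.
rewrite -lee_fin -prE//; apply: (le_trans (generalized_Boole_inequality P mF mUF)).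
apply: lime_le; first by apply: is_cvg_nneseries => k _ _; exact: measure_ge0.
apply: nearW => n; rewrite (eq_bigr (fun k => (pr (F k))%:E)) => [|k _]; last exact: prE.
by rewrite sumEFin lee_fin big_mkord.
Qed.

Lemma pr_sum_disjoint (I : choiceType) (D : set I) (F : I -> set T) :
  finite_set D -> (forall i, measurable (F i)) -> trivIset D F ->
  pr (\bigcup_(i in D) F i) = \sum_(i \in D) pr (F i).
Proof.
move=> finD mF tF; apply: EFin_inj; rewrite -prE; last first.
  by apply: fin_bigcup_measurable => // i _; exact: mF.
rewrite measure_fin_bigcup//.
rewrite -fsumEFin//.
by apply: eq_fsbigr => i _; exact: prE.
Qed.

Lemma pr1_ae (A : set T) (Q : T -> Prop) :
  measurable A -> pr A = 1 -> (forall x, A x -> Q x) -> {ae P, forall x, Q x}.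
Proof.
move=> mA A1 AQ; exists (~` A); split; first exact: measurableC.
  by apply/eqP; rewrite prE ?prC ?A1 ?subrr//; exact: measurableC.
by move=> x /= nQ Ax; apply: nQ; exact: AQ.
Qed.

Lemma pr1_bigcap (F : nat -> set T) :
  (forall k, measurable (F k)) -> (forall k, pr (F k) = 1) ->
  pr (\bigcap_k F k) = 1.
Proof.
move=> mF F1; have mIF : measurable (\bigcap_k F k) by exact: bigcap_measurableType.
apply/eqP; rewrite eq_le pr_le1//= -subr_le0 -prC// setC_bigcap.
apply: pr_bigcup_le => [k|n]; first exact/measurableC.
by rewrite big1// => k _; rewrite prC// F1 subrr.
Qed.

Lemma pr0_bigcup (F : nat -> set T) :
  (forall k, measurable (F k)) -> (forall k, pr (F k) = 0) ->
  pr (\bigcup_k F k) = 0.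
Proof.
move=> mF F0; apply/eqP; rewrite eq_le pr_ge0 andbT.
by apply: pr_bigcup_le => // n; rewrite big1.
Qed.

End RealProbability.

(** * The Markov property *)

(** The laws [L x] on path space of a Markov chain with state space [S] that
    moves along the edges of [e]. *)
Record markov_laws (R : realType) (V : countType) (v0 : V) (e : rel V)
    (S : set V) (p : V -> V -> R) (L : V -> probability (paths v0) R) : Prop := {
  markov_start : forall x, S x -> pr (L x) [set s | s 0%N = x] = 1;
  markov_step : forall x n s, S x ->
    pr (L x) (cyl n.+1 s) = pr (L x) (cyl n s) * p (s n) (s n.+1);
  markov_supp : forall x y, S x -> p x y != 0 -> e x y /\ S y }.

Section Markov.
Context {R : realType} {V : countType} {v0 : V} {e : rel V} {S : set V}
        {p : V -> V -> R} {L : V -> probability (paths v0) R}.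
Hypotheses (e_conn : connected_graph e) (LP : markov_laws e S p L).

(** The prefixes that the chain started from [x] can follow; all others are
    null, by [cyl_null]. *)
Definition admissible (x : V) (n : nat) : set (nat -> V) :=
  [set s | s 0%N = x /\ forall i, (i < n)%N -> e (s i) (s i.+1) /\ S (s i.+1)].

Lemma admissible_in x n s i : S x -> admissible x n s -> (i <= n)%N -> S (s i).
Proof. by move=> Sx [s0 sS]; case: i => [_|i /sS[]//]; rewrite s0. Qed.

Lemma admissible_dist x n s i :
  admissible x n s -> (i <= n)%N -> (gdist e x (s i) <= i)%N.
Proof.
move=> [s0 sS]; elim: i => [_|i IH i_n]; first by rewrite s0 gdistxx.
rewrite -[leqRHS]addn1 (leq_trans (gdist_triangle e_conn (s i) _ _))//.
by apply: leq_add; [exact/IH/ltnW|apply: gdist_edge => //; have [] := sS _ i_n].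
Qed.

Lemma determined_start x : determined 0 [set s : nat -> V | s 0%N = x].
Proof. by move=> s t st /=; rewrite st. Qed.

Lemma determined_at n (D : set V) : determined n [set s : nat -> V | D (s n)].
Proof. by move=> s t st /=; rewrite (st n). Qed.

Lemma measurable_at n (D : set V) : measurable ([set s | D (s n)] : set (paths v0)).
Proof. by apply: (@measurable_determined _ _ n); exact: determined_at. Qed.

Lemma determined_admissible x n : determined n (admissible x n).
Proof.
move=> s t st [s0 sS]; split; first by rewrite -st.
by move=> i i_n; rewrite -!st ?(ltnW i_n)//; exact: sS.
Qed.

Lemma cyl_null x n s : S x -> ~ admissible x n s -> pr (L x) (cyl n s) = 0.
Proof.
move=> Sx; elim: n => [|n IH] nadm.
  have mx := measurable_determined v0 (@determined_start x).
  apply/eqP; rewrite eq_le pr_ge0 andbT.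
  rewrite -[leRHS](subrr 1) -[X in _ <= _ - X](markov_start LP Sx) -prC//.
  apply: le_pr; [exact: measurable_cyl|exact: measurableC|].
  by move=> t ts t0; apply: nadm; split => //; rewrite -(ts 0%N) ?t0.
rewrite (markov_step LP)//; have [adm|/IH->//] := pselect (admissible x n s); last first.
  by rewrite mul0r.
have [->|p0] := eqVneq (p (s n) (s n.+1)) 0; first by rewrite mulr0.
have [eS Se] := markov_supp LP (admissible_in Sx adm (leqnn n)) p0.
exfalso; apply: nadm; split; first by case: adm.
by move=> i; rewrite ltnS leq_eqVlt => /predU1P[->//|/(adm.2 _)].
Qed.

Lemma determined_null x n (F : set (paths v0)) : S x -> determined n F ->
  (forall s, F s -> ~ admissible x n s) -> pr (L x) F = 0.
Proof.
move=> Sx Fn nadm; rewrite (determined_bigcup n F).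
have piece k := determined_piece k Fn.
apply: pr0_bigcup => k; have [->|[s Fs ->]] := piece k.
- exact: measurable0.
- exact: measurable_cyl.
- exact: pr0.
- by apply: cyl_null => //; exact: nadm.
Qed.

Lemma pr_admissible x n : S x -> pr (L x) (admissible x n) = 1.
Proof.
move=> Sx; have mA := measurable_determined v0 (@determined_admissible x n).
rewrite -[LHS]opprK -[RHS]opprK -[in RHS](subr0 1) opprB.
rewrite -(@determined_null x n (~` admissible x n))//; last first.
  by apply: determinedC; exact: determined_admissible.
by rewrite prC// addrAC subrr sub0r opprK.
Qed.

Lemma pr_admissible_all x : S x -> pr (L x) (\bigcap_n admissible x n) = 1.
Proof.
move=> Sx; apply: pr1_bigcap => k; last exact: pr_admissible.
by apply: (@measurable_determined _ _ k); exact: determined_admissible.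
Qed.

Lemma measurable_admissible_all x :
  measurable (\bigcap_n admissible x n : set (paths v0)).
Proof.
apply: bigcap_measurableType => n _.
by apply: (@measurable_determined _ _ n); exact: determined_admissible.
Qed.

(** Inclusions of events need only be checked on paths that the chain can follow. *)
Lemma le_pr_admissible x (A B : set (paths v0)) : S x ->
  measurable A -> measurable B ->
  (forall s, (forall n, admissible x n s) -> A s -> B s) ->
  pr (L x) A <= pr (L x) B.
Proof.
move=> Sx mA mB AB; have mX := measurable_admissible_all x.
rewrite (pr_split (L x) mA mX) [X in _ + X](_ : _ = 0).
  by rewrite addr0; apply: le_pr => //; [exact: measurableI|move=> s [As Xs]; apply: AB => // n; exact: Xs].
apply/eqP; rewrite eq_le pr_ge0 andbT.
rewrite -[leRHS](subrr 1) -[X in _ <= _ - X](pr_admissible_all Sx) -prC//.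
by apply: le_pr; [apply: measurableI => //; exact: measurableC|exact: measurableC|move=> s []].
Qed.

Lemma pr1_admissible x (A : set (paths v0)) : S x -> measurable A ->
  (forall s, (forall n, admissible x n s) -> A s) -> pr (L x) A = 1.
Proof.
move=> Sx mA XA; apply/eqP; rewrite eq_le pr_le1//= -(prT (L x)).
by apply: le_pr_admissible => // s Xs _; exact: XA.
Qed.

Lemma pr0_admissible x (A : set (paths v0)) : S x -> measurable A ->
  (forall s, (forall n, admissible x n s) -> ~ A s) -> pr (L x) A = 0.
Proof.
move=> Sx mA XA; apply/eqP; rewrite eq_le pr_ge0 andbT -(pr0 (L x)).
by apply: le_pr_admissible => // s Xs /(XA s Xs).
Qed.

Lemma cyl_future (n m : nat) (s t : nat -> V) : s n = t 0%N ->
  cyl n s `&` future n @^-1` cyl m t =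
  cyl (n + m)%N (fun i => if (i <= n)%N then s i else t (i - n)%N).
Proof.
move=> st; apply/seteqP; split=> [u [us ut] i im|u uv].
  by case: leqP => ni; [exact: us|rewrite -ut ?leq_subLR// /future subnKC// ltnW].
split=> [i i_n|i im]; first by rewrite uv ?i_n// (leq_trans i_n)// leq_addr.
rewrite /future uv ?leq_add2l//; case: leqP => [|_]; last by rewrite addKn.
by rewrite -[X in (_ <= X)%N]addn0 leq_add2l leqn0 => /eqP->; rewrite addn0.
Qed.

Let markov_cyl_cyl x n s m t : S x -> S (s n) ->
  pr (L x) (cyl n s `&` future n @^-1` cyl m t) =
  pr (L x) (cyl n s) * pr (L (s n)) (cyl m t).
Proof.
move=> Sx Ss; have [st|st] := eqVneq (s n) (t 0%N); last first.
  rewrite [X in pr _ X = _](_ : _ = set0); last first.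
    apply/seteqP; split=> // u [us ut]; move/eqP: st; apply.
    by rewrite -(us n)// -(ut 0%N)// /future addn0.
  rewrite pr0 [X in _ = _ * X]cyl_null ?mulr0// => -[t0 _].
  by rewrite t0 eqxx in st.
rewrite cyl_future//; elim: m => [|m IH].
  rewrite [X in _ = _ * X](_ : _ = 1) ?mulr1 ?addn0.
    by congr pr; apply/seteqP; split=> u us i i_n; rewrite us// i_n.
  rewrite -(markov_start LP Ss); congr pr; apply/seteqP; split=> u.
    by move=> /(_ 0%N isT); rewrite st.
  by move=> u0 i; rewrite leqn0 => /eqP->; rewrite -st.
rewrite addnS (markov_step LP)// IH (markov_step LP)// mulrA ltnNge leq_addr/=.
rewrite -addnS; congr (_ * p _ _); last by rewrite addKn.
case: leqP => [|_]; last by rewrite addKn.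
by rewrite -[X in (_ <= X)%N]addn0 leq_add2l leqn0 => /eqP->; rewrite addn0.
Qed.

(** Both sides are measures in [B], so it is enough to compare them on
    cylinders. *)
Lemma markov_cyl x n s (B : set (paths v0)) : S x -> S (s n) -> measurable B ->
  pr (L x) (cyl n s `&` future n @^-1` B) =
  pr (L x) (cyl n s) * pr (L (s n)) B.
Proof.
move=> Sx Ss mB; have mc := measurable_cyl v0 n s.
pose Q (A : set (paths v0)) := pr (L x) (cyl n s `&` future n @^-1` A) =
  pr (L x) (cyl n s) * pr (L (s n)) A.
apply: (@dynkin_induction _ (paths v0) (@cylinders V) Q) => //.
- exact: cylinders_setI.
- by rewrite /Q preimage_setT setIT prT mulr1.
- move=> _ [->|[m [t ->]]]; rewrite /Q; last exact: markov_cyl_cyl.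
  by rewrite preimage_set0 setI0 !pr0 mulr0.
- move=> A mA; rewrite /Q preimage_setC => QA.
  rewrite prC// mulrBr mulr1 -QA.
  rewrite [X in _ = X - _](pr_split (L x) mc (measurable_future n mA)).
  by rewrite addrAC subrr add0r.
- move=> F mF tF QF; rewrite /Q preimage_bigcup setI_bigcupr.
  have mG k : measurable (cyl n s `&` future n @^-1` (F k) : set (paths v0)).
    by apply: measurableI => //; exact: measurable_future.
  apply: EFin_inj; rewrite EFinM -!prE//; try exact: bigcup_measurable.
  rewrite !measure_bigcup//; last first.
    apply/trivIsetP => i j _ _ ij; rewrite setIACA setIid -preimage_setI.
    by have /trivIsetP/(_ i j I I ij)-> := tF; rewrite preimage_set0 setI0.
  rewrite (prE _ mc) -nneseriesZl//.
  apply: eq_eseriesr => k _; apply: etrans (prE _ (mG k)) _.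
  by rewrite QF EFinM; congr (_ * _)%E; apply/esym/prE.
Qed.

(** The Markov property at a fixed time [n]: given an event [F] of the first [n]
    steps, a uniform bound over the possible positions at time [n] integrates. *)
Lemma markov_le x n (F B : set (paths v0)) (b : R) : S x ->
  determined n F -> measurable B -> 0 <= b ->
  (forall s, F s -> admissible x n s -> pr (L (s n)) B <= b) ->
  pr (L x) (F `&` future n @^-1` B) <= pr (L x) F * b.
Proof.
move=> Sx Fn mB b0 Bb.
have mF := measurable_determined v0 Fn; have mS := measurable_future n mB.
rewrite -lee_fin EFinM -!prE//; last exact: measurableI.
rewrite [in leLHS](determined_bigcup n F) setI_bigcupl.
rewrite [in leRHS](determined_bigcup n F).
have piece k := determined_piece k Fn.
have mp k : measurable (F `&` [set s | prefix_code n s = k] : set (paths v0)).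
  by have [->|[s _ ->]] := piece k; [exact: measurable0|exact: measurable_cyl].
rewrite !measure_bigcup//=.
- rewrite muleC -nneseriesZl//.
  apply: lee_nneseries => [k _ _|k _]; first exact: measure_ge0.
  have [->|[s Fs ->]] := piece k; first by rewrite set0I !measure0 mule0.
  have mc := measurable_cyl v0 n s; have mcS := measurableI _ _ mc mS.
  apply: (le_trans (y := (b * pr (L x) (cyl n s))%:E)); last first.
    by rewrite EFinM; apply: lee_wpmul2l => //; rewrite -prE.
  suff: pr (L x) (cyl n s `&` future n @^-1` B) <= b * pr (L x) (cyl n s).
    by rewrite -lee_fin; apply: le_trans; rewrite -prE.
  rewrite mulrC; have [adm|nadm] := pselect (admissible x n s).
    rewrite markov_cyl//; last exact: admissible_in adm (leqnn n).
    by rewrite ler_wpM2l ?pr_ge0//; exact: Bb.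
  rewrite [X in _ <= X * _]cyl_null// mul0r -(@cyl_null x n s)//.
  exact: le_pr.
- have := @trivIset_pieces _ n F (fun=> setT).
  by under eq_fun do rewrite setIT.
- by move=> k _; exact: measurableI.
- exact: trivIset_pieces.
Qed.

Lemma markov_ge x n (F B : set (paths v0)) (b : R) : S x ->
  determined n F -> measurable B -> b <= 1 ->
  (forall s, F s -> admissible x n s -> b <= pr (L (s n)) B) ->
  pr (L x) F * b <= pr (L x) (F `&` future n @^-1` B).
Proof.
move=> Sx Fn mB b1 Bb.
have mF := measurable_determined v0 Fn; have mS := measurable_future n mB.
have : pr (L x) (F `&` future n @^-1` (~` B)) <= pr (L x) F * (1 - b).
  apply: markov_le => //; [exact: measurableC|by rewrite subr_ge0|].
  by move=> s Fs adm; rewrite prC// lerD2l lerN2; exact: Bb.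
rewrite preimage_setC {2}(pr_split (L x) mF mS) mulrBr mulr1.
rewrite (pr_split (L x) mF mS); lra.
Qed.

Lemma markov_at x n y (B : set (paths v0)) : S x -> measurable B ->
  pr (L x) ([set s | s n = y] `&` future n @^-1` B) =
  pr (L x) [set s | s n = y] * pr (L y) B.
Proof.
move=> Sx mB; have Fn := @determined_at n [set y].
apply/eqP; rewrite eq_le; apply/andP; split.
  by apply: markov_le => //; [exact: pr_ge0|move=> s -> _].
by apply: markov_ge => //; [exact: pr_le1|move=> s -> _].
Qed.

End Markov.

(** * Invariant events *)

(** Two weights of total mass 2 with a common part [m] average a function with
    values in [[lo, hi]] to within the complement of that common part. *)
Lemma overlap_contraction (R : realDomainType) (I : Type) (r : seq I)
    (a b m u : I -> R) (lo hi : R) :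
  (forall i, m i <= a i /\ m i <= b i) ->
  (forall i, (a i = m i /\ b i = m i) \/ lo <= u i <= hi) ->
  \sum_(i <- r) a i = \sum_(i <- r) b i ->
  \sum_(i <- r) a i * u i - \sum_(i <- r) b i * u i <=
  (\sum_(i <- r) a i - \sum_(i <- r) m i) * (hi - lo).
Proof.
move=> m_le u_in ab; rewrite mulrBr [X in _ <= _ - X * _](_ : _ =
  \sum_(i <- r) b i - \sum_(i <- r) m i); last by rewrite ab.
rewrite -!sumrB !mulr_suml -!sumrB; apply: ler_sum => i _.
rewrite -subr_ge0; have [ma mb] := m_le i.
have [[-> ->]|/andP[lou uhi]] := u_in i; first by rewrite !subrr !mul0r subrr.
rewrite (_ : _ - _ = (a i - m i) * (hi - u i) + (b i - m i) * (u i - lo)); last by ring.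
by rewrite addr_ge0// mulr_ge0// subr_ge0.
Qed.

Section ZeroOne.
Context {R : realType} {V : countType} {v0 : V} {e : rel V} {S : set V}
        {p : V -> V -> R} {L : V -> probability (paths v0) R}.
Hypotheses (e_conn : connected_graph e) (LP : markov_laws e S p L).
Hypothesis ball_finite : forall x (r : R), finite_set (gball e x r).

(** Averaging over the two times [n] and [n.+1] copes with a bipartite graph,
    where the laws at a single time from two neighbours never overlap. *)
Definition two_step (x : V) (n : nat) (z : V) : R :=
  pr (L x) [set s | s n = z] + pr (L x) [set s | s n.+1 = z].

(** A Doeblin condition in which the time may depend on the two starting points,
    but the common mass may not. *)
Definition overlapping (delta : R) : Prop :=
  forall x y, S x -> S y -> exists n (D : set V) (m : V -> R),
    [/\ finite_set D, forall z, 0 <= m z,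
        forall z, D z -> m z <= two_step x n z /\ m z <= two_step y n z &
        delta <= \sum_(z \in D) m z].

Lemma pr_at_notin x n z : S x -> ~ S z -> pr (L x) [set s | s n = z] = 0.
Proof.
move=> Sx Sz; apply: (pr0_admissible LP Sx) => [|s Xs sz].
  exact: (measurable_at n [set z]).
by apply: Sz; rewrite -sz; exact: (admissible_in Sx (Xs n)).
Qed.

Lemma decompose_at x n (A : set (paths v0)) (D : set V) : S x -> measurable A ->
  finite_set D -> gball e x (n%:R : R) `<=` D ->
  pr (L x) A = \sum_(z \in D) pr (L x) ([set s | s n = z] `&` A).
Proof.
move=> Sx mA finD xD.
have mF z : measurable ([set s | s n = z] `&` A : set (paths v0)).
  by apply: measurableI => //; exact: (measurable_at n [set z]).
rewrite -pr_sum_disjoint//; last first.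
  by apply/trivIsetP => i j _ _; apply: contra_neqP => /eqP/set0P[s [[<- _] [<- _]]].
have mU : measurable (\bigcup_(z in D) ([set s | s n = z] `&` A) : set (paths v0)).
  by apply: fin_bigcup_measurable => // z _; exact: mF.
apply/eqP; rewrite eq_le; apply/andP; split; last first.
  by apply: le_pr => // s [z _ []].
apply: (le_pr_admissible LP Sx) => // s Xs As; exists (s n) => //.
by apply: xD; rewrite /gball /= ler_nat; exact: (admissible_dist e_conn (Xs n)).
Qed.

Lemma sum_at x n (D : set V) : S x -> finite_set D -> gball e x (n%:R : R) `<=` D ->
  \sum_(z \in D) pr (L x) [set s | s n = z] = 1.
Proof.
move=> Sx finD xD; rewrite -(prT (L x)) (decompose_at Sx measurableT finD xD).
by apply: eq_fsbigr => z _; rewrite setIT.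
Qed.

Section Invariant.
Variable A : set (paths v0).
Hypotheses (mA : measurable A) (A_inv : future 1 @^-1` A = A).

Lemma invariant_future n : future n @^-1` A = A.
Proof.
elim: n => [|n IH]; first by apply/seteqP; split.
by rewrite -[in RHS]IH -[in RHS]A_inv -addn1; apply/seteqP; split=> s /=; rewrite future_future.
Qed.

Lemma invariant_harmonic x n (D : set V) :
  S x -> finite_set D -> gball e x (n%:R : R) `<=` D ->
  pr (L x) A = \sum_(z \in D) pr (L x) [set s | s n = z] * pr (L z) A.
Proof.
move=> Sx finD xD; rewrite (decompose_at Sx mA finD xD).
by apply: eq_fsbigr => z _; rewrite -{1}(invariant_future n) (markov_at LP).
Qed.

(** Liouville property: splitting off the common part of the laws started from
    [x] and [y] contracts the oscillation of [pr (L x) A] by a fixed factor. *)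
Lemma invariant_constant (delta : R) x y : 0 < delta -> overlapping delta ->
  S x -> S y -> pr (L x) A = pr (L y) A.
Proof.
move=> delta_gt0 ov; pose u z := pr (L z) A.
pose U := [set u z | z in S]; move=> Sx Sy.
have U0 : U !=set0 by exists (u x); exists x.
have Ub : has_ubound U by exists 1 => _ [z _ <-]; exact: pr_le1.
have Lb : has_lbound U by exists 0 => _ [z _ <-]; exact: pr_ge0.
have leU z : S z -> inf U <= u z <= sup U.
  by move=> Sz; rewrite ge_inf ?ub_le_sup//; exists z.
have contract a b : S a -> S b -> u a - u b <= (1 - delta / 2) * (sup U - inf U).
  move=> Sa Sb; have [n [D [m [finD m_ge0 m_le m_sum]]]] := ov a b Sa Sb.
  pose E := D `|` gball e a (n.+1%:R : R) `|` gball e b (n.+1%:R : R).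
  have finE : finite_set E by rewrite !finite_setU.
  pose m' z := if z \in D then m z else 0.
  have m'_sum : \sum_(z \in E) m' z = \sum_(z \in D) m z.
    rewrite (fsbigID D)//= [X in _ + X]fsbig1 ?addr0; last first.
      by move=> z [_ /= nD]; rewrite /m' memNset.
    have -> : E `&` D = D by apply/setIidPr => z Dz; left; left.
    by apply: eq_fsbigr => z Dz; rewrite /m' Dz.
  have m'_le z : m' z <= two_step a n z /\ m' z <= two_step b n z.
    rewrite /m'; case: ifPn => [/set_mem/m_le//|_].
    by rewrite /two_step !addr_ge0 ?pr_ge0.
  have ball_E k c : (k <= n.+1)%N -> gball e c (n.+1%:R : R) `<=` E -> gball e c (k%:R : R) `<=` E.
    move=> kn cE z cz; apply: cE; rewrite /gball /=.
    by apply: le_trans cz _; rewrite ler_nat.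
  have aE : gball e a (n.+1%:R : R) `<=` E by move=> z ?; left; right.
  have bE : gball e b (n.+1%:R : R) `<=` E by move=> z ?; right.
  have two_u c : S c -> gball e c (n.+1%:R : R) `<=` E ->
      u c + u c = \sum_(z \in E) two_step c n z * u z.
    move=> Sc cE; rewrite {1}/u (invariant_harmonic Sc finE (ball_E n c (leqnSn n) cE)).
    rewrite {1}/u (invariant_harmonic Sc finE (ball_E n.+1 c (leqnn _) cE)).
    by rewrite -fsbig_split//=; apply: eq_fsbigr => z _; rewrite -mulrDl.
  have two_1 c : S c -> gball e c (n.+1%:R : R) `<=` E -> \sum_(z \in E) two_step c n z = 2.
    move=> Sc cE; rewrite /two_step fsbig_split//=.
    by rewrite !sum_at//; exact: ball_E.
  have null c z : S c -> ~ S z -> two_step c n z = 0.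
    by move=> Sc Sz; rewrite /two_step !pr_at_notin// addr0.
  have m'0 z : ~ S z -> m' z = 0.
    move=> Sz; apply/eqP; rewrite eq_le -{1}(null a z)//; rewrite (m'_le z).1/=.
    by rewrite /m'; case: ifP.
  have inner z : two_step a n z = m' z /\ two_step b n z = m' z \/
      inf U <= u z <= sup U.
    have [/leU|nSz] := pselect (S z); [by right|left].
    by rewrite !null// m'0.
  have uab : (u a + u a) - (u b + u b) <= (2 - delta) * (sup U - inf U).
    have inf_sup : inf U <= sup U by have /andP[/le_trans] := leU _ Sx; exact.
    apply: (@le_trans _ _ ((2 - \sum_(z \in E) m' z) * (sup U - inf U))); last first.
      by rewrite m'_sum ler_wpM2r ?subr_ge0// lerD2l lerN2.
    rewrite !two_u// -[X in (X - _) * _](two_1 a)//.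
    rewrite !fsbig_finite//=; apply: overlap_contraction => //.
    by move: (two_1 a Sa aE) (two_1 b Sb bE); rewrite !fsbig_finite//= => -> ->.
  nra.
have sup_u b : S b -> sup U <= u b + (1 - delta / 2) * (sup U - inf U).
  move=> Sb; apply: ge_sup => // _ [a Sa <-].
  by rewrite -lerBlDl; exact: contract.
have sup_inf : sup U - (1 - delta / 2) * (sup U - inf U) <= inf U.
  by apply: lb_le_inf => // _ [b Sb <-]; rewrite lerBlDr; exact: sup_u.
have [/andP[] + + /andP[]] := (leU x Sx, leU y Sy).
rewrite -/(u x) -/(u y).
have : sup U <= inf U by nra.
lra.
Qed.

(** An invariant event is independent of every cylinder, hence of itself. *)
Lemma invariant_zero_one (delta : R) x : 0 < delta -> overlapping delta ->
  S x -> pr (L x) A = 0 \/ pr (L x) A = 1.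
Proof.
move=> delta_gt0 ov Sx.
suff indep : pr (L x) (A `&` A) = pr (L x) A * pr (L x) A.
  move: indep; rewrite setIid => /eqP; rewrite -subr_eq0 -{1}[pr _ _]mulr1 -mulrBr.
  by rewrite mulf_eq0 subr_eq0 => /orP[]/eqP; [left|right].
pose Q (B : set (paths v0)) := pr (L x) (B `&` A) = pr (L x) B * pr (L x) A.
apply: (@dynkin_induction _ (paths v0) (@cylinders V) Q) => //.
- exact: cylinders_setI.
- by rewrite /Q setTI prT mul1r.
- move=> _ [->|[n [s ->]]]; rewrite /Q; first by rewrite set0I pr0 mul0r.
  have mc := measurable_cyl v0 n s.
  have [adm|nadm] := pselect (@admissible V e S x n s).
    have Ss := admissible_in Sx adm (leqnn n).
    rewrite -{1}(invariant_future n) (markov_cyl LP)//.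
    by rewrite (invariant_constant delta_gt0 ov Ss Sx).
  rewrite [in RHS](cyl_null LP Sx nadm) mul0r; apply/eqP; rewrite eq_le pr_ge0 andbT.
  by rewrite -(cyl_null LP Sx nadm) le_pr//; exact: measurableI.
- move=> B mB; rewrite /Q => QB.
  rewrite prC// mulrBl mul1r -QB.
  have := pr_split (L x) mA mB; rewrite [A `&` B]setIC [A `&` ~` B]setIC; lra.
- move=> F mF tF QF; rewrite /Q setI_bigcupl.
  have mG k : measurable (F k `&` A) by exact: measurableI.
  apply: EFin_inj; rewrite mulrC EFinM -!prE//; try exact: bigcup_measurable.
  rewrite !measure_bigcup//; last first.
    exact: trivIset_setIr.
  rewrite (prE _ mA) -nneseriesZl//.
  apply: eq_eseriesr => k _; apply: etrans (prE _ (mG k)) _.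
  by rewrite QF EFinM muleC; congr (_ * _)%E; apply/esym/prE.
Qed.

End Invariant.

(** An invariant random variable is almost surely constant: the constant is the
    infimum of the levels below which it lies with probability one. *)
Lemma invariant_variable (delta c C : R) (Z : paths v0 -> \bar R) x :
  0 < delta -> overlapping delta -> S x ->
  measurable_fun [set: paths v0] Z -> (forall s, Z (future 1 s) = Z s) ->
  0 < pr (L x) [set s | c%:E <= Z s]%E -> 0 < pr (L x) [set s | Z s <= C%:E]%E ->
  exists2 C0 : R, c <= C0 & forall y, S y -> pr (L y) [set s | Z s = C0%:E] = 1.
Proof.
move=> delta_gt0 ov Sx mZ Z_inv Zc ZC.
have mle (a : R) : measurable [set s | Z s <= a%:E]%E.
  by rewrite -[X in measurable X]setTI; apply: emeasurable_fun_infty_c.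
have mge (a : R) : measurable [set s | a%:E <= Z s]%E.
  by rewrite -[X in measurable X]setTI; apply: emeasurable_fun_c_infty.
have mlt (a : R) : measurable [set s | Z s < a%:E]%E.
  by rewrite -[X in measurable X]setTI; apply: emeasurable_fun_infty_o.
have meq (a : R) : measurable [set s | Z s = a%:E].
  rewrite (_ : mkset _ = [set s | Z s <= a%:E]%E `&` [set s | a%:E <= Z s]%E).
    exact: measurableI.
  apply/seteqP; split=> s /= => [->|[Za aZ]]; first by split.
  by apply/eqP; rewrite eq_le Za.
have inv (Q : set (\bar R)) : future 1 @^-1` [set s | Q (Z s)] = [set s | Q (Z s)].
  by apply/seteqP; split=> s /=; rewrite Z_inv.
have {}ZC : pr (L x) [set s | Z s <= C%:E]%E = 1.
  have := @invariant_zero_one _ (mle C) (inv [set z | z <= C%:E]%E) delta x delta_gt0 ov Sx.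
  by move=> [] // Z0; rewrite Z0 ltxx in ZC.
have {}Zc : pr (L x) [set s | c%:E <= Z s]%E = 1.
  have := @invariant_zero_one _ (mge c) (inv [set z | c%:E <= z]%E) delta x delta_gt0 ov Sx.
  by move=> [] // Z0; rewrite Z0 ltxx in Zc.
pose E := [set a : R | pr (L x) [set s | Z s <= a%:E]%E = 1].
have E_ge a : E a -> c <= a.
  rewrite leNgt => Ea; apply/negP => ac.
  have := pr_split (L x) (mle a) (mge c).
  rewrite Ea [X in _ = pr _ X + _](_ : _ = set0) ?pr0 ?add0r; last first.
    apply/seteqP; split=> // s /= [Za cZ].
    by have := le_trans cZ Za; rewrite lee_fin leNgt ac.
  have : pr (L x) ([set s | Z s <= a%:E]%E `&` ~` [set s | c%:E <= Z s]%E) <= 0.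
    rewrite -[leRHS](subrr 1) -[X in _ <= _ - X]Zc -prC//; apply: le_pr.
    - by apply: measurableI => //; exact: measurableC.
    - exact: measurableC.
    - by move=> s [].
  lra.
have infE : has_inf E by split; [exists C|exists c => a /E_ge].
pose C0 := inf E; exists C0; first by apply: lb_le_inf => [|a /E_ge//]; exists C.
have le1 : pr (L x) [set s | Z s <= C0%:E]%E = 1.
  have -> : [set s | Z s <= C0%:E]%E =
      \bigcap_k [set s | Z s <= (C0 + k.+1%:R^-1)%:E]%E.
    apply/seteqP; split=> s /= Zs; first by move=> k _ /=; rewrite (le_trans Zs)// lee_fin lerDl.
    have {}Zs k : (Z s <= (C0 + k.+1%:R^-1)%:E)%E := Zs k I.
    rewrite leNgt; apply/negP; case: (Z s) Zs => [z|/(_ 0%N)//|//] Zs.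
    rewrite lte_fin => /ltr_add_invr[k] /=; rewrite ltNge.
    by have := Zs k; rewrite lee_fin => ->.
  apply: pr1_bigcap => k; first exact: mle.
  have k_gt0 : 0 < k.+1%:R^-1 :> R by rewrite invr_gt0.
  have [a Ea /ltW aC0] := inf_adherent k_gt0 infE.
  apply/eqP; rewrite eq_le pr_le1//= -[leLHS]Ea.
  by apply: le_pr => // s /= /le_trans; apply; rewrite lee_fin.
have lt0 : pr (L x) [set s | Z s < C0%:E]%E = 0.
  have -> : [set s | Z s < C0%:E]%E =
      \bigcup_k [set s | Z s <= (C0 - k.+1%:R^-1)%:E]%E.
    apply/seteqP; split=> [s /=|s [k _] /= Zs]; last first.
      by rewrite (le_lt_trans Zs)// lte_fin ltrBlDr ltrDl invr_gt0.
    case Zs : (Z s) => [z| |]//; last by exists 0%N => //=; rewrite Zs leNye.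
    rewrite lte_fin => /ltr_add_invr[k] zk; exists k => //=.
    by rewrite Zs lee_fin lerBrDr ltW.
  apply: pr0_bigcup => k; first exact: mle.
  have [//|Ek] := @invariant_zero_one _ (mle (C0 - k.+1%:R^-1))
    (inv [set z | z <= (C0 - k.+1%:R^-1)%:E]%E) delta x delta_gt0 ov Sx.
  have := ge_inf infE.2 Ek; rewrite -/C0 lerBrDr gerDl leNgt.
  by rewrite invr_gt0 ltr0n.
have setE : [set s | Z s = C0%:E] =
    [set s | Z s <= C0%:E]%E `&` ~` [set s | Z s < C0%:E]%E.
  apply/seteqP; split=> s /= => [->|[Zle /negP]]; first by split; [|rewrite ltxx].
  by rewrite -leNgt => Zge; apply/eqP; rewrite eq_le Zle.
have eq1 : pr (L x) [set s | Z s = C0%:E] = 1.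
  have both0 : pr (L x) ([set s | Z s <= C0%:E]%E `&` [set s | Z s < C0%:E]%E) = 0.
    apply/eqP; rewrite eq_le pr_ge0 andbT -lt0; apply: le_pr => //.
    exact: measurableI.
  have := pr_split (L x) (mle C0) (mlt C0).
  by rewrite le1 both0 add0r setE => <-.
move=> y Sy; rewrite -eq1.
exact: (@invariant_constant _ (meq C0) (inv [set C0%:E]) delta y x).
Qed.

End ZeroOne.

(** * Growth rates *)

Section Growth.
Context {R : realType}.
Implicit Types a b c x y M : R.

Lemma powR_le a x y : 0 <= a -> 0 <= x -> x <= y -> x `^ a <= y `^ a.
Proof.
by move=> a0 x0 xy; apply: ge0_ler_powR => //; rewrite nnegrE// (le_trans x0).
Qed.

Lemma powR_split a b x : 0 < x -> x `^ (a + b) = x `^ a * x `^ b.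
Proof. by move=> x0; rewrite powRD// (gt_eqF x0) implybT. Qed.

Lemma powRK a x : 0 < a -> 0 <= x -> (x `^ (1 / a)) `^ a = x.
Proof. by move=> a0 x0; rewrite -powRrM divfK ?gt_eqF// powRr1. Qed.

Lemma powRKV a x : 0 < a -> 0 <= x -> (x `^ a) `^ (1 / a) = x.
Proof. by move=> a0 x0; rewrite -powRrM mulrC divfK ?gt_eqF// powRr1. Qed.

Lemma powR_powRV_le a x y : 0 < a -> 0 <= x -> 0 <= y -> x `^ a <= y -> x <= y `^ (1 / a).
Proof.
move=> a0 x0 y0 xy; rewrite -[leLHS](powRKV a0 x0).
by apply: powR_le => //; [rewrite divr_ge0// ltW|exact: powR_ge0].
Qed.

Lemma powRV_le a x y : 0 < a -> 0 <= x -> 0 <= y -> x <= y `^ (1 / a) -> x `^ a <= y.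
Proof.
by move=> a0 x0 y0 xy; rewrite -[leRHS](powRK a0 y0) powR_le// ltW.
Qed.

(** This lets part of a Gaussian exponent absorb the polynomial volume growth. *)
Lemma powR_le_expR a c : 0 <= a -> 0 < c ->
  exists2 K : R, 0 < K & forall v : R, 0 < v -> v `^ a <= K * expR (c * v).
Proof.
move=> a0 c0; have [->|a_neq0] := eqVneq a 0.
  exists 1 => // v v0; rewrite powRr0 mul1r -expR0 ler_expR mulr_ge0// ltW//.
have a_gt0 : 0 < a by rewrite lt0r a_neq0.
have ca : 0 < c / a by rewrite divr_gt0.
exists ((c / a) `^ (- a)) => [|v v0]; first exact: powR_gt0.
have [c_ge0 v_ge0] : 0 <= c / a /\ 0 <= v by split; exact: ltW.
rewrite powRN mulrC ler_pdivlMr ?powR_gt0// -powRM// mulrC.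
rewrite (_ : c * v = (c / a * v) * a); last by field; rewrite gt_eqF.
rewrite expRM; apply: powR_le => //; first exact: mulr_ge0.
by rewrite (le_trans _ (expR_ge1Dx _))// lerDr.
Qed.

Definition lnln x : R := ln (ln x).

Lemma near_le_lnln M : \forall x \near +oo, M <= lnln x.
Proof.
near=> x.
have x_gt0 : 0 < x by near: x; exact: nbhs_pinfty_gt.
have x_ge : expR (expR M) <= x by near: x; exact: nbhs_pinfty_ge.
have lx : expR M <= ln x by rewrite -[leLHS]expRK ler_ln// posrE expR_gt0.
rewrite -(expRK M) ler_ln ?posrE ?expR_gt0//.
exact: lt_le_trans (expR_gt0 _) lx.
Unshelve. all: by end_near. Qed.

Lemma near_le_powR a M : 0 < a -> \forall x \near +oo, M <= x `^ a.
Proof.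
move=> a0; near=> x; rewrite (@le_trans _ _ `|M|)// ?ler_norm//.
rewrite -[leLHS](powRK a0)//; apply: powR_le; [exact: ltW|exact: powR_ge0|].
by near: x; exact: nbhs_pinfty_ge.
Unshelve. all: by end_near. Qed.

Lemma near_lnln_le_powR a M : 0 < a -> \forall x \near +oo, M * lnln x <= x `^ a.
Proof.
move=> a0; have a2 : 0 < a / 2 by rewrite divr_gt0.
near=> x.
have x_gt1 : 1 < x by near: x; exact: nbhs_pinfty_gt.
have x_gt0 : 0 < x := lt_trans ltr01 x_gt1.
have l0 : 0 <= lnln x by near: x; exact: near_le_lnln.
have big : `|M| / (a / 2) <= x `^ (a / 2) by near: x; exact: near_le_powR.
have lnx : ln x <= x `^ (a / 2) / (a / 2).
  rewrite ler_pdivlMr// mulrC -ln_powR ltW// ln_sublinear// powR_gt0//.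
have lnlnx : lnln x <= x `^ (a / 2) / (a / 2).
  by apply: le_trans lnx; rewrite ltW// ln_sublinear// ln_gt0.
apply: (@le_trans _ _ (`|M| * (x `^ (a / 2) / (a / 2)))).
  by rewrite (le_trans (ler_wpM2r l0 (ler_norm M)))// ler_wpM2l.
rewrite mulrCA [_ `^ a](_ : _ = x `^ (a / 2) * x `^ (a / 2)).
  by rewrite ler_wpM2l// powR_ge0.
by rewrite -powR_split//; congr (powR _ _); field.
Unshelve. all: by end_near. Qed.

Lemma near_lnln_double : \forall x \near +oo, lnln (2 * x) <= 2 * lnln x.
Proof.
near=> x.
have x_gt2 : 2 < x by near: x; exact: nbhs_pinfty_gt.
have x_gt0 : 0 < x by rewrite (lt_trans _ x_gt2).
have x_ge : expR 2 <= x by near: x; exact: nbhs_pinfty_ge.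
have lx2 : 2 <= ln x by rewrite -[leLHS](expRK 2) ler_ln ?posrE ?expR_gt0.
have lx_gt0 : 0 < ln x by rewrite (lt_le_trans _ lx2).
rewrite /lnln [leRHS]mulr_natl -lnXn// ler_ln ?posrE ?exprn_gt0//; last first.
  by rewrite ln_gt0//; lra.
rewrite lnM ?posrE//; apply: (@le_trans _ _ (2 * ln x)); last first.
  by rewrite expr2 ler_wpM2r// ltW.
by rewrite mulr_natl mulr2n lerD2r ler_ln ?posrE// ltW.
Unshelve. all: by end_near. Qed.

Lemma lnln_le x y : 1 < x -> x <= y -> lnln x <= lnln y.
Proof.
move=> x1 xy; have y1 := lt_le_trans x1 xy.
have x0 := lt_trans ltr01 x1; have y0 := lt_trans ltr01 y1.
by rewrite /lnln !ler_ln ?posrE ?ln_gt0.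
Qed.

(** Passing from a real variable to a sequence of natural times. *)
Lemma near_seq (t : nat -> nat) (P : R -> Prop) :
  (forall n, (n <= t n)%N) -> (\forall x \near +oo, P x) ->
  \forall n \near \oo, P (t n)%:R.
Proof.
move=> t_ge [M [_ PM]]; exists (Num.truncn `|M|).+1 => // n /= Mn.
apply: PM; apply: (le_lt_trans (ler_norm M)).
apply: (@lt_le_trans _ _ (Num.truncn `|M|).+1%:R); first exact: truncnS_gt.
by rewrite ler_nat (leq_trans Mn).
Qed.

(** [n^a (log log n)^b]: both normalisations are of this form, with
    [a = 1 / beta] and [b = 1 - 1 / beta] or [b = - 1 / beta]. *)
Definition rate a b x : R := x `^ a * lnln x `^ b.

Lemma near_rate_ge a b M : 0 < a -> \forall x \near +oo, M <= rate a b x.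
Proof.
move=> a_gt0; have a2 : 0 < a / 2 by rewrite divr_gt0.
have b1_gt0 : 0 < `|b| + 1 by rewrite ltr_pwDr.
near=> x.
have x_gt0 : 0 < x by near: x; exact: nbhs_pinfty_gt.
have l1 : 1 <= lnln x by near: x; exact: near_le_lnln.
have Mx : M <= x `^ (a / 2) by near: x; exact: near_le_powR.
have lx : 1 * lnln x <= x `^ (a / 2 / (`|b| + 1)).
  by near: x; apply: near_lnln_le_powR; rewrite divr_gt0.
apply: (le_trans Mx); rewrite /rate.
rewrite [x `^ a](_ : _ = x `^ (a / 2) * x `^ (a / 2)); last first.
  by rewrite -powR_split//; congr (powR _ _); field.
rewrite -mulrA ler_peMr ?powR_ge0//.
have l_gt0 : 0 < lnln x by rewrite (lt_le_trans ltr01).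
apply: (@le_trans _ _ (lnln x `^ (`|b| + b))).
  by rewrite -(powRr0 (lnln x)) ler_powR// -lerBlDr sub0r -normrN ler_norm.
rewrite powR_split// ler_wpM2r ?powR_ge0//.
apply: (@le_trans _ _ (lnln x `^ (`|b| + 1))); first by rewrite ler_powR// lerDl.
apply: (@le_trans _ _ ((x `^ (a / 2 / (`|b| + 1))) `^ (`|b| + 1))).
  by apply: powR_le; [exact: ltW|exact: ltW|rewrite -[lnln x]mul1r].
by rewrite -powRrM divfK ?gt_eqF.
Unshelve. all: by end_near. Qed.

Lemma lnln_succ_le x : 1 <= x -> 1 <= ln x -> 1 <= lnln x ->
  lnln (x + 1) <= (1 + x^-1) * lnln x.
Proof.
move=> x1 lx1 llx1; have x0 : 0 < x by rewrite (lt_le_trans ltr01).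
have lx0 : 0 < ln x by rewrite (lt_le_trans ltr01).
have xV : 0 < x^-1 by rewrite invr_gt0.
have x1V : 1 + x^-1 > 0 by rewrite ltr_pwDl// ltW.
have ln1 : ln (1 + x^-1) <= x^-1 by rewrite le_ln1Dx// (lt_trans _ xV)// ltrN10.
have step : ln (x + 1) <= (1 + x^-1) * ln x.
  rewrite (_ : x + 1 = x * (1 + x^-1)); last by field; rewrite gt_eqF.
  rewrite lnM ?posrE// mulrDl mul1r lerD2l (le_trans ln1)// ler_peMr// ltW//.
have lx10 : 0 < ln (x + 1) by rewrite ln_gt0// ltrDr.
apply: (@le_trans _ _ (ln ((1 + x^-1) * ln x))).
  by rewrite ler_ln ?posrE// mulr_gt0.
rewrite lnM ?posrE// mulrDl mul1r addrC lerD2l (le_trans ln1)// ler_peMr// ltW//.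
Qed.

(** The normalisations vary slowly: this makes the limits below insensitive to a
    shift of time. *)
Lemma near_rate_succ a b (eta : R) : 0 <= a -> 0 < eta -> \forall x \near +oo,
  rate a b (x + 1) <= (1 + eta) * rate a b x /\
  rate a b x <= (1 + eta) * rate a b (x + 1).
Proof.
move=> a_ge0 eta_gt0; pose c := a + `|b| + 1.
have c_gt0 : 0 < c by rewrite /c ltr_pwDr// addr_ge0.
have c_ge0 := ltW c_gt0.
have eta1 : 1 < 1 + eta by rewrite ltrDl.
have root : 1 < (1 + eta) `^ (1 / c).
  have : 1 `^ (1 / c) < (1 + eta) `^ (1 / c); last by rewrite powR1.
  have eta1_ge0 : 0 <= 1 + eta by rewrite addr_ge0// ltW.
  by apply: gt0_ltr_powR; rewrite ?divr_gt0 ?nnegrE.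
near=> x.
have x_gt1 : 1 < x by near: x; exact: nbhs_pinfty_gt.
have x_ge1 := ltW x_gt1; have x_gt0 := lt_trans ltr01 x_gt1.
have llx : 1 <= lnln x by near: x; exact: near_le_lnln.
have x_ge : expR 1 <= x by near: x; exact: nbhs_pinfty_ge.
have lx : 1 <= ln x by rewrite -[leLHS](expRK 1) ler_ln ?posrE ?expR_gt0.
have x_root : ((1 + eta) `^ (1 / c) - 1)^-1 <= x.
  by near: x; exact: nbhs_pinfty_ge.
pose t := 1 + x^-1.
have xV : 0 < x^-1 by rewrite invr_gt0.
have t_ge1 : 1 <= t by rewrite lerDl ltW.
have t_gt0 : 0 < t by rewrite (lt_le_trans ltr01).
have tc : t `^ c <= 1 + eta.
  apply: powRV_le => //; [exact: ltW|by rewrite addr_ge0// ltW|].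
  by rewrite -lerBrDl -[leRHS]invrK lef_pV2 ?posrE ?invr_gt0 ?subr_gt0.
have x1 : x + 1 = t * x by rewrite /t mulrDl mul1r mulVf// gt_eqF.
have l_gt0 : 0 < lnln x by rewrite (lt_le_trans ltr01).
have l_le : lnln x <= lnln (x + 1) by rewrite lnln_le// lerDl.
have l1_gt0 : 0 < lnln (x + 1) by rewrite (lt_le_trans l_gt0).
have l_ge : lnln (x + 1) <= t * lnln x by exact: lnln_succ_le.
have x1a : (x + 1) `^ a = t `^ a * x `^ a by rewrite x1 powRM// ltW.
have pow_le (u v : R) : 0 < u -> u <= v -> v <= t * u -> v `^ b <= t `^ `|b| * u `^ b /\ u `^ b <= t `^ `|b| * v `^ b.
  move=> u0 uv vtu; have v0 := lt_le_trans u0 uv.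
  have t1 : 1 <= t `^ `|b| by rewrite -(powRr0 t) ler_powR.
  have [b0|b0] := leP 0 b.
    split; first by rewrite (ger0_norm b0) -powRM ?powR_le ?(ltW v0) ?(ltW t_gt0) ?(ltW u0).
    rewrite (@le_trans _ _ (v `^ b))// ?powR_le ?(ltW u0)//.
    by rewrite ler_peMl// powR_ge0.
  rewrite (ltr0_norm b0); set d := - b; have d0 : 0 <= d by rewrite oppr_ge0 ltW.
  have t1d : 1 <= t `^ d by rewrite -(powRr0 t) ler_powR.
  have bE (z : R) : z `^ b = (z `^ d)^-1 by rewrite /d powRN invrK.
  rewrite !bE.
  have ud : 0 < u `^ d by exact: powR_gt0.
  have vd : 0 < v `^ d by exact: powR_gt0.
  split.
    apply: (@le_trans _ _ (u `^ d)^-1); first by rewrite lef_pV2 ?posrE// powR_le// ltW.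
    by rewrite ler_peMl// invr_ge0 ltW.
  rewrite ler_pdivlMr// mulrC ler_pdivrMr// -powRM ?(ltW t_gt0) ?(ltW u0)//.
  by apply: powR_le => //; exact: ltW.
have [up down] := pow_le _ _ l_gt0 l_le l_ge.
have tab : t `^ a * t `^ `|b| <= t `^ c.
  by rewrite -powR_split// ler_powR// lerDl.
have ta1 : 1 <= t `^ a by rewrite -(powRr0 t) ler_powR.
have tb0 : 0 <= t `^ `|b| by exact: powR_ge0.
have xa0 : 0 < x `^ a by exact: powR_gt0.
rewrite /rate x1a; split.
  apply: (@le_trans _ _ (t `^ a * x `^ a * (t `^ `|b| * lnln x `^ b))).
    by rewrite ler_wpM2l// mulr_ge0// powR_ge0.
  rewrite [leLHS](_ : _ = (t `^ a * t `^ `|b|) * (x `^ a * lnln x `^ b)); last by ring.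
  by rewrite ler_wpM2r ?(le_trans tab)// mulr_ge0// powR_ge0.
apply: (@le_trans _ _ (x `^ a * (t `^ `|b| * lnln (x + 1) `^ b))).
  by rewrite ler_wpM2l// ltW.
rewrite [leLHS](_ : _ = (1 * t `^ `|b|) * (x `^ a * lnln (x + 1) `^ b)); last by ring.
rewrite [leRHS](_ : _ = (1 + eta) * t `^ a * (x `^ a * lnln (x + 1) `^ b)); last by ring.
rewrite ler_wpM2r//; first by rewrite mulr_ge0// powR_ge0.
rewrite (@le_trans _ _ (t `^ a * t `^ `|b|))// ?ler_wpM2r//.
rewrite (le_trans tab)// (le_trans tc)// ler_peMr// addr_ge0// ltW//.
Unshelve. all: by end_near. Qed.

End Growth.

(** * Upper and lower limits *)

Section UpperLowerLimits.
Context {R : realType}.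
Implicit Types (u v : nat -> R) (b : R).

Lemma limn_esup_inf (w : (\bar R)^nat) : limn_esup w = ereal_inf (range (esups w)).
Proof. by rewrite limn_esup_lim; apply/cvg_lim => //; exact: cvg_esups_inf. Qed.

Lemma limn_einf_sup (w : (\bar R)^nat) : limn_einf w = ereal_sup (range (einfs w)).
Proof. by rewrite limn_einf_lim; apply/cvg_lim => //; exact: cvg_einfs_sup. Qed.

Lemma limn_esup_le u b : (\forall n \near \oo, u n <= b) ->
  (limn_esup (EFin \o u) <= b%:E)%E.
Proof.
move=> [m _ ub]; rewrite limn_esup_inf; apply: ge_ereal_inf.
exists (esups (EFin \o u) m); first by exists m.
by apply: ge_ereal_sup => _ [n /= mn <-]; rewrite lee_fin; exact: ub.
Qed.

Lemma limn_esup_lt u b : (limn_esup (EFin \o u) < b%:E)%E ->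
  \forall n \near \oo, u n < b.
Proof.
rewrite limn_esup_inf => /ereal_inf_lt[_ [m _ <-] mb]; exists m => // n /= mn.
rewrite -lte_fin; apply: le_lt_trans mb; apply: ereal_sup_ubound.
by exists n.
Qed.

Lemma limn_esup_ge u b : (forall m, exists2 n, (m <= n)%N & b <= u n) ->
  (b%:E <= limn_esup (EFin \o u))%E.
Proof.
move=> ub; rewrite leNgt; apply/negP => /limn_esup_lt[m _ um].
have [n mn] := ub m; by rewrite leNgt um.
Qed.

Lemma limn_einf_ge u b : (\forall n \near \oo, b <= u n) ->
  (b%:E <= limn_einf (EFin \o u))%E.
Proof.
move=> [m _ ub]; rewrite limn_einf_sup; apply: le_ereal_sup_tmp.
exists (einfs (EFin \o u) m); first by exists m.
by apply: le_ereal_inf_tmp => _ [n /= mn <-]; rewrite lee_fin; exact: ub.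
Qed.

Lemma limn_einf_le u b : (forall m, exists2 n, (m <= n)%N & u n <= b) ->
  (limn_einf (EFin \o u) <= b%:E)%E.
Proof.
move=> ub; rewrite limn_einf_sup; apply: ge_ereal_sup => _ [m _ <-].
have [n mn unb] := ub m; apply: ge_ereal_inf; exists (u n)%:E; first by exists n.
by rewrite lee_fin.
Qed.

Lemma limn_einf_lt u b : (limn_einf (EFin \o u) < b%:E)%E ->
  forall m, exists2 n, (m <= n)%N & u n < b.
Proof.
move=> ub m; apply: contrapT => nu; move: ub; rewrite ltNge => /negP; apply.
apply: limn_einf_ge; exists m => // n /= mn; rewrite leNgt; apply/negP => un.
by apply: nu; exists n.
Qed.

(** An asymptotic comparison up to a factor tending to 1 preserves both limits. *)
Definition asymp_le u v : Prop := forall eta : R, 0 < eta ->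
  \forall n \near \oo, u n <= (1 + eta) * v n + eta.

Lemma asymp_le_margin (a b : R) : a < b ->
  exists2 eta : R, 0 < eta & forall z, 0 <= z -> z < a -> (1 + eta) * z + eta <= b.
Proof.
move=> ab; have a1 : 0 < `|a| + 1 by rewrite ltr_pwDr.
exists ((b - a) / (`|a| + 1)); first by rewrite divr_gt0// subr_gt0.
move=> z z0 za; set eta := _ / _; have eta0 : 0 <= eta.
  by rewrite divr_ge0 ?subr_ge0 ?ltW.
have : eta * (`|a| + 1) = b - a by rewrite /eta divfK// gt_eqF.
have : a <= `|a| by exact: ler_norm.
nra.
Qed.

Lemma lee_real_gap (x y : \bar R) :
  (forall a b : R, a < b -> (y < a%:E)%E -> (x <= b%:E)%E) -> (x <= y)%E.
Proof.
case: y => [y| |] xab; last 2 first.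
- exact: leey.
- case: x xab => // [r xab|/(_ 0 1 ltr01 (ltNyr _))//].
  have := xab (r - 2) (r - 1); rewrite lee_fin lerBrDr gerDl ler10.
  by move=> /(_ _ (ltNyr _)) H; have : false by apply: H; lra.
apply/lee_addgt0Pr => eps eps0; rewrite -EFinD.
apply: (xab (y + eps / 2)); first by rewrite ltrD2l; lra.
by rewrite lte_fin ltrDl divr_gt0.
Qed.

Lemma asymp_le_limn_esup u v : (\forall n \near \oo, 0 <= v n) -> asymp_le u v ->
  (limn_esup (EFin \o u) <= limn_esup (EFin \o v))%E.
Proof.
move=> v0 uv; apply: lee_real_gap => a b /asymp_le_margin[eta eta0 etaP] va.
apply: limn_esup_le; near=> n.
apply: (@le_trans _ _ ((1 + eta) * v n + eta)); first by near: n; exact: uv.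
by apply: etaP; near: n => //; exact: limn_esup_lt.
Unshelve. all: by end_near. Qed.

Lemma asymp_le_limn_einf u v : (\forall n \near \oo, 0 <= v n) -> asymp_le u v ->
  (limn_einf (EFin \o u) <= limn_einf (EFin \o v))%E.
Proof.
move=> [m0 _ v0] uv; apply: lee_real_gap => a b /asymp_le_margin[eta eta0 etaP] va.
have [m1 _ uv1] := uv eta eta0.
apply: limn_einf_le => m; have [n] := limn_einf_lt va (maxn m (maxn m0 m1)).
rewrite !geq_max => /and3P[mn m0n m1n] vn; exists n => //.
by apply: (le_trans (uv1 n m1n)); apply: etaP => //; exact: v0.
Qed.

Lemma limn_esup_succ v :
  limn_esup (EFin \o (fun n => v n.+1)) = limn_esup (EFin \o v).
Proof.
apply/eqP; rewrite eq_le; apply/andP; split; apply: lee_real_gap => a b ab /limn_esup_lt[m _ vm].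
  apply: limn_esup_le; exists m => // n /= mn; rewrite (le_trans _ (ltW ab))// ltW//.
  by apply: vm; exact: leqW.
apply: limn_esup_le; exists m.+1 => // -[//|n] /= mn.
by rewrite (le_trans _ (ltW ab))// ltW//; exact: vm.
Qed.

Lemma limn_einf_succ v :
  limn_einf (EFin \o (fun n => v n.+1)) = limn_einf (EFin \o v).
Proof.
apply/eqP; rewrite eq_le; apply/andP; split; apply: lee_real_gap => a b ab vm;
  apply: limn_einf_le => m.
  have [[//|n] mn vn] := limn_einf_lt vm m.+1.
  by exists n => //; rewrite (le_trans _ (ltW ab))// ltW.
have [n mn vn] := limn_einf_lt vm m.
by exists n.+1; [exact: leqW|rewrite (le_trans _ (ltW ab))// ltW].
Qed.

Lemma ratio_le (X Y K eta g h : R) : 0 < g -> 0 < h -> 0 < eta -> 0 <= X ->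
  Y <= X + K -> h <= (1 + eta) * g -> K / eta <= g ->
  Y / g <= (1 + eta) * (X / h) + eta.
Proof.
move=> g0 h0 eta0 X0 YX hg Kg; rewrite ler_pdivrMr// (le_trans YX)// mulrDl lerD//.
  rewrite [leRHS](_ : _ = X / h * ((1 + eta) * g)); last by ring.
  by rewrite -[leLHS](divfK (lt0r_neq0 h0)) ler_wpM2l// divr_ge0// ltW.
by rewrite mulrC -ler_pdivrMr.
Qed.

(** A time shift and a bounded change of the numerator are invisible after
    division by a slowly growing rate. *)
Lemma asymp_le_rate (D E : nat -> R) (K p q : R) : 0 < p ->
  (forall n, 0 <= D n) -> (forall n, 0 <= E n) ->
  (forall n, D n <= E n.+1 + K) -> (forall n, E n.+1 <= D n + K) ->
  let u n := D n / rate p q n%:R in let v n := E n / rate p q n%:R in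
  asymp_le u (fun n => v n.+1) /\ asymp_le (fun n => v n.+1) u.
Proof.
move=> p0 D0 E0 DE ED u v.
have rate_near (P : R -> Prop) : (\forall x \near +oo, P x) ->
  \forall n \near \oo, P n%:R by exact: (@near_seq _ id).
have rate_nearS (P : R -> Prop) : (\forall x \near +oo, P x) ->
  \forall n \near \oo, P n.+1%:R by exact: (@near_seq _ succn).
suff cmp (eta : R) : 0 < eta -> \forall n \near \oo,
    u n <= (1 + eta) * v n.+1 + eta /\ v n.+1 <= (1 + eta) * u n + eta.
  by split=> eta /cmp; apply: filterS => n [].
move=> eta0; have large := near_rate_ge q (Num.max 1 (K / eta)) p0.
have slow := near_rate_succ q (ltW p0) eta0.
have largeS : \forall n \near \oo, Num.max 1 (K / eta) <= rate p q n.+1%:R.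
  exact: (rate_nearS (fun x => Num.max 1 (K / eta) <= rate p q x) large).
apply: filterS3 (rate_near _ large) largeS (rate_near _ slow) => n gK hK [g1 g2].
rewrite natr1 in g1 g2; rewrite /u /v.
move: (rate p q n%:R) (rate p q n.+1%:R) gK hK g1 g2 => g h.
rewrite !ge_max => /andP[g_ge1 gK] /andP[h_ge1 hK] hg gh.
have g_gt0 := lt_le_trans ltr01 g_ge1; have h_gt0 := lt_le_trans ltr01 h_ge1.
by split; [apply: (@ratio_le _ _ K)|apply: (@ratio_le _ _ K)].
Qed.

End UpperLowerLimits.

(** * The two ratios *)

Section Ratios.
Context {R : realType} {V : countType} {v0 : V} (e : rel V).
Hypotheses (e_sym : symmetric e) (e_conn : connected_graph e).
Variables (beta : R) (beta_gt0 : 0 < beta).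

Definition max_dist (s : nat -> V) (n : nat) : nat :=
  \max_(l < n.+1) gdist e (s 0%N) (s l).

Lemma max_dist_ge s n l : (l <= n)%N -> (gdist e (s 0%N) (s l) <= max_dist s n)%N.
Proof.
by move=> ln; exact: (@leq_bigmax _ (fun l : 'I_n.+1 => gdist e (s 0%N) (s l)) (Ordinal (ln : (l < n.+1)%N))).
Qed.

Lemma max_dist_le s n m :
  (forall l, (l <= n)%N -> (gdist e (s 0%N) (s l) <= m)%N) -> (max_dist s n <= m)%N.
Proof. by move=> sm; apply/bigmax_leqP => l _; apply: sm; rewrite -ltnS. Qed.

Definition dist_ratio (s : nat -> V) (n : nat) : R :=
  (gdist e (s 0%N) (s n))%:R / rate (1 / beta) (1 - 1 / beta) n%:R.

Definition max_ratio (s : nat -> V) (n : nat) : R :=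
  (max_dist s n)%:R / rate (1 / beta) (- (1 / beta)) n%:R.

Lemma limsup_ratioE s : limsup_ratio e beta s = limn_esup (EFin \o dist_ratio s).
Proof. by []. Qed.

Lemma liminf_ratioE s : liminf_ratio e beta s = limn_einf (EFin \o max_ratio s).
Proof. by []. Qed.

Let dist_shift s x : (gdist e (s 0%N) x)%:R <=
    (gdist e (s 1%N) x)%:R + (gdist e (s 0%N) (s 1%N))%:R :> R /\
  (gdist e (s 1%N) x)%:R <=
    (gdist e (s 0%N) x)%:R + (gdist e (s 0%N) (s 1%N))%:R :> R.
Proof.
rewrite -!natrD !ler_nat [(_ + gdist e (s 0%N) (s 1%N))%N]addnC gdist_triangle//.
rewrite [(gdist e (s 0%N) x + _)%N]addnC.
by rewrite (gdist_sym e_sym e_conn (s 0%N) (s 1%N)) gdist_triangle.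
Qed.

Lemma limsup_ratio_future s :
  limsup_ratio e beta (future 1 s) = limsup_ratio e beta s.
Proof.
rewrite !limsup_ratioE -[RHS]limn_esup_succ.
have rate_ge0 a b (x : R) : 0 <= rate a b x by rewrite mulr_ge0// powR_ge0.
pose K : R := (gdist e (s 0%N) (s 1%N))%:R.
have le1 n : (gdist e (future 1 s 0%N) (future 1 s n))%:R <=
    (gdist e (s 0%N) (s n.+1))%:R + K := (dist_shift s (s n.+1)).2.
have le2 n : (gdist e (s 0%N) (s n.+1))%:R <=
    (gdist e (future 1 s 0%N) (future 1 s n))%:R + K := (dist_shift s (s n.+1)).1.
have [as1 as2] := @asymp_le_rate R
  (fun n => (gdist e (future 1 s 0%N) (future 1 s n))%:R)
  (fun n => (gdist e (s 0%N) (s n))%:R) K (1 / beta) (1 - 1 / beta)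
  (divr_gt0 ltr01 beta_gt0) (fun=> ler0n _ _) (fun=> ler0n _ _) le1 le2.
have ratio_ge0 t n : 0 <= dist_ratio t n by rewrite divr_ge0.
apply/eqP; rewrite eq_le; apply/andP; split.
  by apply: (asymp_le_limn_esup _ as1); apply: nearW => n; exact: ratio_ge0.
by apply: (asymp_le_limn_esup _ as2); apply: nearW => n; exact: ratio_ge0.
Qed.

Lemma liminf_ratio_future s :
  liminf_ratio e beta (future 1 s) = liminf_ratio e beta s.
Proof.
rewrite !liminf_ratioE -[RHS]limn_einf_succ.
have rate_ge0 a b (x : R) : 0 <= rate a b x by rewrite mulr_ge0// powR_ge0.
pose K : R := (gdist e (s 0%N) (s 1%N))%:R.
have le1 n : (max_dist (future 1 s) n)%:R <= (max_dist s n.+1)%:R + K.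
  rewrite -natrD ler_nat; apply: max_dist_le => l ln.
  rewrite -(@ler_nat R) (le_trans (dist_shift s _).2)// natrD lerD2r ler_nat.
  exact: max_dist_ge.
have le2 n : (max_dist s n.+1)%:R <= (max_dist (future 1 s) n)%:R + K.
  rewrite -natrD ler_nat; apply: max_dist_le => -[_|l ln]; first by rewrite gdistxx.
  rewrite -(@ler_nat R) (le_trans (dist_shift s _).1)// natrD lerD2r ler_nat.
  exact: (max_dist_ge (future 1 s)).
have [as1 as2] := @asymp_le_rate R (fun n => (max_dist (future 1 s) n)%:R)
  (fun n => (max_dist s n)%:R) K (1 / beta) (- (1 / beta))
  (divr_gt0 ltr01 beta_gt0) (fun=> ler0n _ _) (fun=> ler0n _ _) le1 le2.
have ratio_ge0 t n : 0 <= max_ratio t n by rewrite divr_ge0.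
apply/eqP; rewrite eq_le; apply/andP; split.
  by apply: (asymp_le_limn_einf _ as1); apply: nearW => n; exact: ratio_ge0.
by apply: (asymp_le_limn_einf _ as2); apply: nearW => n; exact: ratio_ge0.
Qed.

Lemma measurable_limsup_ratio :
  measurable_fun [set: paths v0] (limsup_ratio e beta).
Proof.
apply: (@measurable_fun_limn_esup _ (paths v0) R setT (fun n s => (dist_ratio s n)%:E)) => n.
apply/measurable_EFinP; apply: (@measurable_fun_determined _ v0 n) => s t st.
by rewrite /dist_ratio !st.
Qed.

Lemma measurable_liminf_ratio :
  measurable_fun [set: paths v0] (liminf_ratio e beta).
Proof.
rewrite (_ : liminf_ratio e beta = fun s => - limn_esup (fun n => (- max_ratio s n)%:E))%E //.
apply: (measurableT_comp (@oppe_measurable R setT)).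
apply: (@measurable_fun_limn_esup _ (paths v0) R setT (fun n s => (- max_ratio s n)%:E)) => n.
apply/measurable_EFinP; apply: (@measurable_fun_determined _ v0 n) => s t st.
congr (- (_%:R / _)); apply: eq_bigr => l _.
by rewrite !st// -ltnS.
Qed.

End Ratios.

(** * Consequences of the heat kernel bounds *)

Lemma ler_fsum (R : numDomainType) (I : choiceType) (D : set I) (f g : I -> R) :
  finite_set D -> (forall i, D i -> f i <= g i) ->
  \sum_(i \in D) f i <= \sum_(i \in D) g i.
Proof.
move=> finD fg; rewrite !fsbig_finite//= big_seq [leRHS]big_seq.
by apply: ler_sum => i; rewrite in_fset_set// inE => /fg.
Qed.

Lemma ler_fsum_subset (R : numDomainType) (I : choiceType) (D E : set I) (f : I -> R) :
  finite_set E -> D `<=` E -> (forall i, E i -> 0 <= f i) ->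
  \sum_(i \in D) f i <= \sum_(i \in E) f i.
Proof.
move=> finE DE f0; rewrite (fsbigID D _ _ finE)/= (setIidr DE) lerDl.
by apply: fsumr_ge0 => i [/f0].
Qed.

(** The bounds that hold in a good environment: [mu] is the weight of a vertex,
    [N] the scale from which the volume and heat kernel bounds hold there. *)
Record subgaussian (R : realType) (V : countType) (v0 : V) (e : rel V)
    (S : set V) (mu : V -> R) (N : V -> R) (L : V -> probability (paths v0) R)
    (alpha beta eps c11 c12 c13 c14 c15 c16 : R) : Prop := {
  sg_alpha : 1 <= alpha;
  sg_eps : 0 < eps;
  sg_eps_beta : eps + 1 < beta;
  sg_c11 : 0 < c11; sg_c12 : 0 < c12; sg_c13 : 0 < c13;
  sg_c14 : 0 < c14; sg_c15 : 0 < c15; sg_c16 : 0 < c16;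
  sg_weight : forall y, S y -> 0 <= mu y;
  sg_volume : forall x r, S x -> 1 <= r -> N x <= r ->
    c11 * r `^ alpha <= \sum_(y \in gball e x r `&` S) mu y <= c12 * r `^ alpha;
  sg_upper : forall x y n, S x -> S y -> (1 <= n)%N ->
    (gdist e x y <= n)%N -> N x <= n%:R ->
    pr (L x) [set s | s n = y] <= mu y * (c13 / n%:R `^ (alpha / beta) *
      expR (- (c14 * ((gdist e x y)%:R / n%:R `^ (1 / beta)) `^ (beta / (beta - 1)))));
  sg_lower : forall x y n, S x -> S y -> (1 <= n)%N ->
    (gdist e x y)%:R `^ (1 + eps) <= n%:R -> N x <= n%:R ->
    mu y * (c15 / n%:R `^ (alpha / beta) *
      expR (- (c16 * ((gdist e x y)%:R / n%:R `^ (1 / beta)) `^ (beta / (beta - 1))))) <=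
    pr (L x) [set s | s n = y] + pr (L x) [set s | s n.+1 = y] }.

Section HeatKernel.
Context {R : realType} {V : countType} {v0 : V} {e : rel V} {S : set V}
        {p : V -> V -> R} {L : V -> probability (paths v0) R} {mu N : V -> R}
        {alpha beta eps c11 c12 c13 c14 c15 c16 : R}.
Hypotheses (e_sym : symmetric e) (e_conn : connected_graph e).
Hypothesis ball_finite : forall x (r : R), finite_set (gball e x r).
Hypothesis LP : markov_laws e S p L.
Hypothesis SG :
  subgaussian e S mu N L alpha beta eps c11 c12 c13 c14 c15 c16.

Local Notation q := (beta / (beta - 1)).
Local Notation scale n := (n%:R `^ (1 / beta)).
Local Notation far x r n := [set s : nat -> V | r <= (gdist e x (s n))%:R].

Lemma beta_gt1 : 1 < beta.
Proof. by have := sg_eps SG; have := sg_eps_beta SG; lra. Qed.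

Lemma beta_gt0 : 0 < beta. Proof. exact: lt_trans ltr01 beta_gt1. Qed.

Lemma alpha_gt0 : 0 < alpha. Proof. exact: lt_le_trans ltr01 (sg_alpha SG). Qed.

Lemma q_gt1 : 1 < q.
Proof. by rewrite ltr_pdivlMr ?subr_gt0 ?beta_gt1// mul1r; lra. Qed.

Lemma q_gt0 : 0 < q. Proof. exact: lt_trans ltr01 q_gt1. Qed.

Lemma gdist_triangleR x y z :
  (gdist e x z)%:R <= (gdist e x y)%:R + (gdist e y z)%:R :> R.
Proof. by rewrite -natrD ler_nat gdist_triangle. Qed.

Lemma gdist_stepR x n m s : @admissible V e S x n s -> (m < n)%N ->
  (gdist e (s m) (s m.+1))%:R <= 1 :> R.
Proof.
by move=> [_ sS] mn; rewrite -[leRHS]/(1%:R) ler_nat; apply: gdist_edge; have [] := sS m mn.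
Qed.

Lemma expR_gauss_le (c a b : R) : 0 < c -> 0 <= a -> a <= b ->
  expR (- (c * b `^ q)) <= expR (- (c * a `^ q)).
Proof.
move=> c0 a0 ab; rewrite ler_expR lerN2 ler_wpM2l ?(ltW c0)//.
by apply: powR_le => //; exact/ltW/q_gt0.
Qed.

Lemma pr_at_sum z n (D : set V) : finite_set D ->
  \sum_(y \in D) pr (L z) [set s | s n = y] = pr (L z) [set s | D (s n)].
Proof.
move=> finD; rewrite -pr_sum_disjoint//.
- by congr pr; apply/seteqP; split=> s /= => [[y Dy ->//]|Ds]; exists (s n).
- by move=> y; exact: (measurable_at n [set y]).
- by apply/trivIsetP => i j _ _; apply: contra_neqP => /eqP/set0P[s [<- <-]].
Qed.

(** The volume of a ball containing [D] times the largest value of the upper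
    heat kernel bound on [D]. *)
Lemma pr_at_le (z : V) (n : nat) (r D0 : R) (D : set V) : S z -> (1 <= n)%N -> N z <= n%:R ->
  1 <= r -> N z <= r -> 0 <= D0 ->
  (forall y, D y -> D0 <= (gdist e z y)%:R <= r) ->
  pr (L z) [set s | D (s n)] <=
    c13 * c12 * (r `^ alpha / n%:R `^ (alpha / beta)) *
    expR (- (c14 * (D0 / scale n) `^ q)).
Proof.
move=> Sz n1 Nn r1 Nr D00 D_in.
pose E := D `&` S `&` gball e z (n%:R : R).
have finE : finite_set E by apply: finite_setIr.
apply: (@le_trans _ _ (pr (L z) [set s | E (s n)])).
  apply: (le_pr_admissible LP Sz); [exact: (measurable_at n D)|exact: (measurable_at n E)|].
  move=> s Xs Ds; split; first by split=> //; exact: (admissible_in Sz (Xs n)).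
  by rewrite /gball /= ler_nat; exact: (admissible_dist e_conn (Xs n)).
rewrite -pr_at_sum//.
set K := c13 / n%:R `^ (alpha / beta) * expR (- (c14 * (D0 / scale n) `^ q)).
have K_ge0 : 0 <= K.
  by rewrite mulr_ge0 ?expR_ge0// divr_ge0 ?powR_ge0// ltW// (sg_c13 SG).
apply: (@le_trans _ _ (\sum_(y \in E) mu y * K)).
  apply: ler_fsum => // y [[Dy Sy] zy].
  apply: (le_trans (sg_upper SG Sz Sy n1 _ Nn)); first by move: zy; rewrite /gball /= ler_nat.
  apply: ler_wpM2l; first exact: sg_weight SG _ Sy.
  apply: ler_wpM2l; first by rewrite divr_ge0 ?powR_ge0// ltW// (sg_c13 SG).
  apply: expR_gauss_le; [exact: sg_c14 SG|by rewrite divr_ge0// powR_ge0|].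
  by rewrite ler_wpM2r ?invr_ge0 ?powR_ge0//; have /andP[] := D_in _ Dy.
rewrite -mulr_fsuml.
have /andP[_ vol] := sg_volume SG Sz r1 Nr.
apply: (@le_trans _ _ ((c12 * r `^ alpha) * K)); last by rewrite /K le_eqVlt; apply/orP; left; apply/eqP; ring.
apply: ler_wpM2r => //; apply: le_trans vol.
apply: ler_fsum_subset.
- exact: finite_setIl.
- by move=> y [[Dy Sy] _]; split => //; rewrite /gball /=; have /andP[] := D_in _ Dy.
- by move=> y [_ Sy]; exact: sg_weight SG _ Sy.
Qed.

(** Only the sum over two consecutive times is bounded below, since on a bipartite
    graph one of the two terms vanishes at each vertex. *)
Lemma pr_at_ge (z : V) (n : nat) (r : R) (D : set V) : S z -> (1 <= n)%N -> N z <= n%:R ->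
  0 <= r -> r `^ (1 + eps) <= n%:R -> (forall y, D y -> (gdist e z y)%:R <= r) ->
  (\sum_(y \in D `&` S) mu y) *
    (c15 / n%:R `^ (alpha / beta) * expR (- (c16 * (r / scale n) `^ q))) <=
  pr (L z) [set s | D (s n)] + pr (L z) [set s | D (s n.+1)].
Proof.
move=> Sz n1 Nn r0 rn D_in.
have finE : finite_set (D `&` S).
  by apply: sub_finite_set (ball_finite z r) => y [/D_in].
apply: (@le_trans _ _ (\sum_(y \in D `&` S)
    (pr (L z) [set s | s n = y] + pr (L z) [set s | s n.+1 = y]))).
  rewrite mulr_fsuml; apply: ler_fsum => // y [Dy Sy].
  have eps1 : 0 <= 1 + eps by rewrite addr_ge0// ltW// (sg_eps SG).
  have dyn : (gdist e z y)%:R `^ (1 + eps) <= n%:R.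
    by apply: le_trans rn; apply: powR_le => //; exact: D_in.
  apply: le_trans (sg_lower SG Sz Sy n1 dyn Nn).
  apply: ler_wpM2l; first exact: sg_weight SG _ Sy.
  apply: ler_wpM2l; first by rewrite divr_ge0 ?powR_ge0// ltW// (sg_c15 SG).
  apply: expR_gauss_le; [exact: sg_c16 SG|by rewrite divr_ge0// powR_ge0|].
  by rewrite ler_wpM2r ?invr_ge0 ?powR_ge0//; exact: D_in.
rewrite fsbig_split//= !pr_at_sum//; apply: lerD; apply: le_pr.
- exact: (measurable_at n (D `&` S)).
- exact: (measurable_at n D).
- by move=> s [].
- exact: (measurable_at n.+1 (D `&` S)).
- exact: (measurable_at n.+1 D).
- by move=> s [].
Qed.

(** The lower bound controls two consecutive times together; moving one step
    changes the distance by at most 1, which is absorbed in the radius. *)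
Lemma pr_ball_ge (y z : V) (n : nat) (a : R) : S y -> S z -> (1 <= n)%N -> N z <= n%:R ->
  2 <= a -> N y <= a - 1 -> (gdist e z y)%:R <= a -> (2 * a) `^ (1 + eps) <= n%:R ->
  c15 * c11 / 2 * ((a - 1) `^ alpha / n%:R `^ (alpha / beta)) *
    expR (- (c16 * (2 * a / scale n) `^ q)) <=
  pr (L z) [set s | (gdist e y (s n))%:R <= a].
Proof.
move=> Sy Sz n1 Nn a2 Na zy an.
have a1 : 1 <= a - 1 by lra.
have D_in w : gball e y (a - 1) w -> (gdist e z w)%:R <= 2 * a.
  move=> yw; apply: (le_trans (gdist_triangleR _ y _)).
  by move: yw zy; rewrite /gball /=; lra.
have a20 : 0 <= 2 * a by lra.
have := pr_at_ge Sz n1 Nn a20 an D_in.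
have /andP[vol _] := sg_volume SG Sy a1 Na.
set K := _ / _ * expR _.
have K_ge0 : 0 <= K.
  by rewrite mulr_ge0 ?expR_ge0// divr_ge0 ?powR_ge0// ltW// (sg_c15 SG).
move=> /(le_trans (ler_wpM2r K_ge0 vol)) low.
have mB : measurable ([set s | (gdist e y (s n))%:R <= a] : set (paths v0)).
  exact: (measurable_at n [set w | (gdist e y w)%:R <= a]).
have le1 : pr (L z) [set s | gball e y (a - 1) (s n)] <=
    pr (L z) [set s | (gdist e y (s n))%:R <= a].
  apply: le_pr => //; first exact: (measurable_at n (gball e y (a - 1))).
  by move=> s; rewrite /gball /=; lra.
have le2 : pr (L z) [set s | gball e y (a - 1) (s n.+1)] <=
    pr (L z) [set s | (gdist e y (s n))%:R <= a].
  apply: (le_pr_admissible LP Sz) => //; first exact: (measurable_at n.+1 (gball e y (a - 1))).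
  move=> s Xs; rewrite /gball /=.
  have := gdist_stepR (Xs n.+1) (leqnn _).
  have := gdist_triangleR y (s n.+1) (s n); rewrite (gdist_sym e_sym e_conn (s n.+1)); lra.
rewrite [leLHS](_ : _ = c11 * (a - 1) `^ alpha * K / 2); last first.
  by rewrite /K; field; apply/lt0r_neq0/powR_gt0; rewrite ltr0n.
lra.
Qed.

(** A ratio of radii for which an annulus keeps a positive share of the volume. *)
Definition annulus_ratio : R := 2 + (c12 * (2 `^ alpha + 1) / c11) `^ (1 / alpha).

Lemma annulus_ratio_ge2 : 2 <= annulus_ratio.
Proof. by rewrite lerDl powR_ge0. Qed.

(** The annulus between the radii [2 r] and [annulus_ratio * r] carries volume
    at least [c12 r^alpha], and all its points are within reach of the lower heat kernel
    bound. The inner radius is [2 r] rather than [r] because the lower bound may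
    hold one step too late, which costs a distance 1. *)
Lemma pr_far_ge (z : V) (n : nat) (r : R) : S z -> (1 <= n)%N -> N z <= n%:R ->
  1 <= r -> N z <= r -> (annulus_ratio * r) `^ (1 + eps) <= n%:R ->
  c15 * c12 / 2 * (r `^ alpha / n%:R `^ (alpha / beta)) *
    expR (- (c16 * (annulus_ratio * r / scale n) `^ q)) <=
  pr (L z) (far z r n).
Proof.
move=> Sz n1 Nn r1 Nr rn; set Lam := annulus_ratio.
have Lam2 : 2 <= Lam := annulus_ratio_ge2.
pose B2 := gball e z (2 * r); pose B := gball e z (Lam * r).
have D_in w : (B `\` B2) w -> (gdist e z w)%:R <= Lam * r by case.
have Lr0 : 0 <= Lam * r by rewrite mulr_ge0//; lra.
have := pr_at_ge Sz n1 Nn Lr0 rn D_in.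
set K := _ / _ * expR _.
have K_ge0 : 0 <= K.
  by rewrite mulr_ge0 ?expR_ge0// divr_ge0 ?powR_ge0// ltW// (sg_c15 SG).
have B2B : B2 `<=` B.
  by move=> w; rewrite /B2 /B /gball /= => /le_trans; apply; rewrite ler_wpM2r//; lra.
have volB : c12 * r `^ alpha <= \sum_(w \in (B `\` B2) `&` S) mu w.
  have r2 : 1 <= 2 * r by lra.
  have Nr2 : N z <= 2 * r by lra.
  have rL : 1 <= Lam * r by nra.
  have NrL : N z <= Lam * r by nra.
  have vB : c11 * (Lam * r) `^ alpha <= \sum_(w \in B `&` S) mu w.
    by have /andP[] := sg_volume SG Sz rL NrL.
  have vB2 : \sum_(w \in B2 `&` S) mu w <= c12 * (2 * r) `^ alpha.
    by have /andP[] := sg_volume SG Sz r2 Nr2.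
  move: vB vB2.
  rewrite (fsbigID B2 (B `&` S) _ (finite_setIl _ (ball_finite _ _)))/=.
  rewrite (_ : B `&` S `&` B2 = B2 `&` S); last first.
    by rewrite setIAC (setIidr B2B).
  rewrite (_ : B `&` S `&` ~` B2 = (B `\` B2) `&` S); last by rewrite setIAC.
  rewrite !powRM; [|by lra..].
  have Lam_alpha : c12 * (2 `^ alpha + 1) <= c11 * Lam `^ alpha.
    rewrite [leRHS]mulrC -ler_pdivrMr ?(sg_c11 SG)//.
    have c11_ge0 := ltW (sg_c11 SG); have c12_ge0 := ltW (sg_c12 SG).
    rewrite -[leLHS](powRK alpha_gt0); last first.
      by rewrite divr_ge0 ?mulr_ge0 ?addr_ge0 ?powR_ge0.
    by apply: powR_le; [exact/ltW/alpha_gt0|exact: powR_ge0|rewrite lerDr].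
  have ra : 0 <= r `^ alpha by exact: powR_ge0.
  nra.
move=> /(le_trans (ler_wpM2r K_ge0 volB)) low.
have mF : measurable (far z r n : set (paths v0)).
  exact: (measurable_at n [set w | r <= (gdist e z w)%:R]).
have le1 : pr (L z) [set s | (B `\` B2) (s n)] <= pr (L z) (far z r n).
  apply: le_pr => //; first exact: (measurable_at n (B `\` B2)).
  move=> s [_]; rewrite /B2 /gball /= => /negP; rewrite -ltNge; lra.
have le2 : pr (L z) [set s | (B `\` B2) (s n.+1)] <= pr (L z) (far z r n).
  apply: (le_pr_admissible LP Sz) => //; first exact: (measurable_at n.+1 (B `\` B2)).
  move=> s Xs [_]; rewrite /B2 /gball /= => /negP; rewrite -ltNge.
  have := gdist_stepR (Xs n.+1) (leqnn _).
  have := gdist_triangleR z (s n) (s n.+1); lra.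
rewrite [leLHS](_ : _ = c12 * r `^ alpha * K / 2); last first.
  by rewrite /K; field; apply/lt0r_neq0/powR_gt0; rewrite ltr0n.
lra.
Qed.

End HeatKernel.

Section Displacement.
Context {R : realType} {V : countType} {v0 : V} {e : rel V} {S : set V}
        {p : V -> V -> R} {L : V -> probability (paths v0) R} {mu N : V -> R}
        {alpha beta eps c11 c12 c13 c14 c15 c16 : R}.
Hypotheses (e_sym : symmetric e) (e_conn : connected_graph e).
Hypothesis ball_finite : forall x (r : R), finite_set (gball e x r).
Hypothesis LP : markov_laws e S p L.
Hypothesis SG :
  subgaussian e S mu N L alpha beta eps c11 c12 c13 c14 c15 c16.

Local Notation q := (beta / (beta - 1)).
Local Notation scale n := (n%:R `^ (1 / beta)).
Local Notation far x r n := [set s : nat -> V | r <= (gdist e x (s n))%:R].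

Lemma dyadic_shell (r d : R) : 0 < r -> r <= d ->
  exists k, 2 ^+ k * r <= d <= 2 ^+ k.+1 * r.
Proof.
move=> r0 rd; have [n dn] : exists n, d < 2 ^+ n * r.
  exists (Num.truncn (d / r)).+1; rewrite -ltr_pdivrMr// (lt_trans (truncnS_gt _))//.
  by rewrite -natrX ltr_nat ltn_expl.
elim: n dn => [|n IH dn]; first by rewrite expr0 mul1r ltNge rd.
by have [/IH//|nd] := ltP d (2 ^+ n * r); exists n; rewrite nd ltW.
Qed.

Lemma sum_half_le (n : nat) : \sum_(k < n) (2 ^+ k)^-1 <= 2 :> R.
Proof.
suff -> : \sum_(k < n) (2 ^+ k)^-1 = 2 - 2 / 2 ^+ n :> R by rewrite gerBl divr_ge0 ?exprn_ge0.
elim: n => [|n IH]; first by rewrite big_ord0 expr0 divr1 subrr.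
by rewrite big_ord_recr/= IH exprS; field; rewrite expf_neq0.
Qed.

(** Summing the Gaussian upper bound over dyadic shells: each shell of ratio
    [v = 2^k r / n^(1/beta)] contributes at most [v^alpha exp(- c14 v^q)], and half of
    the exponent pays for the volume. *)
Lemma far_le : exists K1 K2 : R, [/\ 0 < K1, 0 < K2 &
  forall (z : V) (n : nat) (r : R), S z -> (1 <= n)%N -> N z <= n%:R ->
    1 <= r -> N z <= r -> scale n <= r ->
    pr (L z) (far z r n) <= K1 * expR (- (K2 * (r / scale n) `^ q))].
Proof.
have al := alpha_gt0 SG; have b0 := beta_gt0 SG; have q1 := q_gt1 SG; have q0 := q_gt0 SG.
have c14p := sg_c14 SG; have c12p := sg_c12 SG; have c13p := sg_c13 SG.
have c2 : 0 < c14 / 2 by rewrite divr_gt0.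
have [K K0 KP] := @powR_le_expR R (alpha + 1) (c14 / 2) (addr_ge0 (ltW al) ler01) c2.
exists (c13 * c12 * 2 `^ alpha * K * 2), (c14 / 2); split => //.
  by rewrite !mulr_gt0// powR_gt0.
move=> z n r Sz n1 Nn r1 Nr nr.
have r0 : 0 < r by rewrite (lt_le_trans ltr01).
have n0 : 0 < n%:R :> R by rewrite ltr0n.
have sc0 : 0 < scale n :> R by rewrite powR_gt0.
pose D k := [set y | 2 ^+ k * r <= (gdist e z y)%:R <= 2 ^+ k.+1 * r].
pose F k := [set s : nat -> V | D k (s n)].
have mF k : measurable (F k : set (paths v0)) by exact: (measurable_at n (D k)).
apply: (@le_trans _ _ (pr (L z) (\bigcup_k F k))).
  apply: le_pr.
  - exact: (measurable_at n [set y | r <= (gdist e z y)%:R]).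
  - exact: bigcup_measurable.
  - by move=> s /(dyadic_shell r0)[k sk]; exists k.
apply: pr_bigcup_le => // m.
set u := r / scale n.
have u1 : 1 <= u by rewrite /u ler_pdivlMr // [leLHS]mul1r.
set G := expR _.
apply: (@le_trans _ _ (\sum_(k < m) c13 * c12 * 2 `^ alpha * K * G * (2 ^+ k)^-1)); last first.
  rewrite -mulr_sumr -mulrA [leRHS](_ : _ = c13 * c12 * 2 `^ alpha * K * G * 2); last by ring.
  rewrite -[leLHS]mulrA -[leRHS]mulrA.
  by rewrite !mulrA ler_wpM2l ?sum_half_le// !mulr_ge0 ?powR_ge0 ?expR_ge0// ltW.
apply: ler_sum => k _.
have k0 : 0 < 2 ^+ k :> R by rewrite exprn_gt0.
have k1 : 1 <= 2 ^+ k :> R by rewrite exprn_ege1// ler1n.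
pose v := 2 ^+ k * u.
have v1 : 1 <= v by rewrite (le_trans u1)// ler_peMl// (le_trans ler01).
have v0' : 0 < v by rewrite (lt_le_trans ltr01).
have rk : 1 <= 2 ^+ k.+1 * r.
  by rewrite (le_trans r1)// ler_peMl ?(ltW r0)// exprn_ege1// ler1n.
have Nrk : N z <= 2 ^+ k.+1 * r.
  by rewrite (le_trans Nr)// ler_peMl ?(ltW r0)// exprn_ege1// ler1n.
have := pr_at_le e_conn ball_finite LP SG Sz n1 Nn rk Nrk
  (mulr_ge0 (ltW k0) (ltW r0)) (fun y (Dy : D k y) => Dy).
move/le_trans; apply.
rewrite (_ : 2 ^+ k * r / scale n = v); last by rewrite /v /u mulrA.
have -> : (2 ^+ k.+1 * r) `^ alpha / n%:R `^ (alpha / beta) = 2 `^ alpha * v `^ alpha.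
  have -> : 2 ^+ k.+1 * r = 2 * v * scale n.
    by rewrite /v /u exprS; field; exact: lt0r_neq0.
  have v_ge0 := ltW v0'; have v2_ge0 : 0 <= 2 * v by rewrite mulr_ge0.
  rewrite (@powRM _ (2 * v))// (@powRM _ 2 v)//.
  have -> : scale n `^ alpha = n%:R `^ (alpha / beta) by rewrite -powRrM mul1r mulrC.
  by field; apply/lt0r_neq0/powR_gt0.
have expv : expR (- (c14 * v `^ q)) <= G * expR (- (c14 / 2 * v)).
  rewrite -expRD ler_expR -opprD lerN2.
  have : u `^ q <= v `^ q.
    by apply: powR_le; [exact: ltW|exact: le_trans ler01 u1|rewrite ler_peMl// (le_trans ler01)].
  have : v <= v `^ q by apply: le1r_powR => //; exact: ltW.
  rewrite -/u; nra.
have vK : v `^ alpha * expR (- (c14 / 2 * v)) <= K * (2 ^+ k)^-1.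
  have := KP v v0'; rewrite powR_split// powRr1 ?(ltW v0')// => vK.
  rewrite ler_pdivlMr// expRN mulrAC ler_pdivrMr ?expR_gt0//.
  rewrite (le_trans _ vK)// ler_wpM2l ?powR_ge0//.
  by rewrite /v ler_peMr// ltW.
have C0 : 0 <= c13 * c12 * 2 `^ alpha by rewrite !mulr_ge0 ?powR_ge0// ltW.
have va0 : 0 <= v `^ alpha by exact: powR_ge0.
have G0 : 0 <= G by exact: expR_ge0.
rewrite mulrA -[leLHS]mulrA.
apply: (@le_trans _ _ (c13 * c12 * 2 `^ alpha * (v `^ alpha * (G * expR (- (c14 / 2 * v)))))).
  by apply: ler_wpM2l => //; apply: ler_wpM2l.
rewrite [leLHS](_ : _ = c13 * c12 * 2 `^ alpha * G * (v `^ alpha * expR (- (c14 / 2 * v)))); last by ring.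
rewrite [leRHS](_ : _ = c13 * c12 * 2 `^ alpha * G * (K * (2 ^+ k)^-1)); last by ring.
by apply: ler_wpM2l => //; exact: mulr_ge0.
Qed.

(** Decomposing at the first exit from the ball of radius [2 r]: a walk that has
    exited by time [n] is at distance at least [r] from its start at time [2 n],
    unless it has moved by at least [r] since the exit. *)
Lemma exit_le (y : V) (n : nat) (r eta : R) : S y -> 0 <= r ->
  (forall z m, S z -> (gdist e y z)%:R <= 2 * r + 1 -> (n <= m <= 2 * n)%N ->
     pr (L z) (far z r m) <= eta) ->
  pr (L y) [set s | exists2 l, (l <= n)%N & 2 * r <= (gdist e y (s l))%:R] <= 2 * eta.
Proof.
move=> Sy r0 tail.
pose dy (x : V) : R := (gdist e y x)%:R.
pose G l := [set s : nat -> V | 2 * r <= dy (s l) /\ forall i, (i < l)%N -> dy (s i) < 2 * r].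
have Gdet l : determined l (G l).
  by move=> s t st [sl si]; split=> [|i il]; rewrite -st//; [exact: si|exact: ltnW].
have mG l : measurable (G l : set (paths v0)) by exact: measurable_determined (Gdet l).
pose I := [set l | (l <= n)%N].
have finI : finite_set I.
  by apply: (sub_finite_set _ (finite_II n.+1)) => l; rewrite /= ltnS.
have tG : trivIset I G.
  apply/trivIsetP => i j _ _; apply: contra_neqP => /eqP/set0P[s [[si1 si2] [sj1 sj2]]].
  have [ij|ji|//] := ltngtP i j.
    by have := sj2 _ ij; rewrite ltNge si1.
  by have := si2 _ ji; rewrite ltNge sj1.
pose E := \bigcup_(l in I) G l.
have mE : measurable (E : set (paths v0)) by exact: fin_bigcup_measurable.
have exitE : [set s | exists2 l, (l <= n)%N & 2 * r <= dy (s l)] = E.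
  apply/seteqP; split=> s; last by move=> [l ln [sl _]]; exists l.
  move=> [l ln sl]; have ex : exists l, 2 * r <= dy (s l) by exists l.
  case: (ex_minnP ex) => k sk kmin; exists k; first by rewrite /I /= (leq_trans _ ln)// kmin.
  by split=> // i ik; rewrite ltNge; apply/negP => /kmin; rewrite leqNgt ik.
rewrite exitE.
pose B m := [set s : nat -> V | r <= (gdist e (s 0%N) (s m))%:R].
have Bdet m : determined m (B m) by move=> s t st; rewrite /B /= !st.
have mB m : measurable (B m : set (paths v0)) by exact: measurable_determined (Bdet m).
have pB z m : S z -> (dy z) <= 2 * r + 1 -> (n <= m <= 2 * n)%N -> pr (L z) (B m) <= eta.
  move=> Sz yz nm; apply: le_trans (tail z m Sz yz nm).
  apply: (le_pr_admissible LP Sz) => //.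
    exact: (measurable_at m [set w | r <= (gdist e z w)%:R]).
  by move=> s /(_ 0%N)[s0 _]; rewrite /B /= s0.
have eta0 : 0 <= eta.
  apply: le_trans (pB y n Sy _ _); first exact: pr_ge0.
    by rewrite /dy gdistxx//; lra.
  by rewrite leqnn leq_pmull.
pose H l := G l `&` future l @^-1` B (2 * n - l)%N.
have mH l : measurable (H l : set (paths v0)).
  by apply: measurableI => //; exact: measurable_future.
have prH l : I l -> pr (L y) (H l) <= pr (L y) (G l) * eta.
  move=> ln; apply: (markov_le LP) => // s [sl sl'] adm; apply: pB.
  - exact: (admissible_in Sy adm).
  - case: l ln sl sl' adm => [|l] ln sl sl' adm.
      by rewrite adm.1 /dy gdistxx//; lra.
    have := sl' l (ltnSn l); have := gdist_stepR (R := R) adm (ltnSn l).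
    by have := gdist_triangleR (R := R) e_conn y (s l) (s l.+1); rewrite /dy; lra.
  - rewrite leq_subr andbT leq_subRL; last by rewrite (leq_trans ln)// leq_pmull.
    by rewrite mul2n -addnn leq_add2r.
have mUH : measurable (\bigcup_(l in I) H l : set (paths v0)) by exact: fin_bigcup_measurable.
have prUH : pr (L y) (\bigcup_(l in I) H l) <= pr (L y) E * eta.
  rewrite !pr_sum_disjoint//; last exact: trivIset_setIr.
  by rewrite mulr_fsuml; exact: ler_fsum.
have far2 : pr (L y) (far y r (2 * n)%N) <= eta.
  apply: tail => //; first by rewrite gdistxx//; lra.
  by rewrite leqnn leq_pmull.
have mfar : measurable (far y r (2 * n)%N : set (paths v0)).
  exact: (measurable_at (2 * n) [set w | r <= (gdist e y w)%:R]).
have EU : pr (L y) E <= pr (L y) (far y r (2 * n)%N `|` \bigcup_(l in I) H l).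
  apply: le_pr => //; first exact: measurableU.
  move=> s [l ln [sl sl']]; have [|lt] := leP r (dy (s (2 * n)%N)); [by left|right].
  exists l => //; split=> //; rewrite /B /= /future addn0.
  rewrite subnKC; last by rewrite (leq_trans ln)// leq_pmull.
  by have := gdist_triangleR (R := R) e_conn y (s (2 * n)%N) (s l);
    rewrite (gdist_sym e_sym e_conn (s (2 * n)%N)); move: sl lt; rewrite /dy; lra.
apply: (le_trans EU); apply: (le_trans (prU_le _ mfar mUH)).
have : pr (L y) E * eta <= eta by rewrite ler_piMl// pr_le1.
lra.
Qed.

Lemma near_scale_le (C a : R) : 0 <= C -> 0 <= a -> a < beta ->
  \forall x \near +oo, (C * x `^ (1 / beta)) `^ a <= x.
Proof.
move=> C0 a0 ab; have b0 := beta_gt0 SG.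
have d0 : 0 < 1 - a / beta by rewrite subr_gt0 ltr_pdivrMr// mul1r.
near=> x.
have x0 : 0 < x by near: x; exact: nbhs_pinfty_gt.
have Cx : C `^ a <= x `^ (1 - a / beta) by near: x; exact: near_le_powR.
rewrite powRM ?powR_ge0// -powRrM (_ : 1 / beta * a = a / beta); last by ring.
rewrite [leRHS](_ : _ = x `^ (1 - a / beta) * x `^ (a / beta)).
  by rewrite ler_wpM2r ?powR_ge0.
by rewrite -powR_split// subrK powRr1// ltW.
Unshelve. all: by end_near. Qed.

(** At a large time the laws from two starting points both dominate a fixed
    fraction of the normalised weight on a ball of the diffusive radius. *)
Lemma subgaussian_overlapping :
  exists2 delta : R, 0 < delta & @overlapping R V v0 S L delta.
Proof.
have al := alpha_gt0 SG; have b0 := beta_gt0 SG; have q0 := q_gt0 SG.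
have c11p := sg_c11 SG; have c15p := sg_c15 SG; have c16p := sg_c16 SG.
have e0 := sg_eps SG.
set G := expR (- (c16 * 2 `^ q)).
exists (c11 * c15 * G); first by rewrite !mulr_gt0// expR_gt0.
move=> x y Sx Sy.
have ib : 0 < 1 / beta by rewrite divr_gt0.
have near1 := @near_le_powR R (1 / beta) (Num.max 1 (Num.max (N x) (gdist e x y)%:R)) ib.
have eb : 1 + eps < beta by rewrite addrC; exact: sg_eps_beta SG.
have near2 := near_scale_le (ler0n _ 2) (addr_ge0 ler01 (ltW e0)) eb.
have [n] : exists n : nat, [/\ (1 <= n)%N, N x <= n%:R, N y <= n%:R,
    Num.max 1 (Num.max (N x) (gdist e x y)%:R) <= scale n &
    (2 * scale n) `^ (1 + eps) <= n%:R].
  have near3 : \forall z \near +oo, [/\ 1 <= z, N x <= z, N y <= z,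
      Num.max 1 (Num.max (N x) (gdist e x y)%:R) <= z `^ (1 / beta) &
      (2 * z `^ (1 / beta)) `^ (1 + eps) <= z].
    near=> z; split.
    - by near: z; apply: nbhs_pinfty_ge; exact: num_real.
    - by near: z; apply: nbhs_pinfty_ge; exact: num_real.
    - by near: z; apply: nbhs_pinfty_ge; exact: num_real.
    - by near: z; exact: near1.
    - by near: z; exact: near2.
  have [m _ nm] := @near_seq R id _ (fun n => leqnn n) near3.
  by have [m1 ? ? ? ?] := nm m (leqnn m); exists m; split => //; rewrite -(ler_nat R).
rewrite !ge_max => -[n1 Nxn Nyn /and3P[sc1 Nsc dsc] scn].
set sc : R := scale n in sc1 Nsc dsc scn *.
have sc0 : 0 < sc by rewrite (lt_le_trans ltr01).
have n0 : 0 < n%:R :> R by rewrite ltr0n.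
pose K := c15 / n%:R `^ (alpha / beta) * G.
have K0 : 0 <= K by rewrite mulr_ge0 ?expR_ge0// divr_ge0 ?powR_ge0// ltW.
exists n, (gball e x sc `&` S), (fun z => if z \in S then mu z * K else 0); split.
- exact: finite_setIl.
- by move=> z; case: ifPn => // /set_mem Sz; rewrite mulr_ge0// (sg_weight SG).
- move=> z [xz Sz]; rewrite mem_set//.
  suff low w : S w -> N w <= n%:R -> (gdist e w z)%:R <= 2 * sc -> mu z * K <= @two_step R V v0 L w n z.
    split; apply: low => //; first by move: xz; rewrite /gball /=; lra.
    apply: (le_trans (gdist_triangleR e_conn y x z)).
    by rewrite (gdist_sym e_sym e_conn y); move: xz; rewrite /gball /=; lra.
  move=> Sw Nw wz; apply: le_trans (sg_lower SG Sw Sz n1 _ Nw); last first.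
    apply: le_trans scn; apply: powR_le => //; last by rewrite addr_ge0// ltW.
  apply: ler_wpM2l; first exact: sg_weight SG _ Sz.
  apply: ler_wpM2l; first by rewrite divr_ge0 ?powR_ge0// ltW.
  rewrite ler_expR lerN2 ler_wpM2l ?(ltW c16p)//.
  by apply: powR_le; [exact: ltW|rewrite divr_ge0// ltW|rewrite ler_pdivrMr].
- rewrite (eq_fsbigr (fun z => mu z * K)); last first.
    by move=> z /set_mem[_ Sz]; rewrite mem_set.
  rewrite -mulr_fsuml; have /andP[vol _] := sg_volume SG Sx sc1 Nsc.
  apply: le_trans (ler_wpM2r K0 vol).
  have -> : sc `^ alpha = n%:R `^ (alpha / beta) by rewrite -powRrM mul1r mulrC.
  rewrite /K le_eqVlt; apply/orP; left; apply/eqP; field.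
  exact/lt0r_neq0/powR_gt0.
Unshelve. all: by end_near. Qed.

End Displacement.

(** * Borel-Cantelli along dyadic times *)

Section DyadicTimes.
Context {R : realType}.

(** The times [2^(k^2)] grow so fast that the past before [square_time k] is
    negligible at time [square_time k.+1], while [log log] still grows like [log k]. *)
Definition square_time (k : nat) : nat := (2 ^ (k ^ 2))%N.

Lemma square_time_ge k : (k <= square_time k)%N.
Proof.
apply: (@leq_trans (k ^ 2)); last exact/ltnW/ltn_expl.
by case: k => // k; rewrite expnS leq_pmulr// expn_gt0.
Qed.

Lemma square_time_gt0 k : (0 < square_time k)%N.
Proof. by rewrite expn_gt0. Qed.

Lemma square_time_le j k : (j <= k)%N -> (square_time j <= square_time k)%N.
Proof. by move=> jk; rewrite leq_pexp2l// leq_exp2r. Qed.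

Lemma ln2_gt0 : 0 < ln 2 :> R. Proof. by rewrite ln_gt0// ltr1n. Qed.

Lemma ln2_le1 : ln 2 <= 1 :> R.
Proof. by have := @le_ln1Dx R 1; rewrite (_ : 1 + 1 = 2)//; apply; lra. Qed.

Lemma ln_pow2 j : ln (2 ^ j)%:R = j%:R * ln 2 :> R.
Proof. by rewrite natrX lnXn// mulr_natl. Qed.

Lemma expR_lnln_pow2 (a : R) j : (0 < j)%N ->
  expR (- (a * lnln (2 ^ j)%:R)) = ((j%:R * ln 2) `^ a)^-1.
Proof.
move=> j0; have jl : 0 < j%:R * ln 2 :> R by rewrite mulr_gt0 ?ltr0n ?ln2_gt0.
by rewrite /lnln ln_pow2 -ln_powR -lnV ?posrE ?powR_gt0// lnK// posrE invr_gt0 powR_gt0.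
Qed.

Lemma sum_inv_sqr_le (J m : nat) : (0 < J)%N ->
  \sum_(k < m) ((J.+1 + k)%:R ^+ 2)^-1 <= J%:R^-1 :> R.
Proof.
move=> J0; suff : \sum_(k < m) ((J.+1 + k)%:R ^+ 2)^-1 <= J%:R^-1 - (J + m)%:R^-1 :> R.
  by move=> /le_trans; apply; rewrite gerBl invr_ge0.
elim: m => [|m IH]; first by rewrite big_ord0 addn0 subrr.
rewrite big_ord_recr/=; apply: (le_trans (lerD IH (lexx _))).
rewrite -addrA lerD2l addnS addSn -natr1.
have : 0 < (J + m)%:R :> R by rewrite ltr0n addn_gt0 J0.
move: (J + m)%:R => y y0.
rewrite -subr_ge0 (_ : _ - _ = (y * (y + 1) ^+ 2)^-1).
  by rewrite invr_ge0 mulr_ge0 ?exprn_ge0 ?addr_ge0// ltW.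
have y1 : 0 < y + 1 by rewrite addr_gt0.
by field; rewrite !lt0r_neq0.
Qed.

Context {d : measure_display} {T : measurableType d} (P : probability T R).

(** Probabilities of order [(log n)^-2] at the times [n = 2^j] are summable. *)
Lemma dyadic_union (E : nat -> set T) (K : R) : 0 < K ->
  (forall j, measurable (E j)) ->
  (\forall j \near \oo, pr P (E j) <= K * expR (- (2 * lnln (2 ^ j)%:R))) ->
  exists J, pr P (\bigcup_k E (J + k)%N) < 1.
Proof.
move=> K0 mE [J0 _ EJ]; pose l : R := ln 2; have l0 : 0 < l := ln2_gt0.
pose C := K / l ^+ 2; have C0 : 0 < C by rewrite divr_gt0// exprn_gt0.
pose J := maxn J0 (Num.truncn C).+1.
have J_gt0 : (0 < J)%N by rewrite leq_max orbT.
exists J.+1; apply: (@le_lt_trans _ _ (C * J%:R^-1)); last first.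
  rewrite ltr_pdivrMr ?ltr0n// mul1r (lt_le_trans (truncnS_gt _))// ler_nat.
  by rewrite leq_max leqnn orbT.
apply: pr_bigcup_le => [k|m]; first exact: mE.
apply: (@le_trans _ _ (\sum_(k < m) C * ((J.+1 + k)%:R ^+ 2)^-1)); last first.
  by rewrite -mulr_sumr ler_wpM2l ?sum_inv_sqr_le// ltW.
apply: ler_sum => k _.
have jJ : (J0 <= J.+1 + k)%N.
  by rewrite (leq_trans (leq_maxl J0 (Num.truncn C).+1))// (leq_trans (leqnSn _))// leq_addr.
apply: (le_trans (EJ _ jJ)); rewrite expR_lnln_pow2//.
have -> : ((J.+1 + k)%:R * ln 2) `^ 2 = ((J.+1 + k)%:R * l) ^+ 2 :> R.
  by rewrite -powR_mulrn// mulr_ge0// ltW.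
by rewrite exprMn invfM /C -mulrA (mulrC (l ^+ 2)^-1).
Qed.

End DyadicTimes.

Section ConditionalBorelCantelli.
Context {R : realType} {V : countType} {v0 : V} {e : rel V} {S : set V}
        {p : V -> V -> R} {L : V -> probability (paths v0) R}.
Hypotheses (e_conn : connected_graph e) (LP : markov_laws e S p L).

(** Powers of [n / (n + 1)] telescope, so a product of factors [1 - delta / n] tends
    to 0 like a power of the number of factors. *)
Lemma product_harmonic_le (delta : R) (n : nat) : 0 < delta -> (0 < n)%N ->
  1 - delta / n%:R <= (n%:R / n.+1%:R) `^ delta.
Proof.
move=> delta0 n0; have n0' : 0 < n%:R :> R by rewrite ltr0n.
apply: (@le_trans _ _ (expR (- (delta / n%:R)))); first exact: expR_ge1Dx.
have nn : 0 < n%:R / n.+1%:R :> R by rewrite divr_gt0.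
rewrite -[leRHS](lnK (_ : _ \is Num.pos)) ?posrE ?powR_gt0// ler_expR ln_powR.
have -> : n%:R / n.+1%:R = (1 + n%:R^-1)^-1 :> R.
  by rewrite -natr1; field; rewrite !lt0r_neq0// addr_gt0.
rewrite lnV ?posrE ?addr_gt0 ?invr_gt0// mulrN lerN2 ler_wpM2l ?(ltW delta0)//.
by rewrite le_ln1Dx// (lt_le_trans (ltrN10 _))// invr_ge0.
Qed.

(** By the Markov property, given that none of the events from [m] to [k - 1] has
    occurred, the next one fails with probability at most [1 - delta / (k + 1)], and
    these factors have product 0. This takes the place of independence in the
    second Borel-Cantelli lemma. *)
Lemma conditional_io (t : nat -> nat) (E : nat -> set (nat -> V)) (x : V) (delta : R) :
  S x -> (forall j k, (j <= k)%N -> (t j <= t k)%N) -> 0 < delta -> delta <= 1 ->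
  (forall k, determined (t k.+1 - t k) (E k)) ->
  (\forall k \near \oo, forall z, S z -> (gdist e x z <= t k)%N ->
     delta / k.+1%:R <= pr (L z) (E k)) ->
  pr (L x) (\bigcap_m \bigcup_k (future (t (m + k)%N) @^-1` E (m + k)%N)) = 1.
Proof.
move=> Sx t_le d0 d1 Edet [k0 _ EP].
have mE k : measurable (E k : set (paths v0)) by exact: measurable_determined (Edet k).
have mF k : measurable (future (t k) @^-1` E k : set (paths v0)) by exact: measurable_future.
have mU m : measurable (\bigcup_k (future (t (m + k)%N) @^-1` E (m + k)%N) : set (paths v0)).
  exact: bigcup_measurable.
suff large m : (k0 <= m)%N ->
    pr (L x) (\bigcup_k (future (t (m + k)%N) @^-1` E (m + k)%N)) = 1.
  apply: pr1_bigcap => // m; apply/eqP; rewrite eq_le pr_le1//=.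
  rewrite -[leLHS](large (maxn k0 m) (leq_maxl _ _)); apply: le_pr => //.
  move=> s [k _ sk]; exists (maxn k0 m - m + k)%N => //.
  by rewrite addnA subnKC// leq_maxr.
move=> km; pose F n := \bigcap_(k < n) (future (t (m + k)%N) @^-1` (~` E (m + k)%N)).
have Fdet n : determined (t (m + n)%N) (F n).
  move=> s s' ss' Fs k kn; apply: determinedC (Edet (m + k)%N) _ _ _ (Fs k kn).
  move=> i i_le; rewrite /future; apply: ss'.
  have tk : (t (m + k)%N <= t (m + k).+1)%N by apply: t_le.
  rewrite (@leq_trans (t (m + k).+1))//; first by rewrite -(subnKC tk) leq_add2l.
  by apply: t_le; rewrite -addnS leq_add2l.
have mFn n : measurable (F n : set (paths v0)) by exact: measurable_determined (Fdet n).
have FS n : F n.+1 = F n `&` future (t (m + n)%N) @^-1` (~` E (m + n)%N).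
  apply/seteqP; split=> [s Fs|s [Fs Es] k /=].
    by split=> [k kn|]; [apply: Fs; rewrite /= ltnW|exact: (Fs n (ltnSn n))].
  by rewrite ltnS leq_eqVlt => /predU1P[->//|]; exact: Fs.
have Fle n : pr (L x) (F n) <= (m.+1%:R / (m.+1 + n)%:R) `^ delta.
  elim: n => [|n IH]; first by rewrite addn0 divff ?pnatr_eq0// powR1 pr_le1.
  have mn0 : (0 < m.+1 + n)%N by [].
  have b0 : 0 <= 1 - delta / (m.+1 + n)%:R.
    rewrite subr_ge0 ler_pdivrMr ?ltr0n// mul1r (le_trans d1)// ler1n//.
  rewrite FS; apply: (@le_trans _ _ (pr (L x) (F n) * (1 - delta / (m.+1 + n)%:R))).
    apply: (markov_le LP) => //; first exact: measurableC.
    move=> s _ adm; rewrite prC// lerD2l lerN2 addSn; apply: EP.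
    - by rewrite /= (leq_trans km)// leq_addr.
    - exact: (admissible_in Sx adm).
    - exact: (admissible_dist e_conn adm).
  apply: (le_trans (ler_pM (pr_ge0 _ _) b0 IH (product_harmonic_le d0 mn0))).
  rewrite -powRM ?divr_ge0// le_eqVlt; apply/orP; left; apply/eqP; congr powR.
  by rewrite addnS mulrA divfK ?pnatr_eq0.
set U := \bigcup_k _; suff U0 : pr (L x) (~` U) <= 0.
  by have := prC (L x) (mU m); have := pr_le1 (L x) (mU m); rewrite -/U; lra.
apply/ler_addgt0Pr => eta eta0; rewrite add0r.
pose M := Num.truncn (m.+1%:R / eta `^ (1 / delta)).
have ed : 0 < eta `^ (1 / delta) by exact: powR_gt0.
apply: (@le_trans _ _ (pr (L x) (F M))).
  apply: le_pr; [exact: measurableC (mU m)|exact: mFn|].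
  by move=> s nU k _ Es; apply: nU; exists k.
apply: (le_trans (Fle M)); rewrite -[leRHS](powRK d0 (ltW eta0)).
apply: powR_le; [exact: ltW|exact: divr_ge0|].
rewrite ler_pdivrMr ?ltr0n// mulrC -ler_pdivrMr//.
apply: (le_trans (ltW (truncnS_gt _))); rewrite -/M ler_nat addSn ltnS.
exact: leq_addl.
Qed.

End ConditionalBorelCantelli.

(** * The two normalisations *)

Section Normalisations.
Context {R : realType} (beta : R) (beta_gt1 : 1 < beta).
Implicit Types a b c t : R.

Local Notation q := (beta / (beta - 1)).
Local Notation phi := (rate (1 / beta) (1 - 1 / beta)).
Local Notation psi := (rate (1 / beta) (- (1 / beta))).

Let beta_gt0 : 0 < beta. Proof. exact: lt_trans ltr01 beta_gt1. Qed.

Let ib_gt0 : 0 < 1 / beta. Proof. by rewrite divr_gt0. Qed.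

Let ib_le1 : 1 / beta <= 1.
Proof. by rewrite ler_pdivrMr// mul1r ltW. Qed.

Let b1_ge0 : 0 <= 1 - 1 / beta. Proof. by rewrite subr_ge0. Qed.

Let powR_ge1 a t : 1 <= t -> 0 <= a -> 1 <= t `^ a.
Proof. by move=> t1 a0; have := ler_powR t1 a0; rewrite powRr0. Qed.

Lemma powRV_mono s t : 0 <= s -> s <= t -> s `^ (1 / beta) <= t `^ (1 / beta).
Proof. by move=> s0 st; apply: powR_le => //; exact: ltW. Qed.

Lemma powRV_double t : 0 <= t -> (2 * t) `^ (1 / beta) <= 2 * t `^ (1 / beta).
Proof.
move=> t0; rewrite powRM// ler_wpM2r ?powR_ge0// -[leRHS]powRr1//.
by rewrite ler_powR// ler1n.
Qed.

Lemma phi_ge_scale t : 1 <= lnln t -> t `^ (1 / beta) <= phi t.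
Proof.
by move=> l1; rewrite /rate ler_peMr ?powR_ge0// powR_ge1.
Qed.

Lemma phi_le_scale t : 1 <= lnln t -> phi t <= t `^ (1 / beta) * lnln t.
Proof.
move=> l1; rewrite /rate ler_wpM2l ?powR_ge0//.
by rewrite -[leRHS]powRr1 ?(le_trans ler01)// ler_powR// gerBl ltW.
Qed.

Lemma phi_scale_powR c t : 0 <= c -> 0 < t -> 0 < lnln t ->
  (c * phi t / t `^ (1 / beta)) `^ q = c `^ q * lnln t.
Proof.
move=> c0 t0 l0; have s0 : 0 < t `^ (1 / beta) by rewrite powR_gt0.
have -> : c * phi t / t `^ (1 / beta) = c * lnln t `^ (1 - 1 / beta).
  by rewrite /rate; field; exact: lt0r_neq0.
rewrite powRM ?powR_ge0//; congr (_ * _); rewrite -powRrM.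
have -> : (1 - 1 / beta) * q = 1.
  by field; rewrite subr_eq0 (gt_eqF beta_gt1) (gt_eqF beta_gt0).
by rewrite powRr1// ltW.
Qed.

Lemma psi_powR t : 0 < t -> 0 < lnln t -> psi t `^ beta = t / lnln t.
Proof.
move=> t0 l0; rewrite /rate powRN powRM ?invr_ge0 ?powR_ge0// powRK ?(ltW t0)//.
rewrite -powR_inv1 ?powR_ge0// -!powRrM.
rewrite (_ : 1 / beta * (-1 * beta) = -1); last by field; exact: lt0r_neq0.
by rewrite powR_inv1// ltW.
Qed.

Lemma phi_le s t : 1 < s -> 0 < lnln s -> s <= t -> phi s <= phi t.
Proof.
move=> s1 l0 st; have s0 := lt_trans ltr01 s1.
rewrite /rate ler_pM ?powR_ge0// powR_le ?(ltW ib_gt0) ?(ltW s0) ?(ltW l0)//.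
exact: lnln_le.
Qed.

Lemma near_phi_powR_le (C a : R) : 0 <= C -> 0 < a -> a < beta ->
  \forall t \near +oo, (C * phi t) `^ a <= t.
Proof.
move=> C0 a0 ab; have gap : 0 < (1 - a / beta) / a.
  by rewrite divr_gt0// subr_gt0 ltr_pdivrMr// mul1r.
near=> t.
have t0 : 0 < t by near: t; exact: nbhs_pinfty_gt.
have l1 : 1 <= lnln t by near: t; exact: near_le_lnln.
have Cl : C * lnln t <= t `^ ((1 - a / beta) / a).
  by near: t; exact: near_lnln_le_powR.
apply: (@le_trans _ _ ((t `^ ((1 - a / beta) / a) * t `^ (1 / beta)) `^ a)).
  apply: powR_le; [exact: ltW|by rewrite mulr_ge0// mulr_ge0// powR_ge0|].
  apply: (@le_trans _ _ (C * (t `^ (1 / beta) * lnln t))).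
    by rewrite ler_wpM2l// phi_le_scale.
  by rewrite mulrCA mulrC ler_wpM2r// powR_ge0.
rewrite powRM ?powR_ge0// -!powRrM divfK ?(gt_eqF a0)//.
rewrite (_ : 1 / beta * a = a / beta); last by ring.
by rewrite -powR_split// subrK powRr1// ltW.
Unshelve. all: by end_near. Qed.

Lemma near_phi_double : \forall t \near +oo, phi (2 * t) <= 4 * phi t.
Proof.
near=> t.
have t1 : 1 < t by near: t; exact: nbhs_pinfty_gt.
have t0 := lt_trans ltr01 t1.
have l1 : 1 <= lnln t by near: t; exact: near_le_lnln.
have l0 : 0 < lnln t := lt_le_trans ltr01 l1.
have ll : lnln (2 * t) <= 2 * lnln t by near: t; exact: near_lnln_double.
have two a : 0 <= a <= 1 -> 2 `^ a <= 2 :> R.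
  by move=> /andP[a0 a1]; rewrite -[leRHS]powRr1// ler_powR// ler1n.
have l20 : 0 <= lnln (2 * t) by rewrite (le_trans (ltW l0))// lnln_le// ler_peMl ?ler1n// ltW.
have sc : (2 * t) `^ (1 / beta) <= 2 * t `^ (1 / beta).
  by rewrite powRM ?(ltW t0)// ler_wpM2r ?powR_ge0// two// (ltW ib_gt0).
have lb : lnln (2 * t) `^ (1 - 1 / beta) <= 2 * lnln t `^ (1 - 1 / beta).
  apply: (@le_trans _ _ ((2 * lnln t) `^ (1 - 1 / beta))); first exact: powR_le.
  by rewrite powRM ?(ltW l0)// ler_wpM2r ?powR_ge0// two// b1_ge0 gerBl ltW.
rewrite /rate (_ : 4 * _ = (2 * t `^ (1 / beta)) * (2 * lnln t `^ (1 - 1 / beta))); last by ring.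
by apply: ler_pM => //; exact: powR_ge0.
Unshelve. all: by end_near. Qed.

(** [n] and the power of 2 below it have comparable [psi]. *)
Lemma psi_le_double s t : 1 < s -> 0 < lnln s -> s <= t -> t <= 2 * s ->
  psi t <= 2 * psi s.
Proof.
move=> s1 l0 st t2s; have s0 := lt_trans ltr01 s1; have t0 := lt_le_trans s0 st.
have lst : lnln s <= lnln t by exact: lnln_le.
rewrite /rate mulrA; apply: ler_pM; [exact: powR_ge0|exact: powR_ge0| |].
  apply: (@le_trans _ _ ((2 * s) `^ (1 / beta))).
    by apply: powR_le => //; exact: ltW.
  rewrite powRM ?(ltW s0)// ler_wpM2r ?powR_ge0// -[leRHS]powRr1//.
  by rewrite ler_powR// ler1n.
rewrite !powRN lef_pV2 ?posrE ?powR_gt0//; last exact: lt_le_trans lst.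
by apply: powR_le => //; exact: ltW.
Qed.

(** When [t] exceeds [s] by the factor [(log log t)^beta], a displacement of order
    [phi s] at time [s] is negligible against [psi t]. *)
Lemma phi_le_psi s t : 1 < s -> 0 < lnln s -> s <= t -> s * lnln t `^ beta <= t ->
  phi s <= psi t.
Proof.
move=> s1 l0 st slt; have s0 := lt_trans ltr01 s1; have t0 := lt_le_trans s0 st.
have lst : lnln s <= lnln t by exact: lnln_le.
have lt0 : 0 < lnln t := lt_le_trans l0 lst.
have sl : s `^ (1 / beta) * lnln t <= t `^ (1 / beta).
  rewrite -[X in _ * X <= _](powRKV beta_gt0 (ltW lt0)) -powRM ?powR_ge0 ?(ltW s0)//.
  by apply: powR_le => //; [exact: ltW|rewrite mulr_ge0 ?powR_ge0// ltW].
rewrite /rate; apply: (@le_trans _ _ (s `^ (1 / beta) * lnln t `^ (1 - 1 / beta))).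
  by rewrite ler_wpM2l ?powR_ge0// powR_le// ltW.
by rewrite powR_split// powRr1 ?(ltW lt0)// mulrA ler_wpM2r// powR_ge0.
Qed.

End Normalisations.

Section SquareTimes.
Context {R : realType}.

Lemma square_timeS k :
  (square_time k.+1)%:R = (square_time k)%:R * 2 ^+ (2 * k).+1 :> R.
Proof.
rewrite -natrX -natrM -expnD; congr (_ ^ _)%:R.
by rewrite !expnS !expn0; lia.
Qed.

Lemma near_square_timeS (P : R -> Prop) : (\forall t \near +oo, P t) ->
  \forall k \near \oo, P (square_time k.+1)%:R.
Proof.
have kt k : (k <= square_time k.+1)%N by rewrite ltnW// square_time_ge.
exact: (near_seq kt).
Qed.

Lemma lnln_square_time k : lnln (square_time k.+1)%:R <= 2 * k.+1%:R :> R.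
Proof.
rewrite /lnln ln_pow2; have k0 : 0 < k.+1%:R :> R by [].
apply: (@le_trans _ _ (ln (k.+1%:R ^+ 2))).
  rewrite ler_ln ?posrE ?mulr_gt0 ?ln2_gt0 ?exprn_gt0//.
  by rewrite natrX ler_piMr ?ln2_le1// exprn_ge0.
rewrite lnXn// -[leLHS]mulr_natl ler_wpM2l// ltW//.
exact: ln_sublinear.
Qed.

(** The ratio of consecutive square times beats every power of [log log]. *)
Lemma near_square_time (G b : R) : 0 <= G -> 0 <= b -> \forall k \near \oo,
  G * (square_time k)%:R * lnln (square_time k.+1)%:R `^ b <= (square_time k.+1)%:R.
Proof.
move=> G0 b0; have l2 : 0 < ln 2 / 2 :> R by rewrite divr_gt0// ln2_gt0.
have [K K0 KP] := powR_le_expR b0 l2.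
have l_ge0 : \forall k \near \oo, 0 <= lnln (square_time k.+1)%:R :> R.
  have kt k : (k <= square_time k.+1)%N by rewrite ltnW// square_time_ge.
  exact: (near_seq kt (near_le_lnln 0)).
have kGK : \forall k \near \oo, G * K <= 2 ^+ k.
  exists (Num.truncn (G * K)).+1 => // k /= kGK.
  rewrite (le_trans (ltW (truncnS_gt _)))// (le_trans (_ : _ <= k%:R))// ?ler_nat//.
  by rewrite -natrX ler_nat ltnW// ltn_expl.
apply: filterS2 l_ge0 kGK => k l0 kGK.
rewrite square_timeS mulrAC mulrC ler_wpM2l//.
apply: (@le_trans _ _ (G * (K * expR (ln 2 / 2 * (2 * k.+1%:R))))).
  rewrite -square_timeS ler_wpM2l//; apply: (@le_trans _ _ ((2 * k.+1%:R) `^ b)).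
    by apply: powR_le => //; exact: lnln_square_time.
  by apply: KP; rewrite mulr_gt0.
have -> : expR (ln 2 / 2 * (2 * k.+1%:R)) = 2 ^+ k.+1 :> R.
  by rewrite mulrA divfK// mulrC expRM_natl lnK// posrE.
by rewrite mul2n -addnn -addnS exprD mulrA ler_wpM2r// exprn_ge0.
Qed.

(** The exponent 1/2 is chosen to give probabilities of order [1 / k] along the
    square times, where [log log] is about [2 log k]; these are not summable. *)
Lemma inv_succ_le_expR k :
  k.+1%:R^-1 <= expR (- (1 / 2 * lnln (square_time k.+1)%:R)) :> R.
Proof.
have kR : 0 < k.+1%:R :> R by [].
rewrite expR_lnln_pow2 ?expn_gt0// lef_pV2 ?posrE ?powR_gt0 ?mulr_gt0 ?ln2_gt0 ?ltr0n ?expn_gt0//.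
apply: (@le_trans _ _ ((k.+1%:R `^ 2) `^ (1 / 2))); last by rewrite powRKV.
apply: powR_le => //; first by rewrite mulr_ge0// ltW// ln2_gt0.
by rewrite powR_mulrn// natrX ler_piMr ?ln2_le1// exprn_ge0.
Qed.

End SquareTimes.

(** * Estimates at the scale of the two normalisations *)

Section CoreEstimates.
Context {R : realType} {V : countType} {v0 : V} {e : rel V} {S : set V}
        {p : V -> V -> R} {L : V -> probability (paths v0) R} {mu N : V -> R}
        {alpha beta eps c11 c12 c13 c14 c15 c16 : R}.
Hypotheses (e_sym : symmetric e) (e_conn : connected_graph e).
Hypothesis ball_finite : forall x (r : R), finite_set (gball e x r).
Hypothesis LP : markov_laws e S p L.
Hypothesis SG :
  subgaussian e S mu N L alpha beta eps c11 c12 c13 c14 c15 c16.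
Variables (x : V) (rho0 : R).
Hypothesis Sx : S x.
Hypothesis N_good : forall rho z, rho0 <= rho -> S z -> (gdist e x z)%:R <= rho ->
  N z <= 2 * rho `^ (1 / beta).

Local Notation q := (beta / (beta - 1)).
Local Notation phi := (rate (1 / beta) (1 - 1 / beta)).
Local Notation scale n := (n%:R `^ (1 / beta)).

Let b1 : 1 < beta. Proof. exact: beta_gt1 SG. Qed.
Let b0 : 0 < beta. Proof. exact: beta_gt0 SG. Qed.
Let q0 : 0 < q. Proof. exact: q_gt0 SG. Qed.
Let ib0 : 0 < 1 / beta. Proof. by rewrite divr_gt0. Qed.
Let ib1 : 1 / beta <= 1. Proof. by rewrite ler_pdivrMr// mul1r ltW. Qed.

Let scale_ge1 (t : R) : 1 <= t -> 1 <= t `^ (1 / beta).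
Proof. by move=> t1; have := ler_powR t1 (ltW ib0); rewrite powRr0. Qed.

Definition exceeds (n : nat) (r : R) : set (nat -> V) :=
  [set s | exists2 l, (l <= n)%N & r <= (gdist e x (s l))%:R].

Lemma determined_exceeds n r : determined n (exceeds n r).
Proof. by move=> s t st [l ln sl]; exists l => //; rewrite -st. Qed.

(** Gaussian tails at distance [A phi n] are of order [exp (- 2 log log n)]. *)
Lemma pr_exceeds_phi : exists A K : R, [/\ 0 < A, 0 < K &
  \forall n \near \oo, pr (L x) (exceeds n (A * phi n%:R)) <=
    K * expR (- (2 * lnln n%:R))].
Proof.
have [K1 [K2 [K10 K20 farP]]] := far_le e_conn ball_finite LP SG.
(* [K2 * (A / 4) `^ q >= 2], which is the exponent asked for; the factor 4 covers
   the radius [A * phi / 2] and a time up to [2 n]. *)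
pose A := 4 * (1 + (2 / K2) `^ (1 / q)).
have A4 : 4 <= A by rewrite /A ler_peMr// lerDl powR_ge0.
have A0 : 0 < A by rewrite (lt_le_trans _ A4).
have Aq : 2 / K2 <= (A / 4) `^ q.
  have K2' : 0 <= 2 / K2 by rewrite divr_ge0// ltW.
  rewrite -[leLHS](powRK q0)//; apply: powR_le; [exact: ltW|exact: powR_ge0|].
  by rewrite (_ : A / 4 = 1 + (2 / K2) `^ (1 / q)) ?lerDr// /A; field.
exists A, (2 * K1); split; [by []|by rewrite mulr_gt0|].
have fact : \forall t \near +oo, [/\ 1 < t, 1 <= lnln t, rho0 <= t,
    (2 * A * phi t) `^ 1 <= t & (2 * t `^ (1 / beta)) `^ 1 <= t].
  near=> t; split.
  - by near: t; apply: nbhs_pinfty_gt; exact: num_real.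
  - by near: t; exact: near_le_lnln.
  - by near: t; apply: nbhs_pinfty_ge; exact: num_real.
  - by near: t; apply: near_phi_powR_le => //; rewrite mulr_ge0// ltW.
  - by near: t; exact: (near_scale_le SG).
have := near_seq (t := id) (fun n => leqnn n) fact.
apply: filterS => n [n1 l1 nrho phin scn].
have n0 : 0 < n%:R :> R := lt_trans ltr01 n1.
have l0 : 0 < lnln n%:R :> R := lt_le_trans ltr01 l1.
set f : R := phi n%:R in phin *.
have sc_f : scale n <= f by exact: phi_ge_scale.
have sc1 : 1 <= scale n :> R by apply: scale_ge1; exact: ltW.
have f0 : 0 <= f by rewrite (le_trans _ sc_f)// powR_ge0.
have Af0 : 0 <= 2 * A * f by rewrite mulr_ge0// mulr_ge0// ltW.
have sc20 : 0 <= 2 * scale n :> R by rewrite mulr_ge0// powR_ge0.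
rewrite (powRr1 Af0) in phin; rewrite (powRr1 sc20) in scn.
pose r := A * f / 2.
have r2 : 2 * scale n <= r by rewrite /r; nra.
have r1 : 1 <= r by lra.
have n1N : (1 <= n)%N by rewrite -(ltr_nat R).
pose eta := K1 * expR (- (2 * lnln n%:R)).
suff tail z m : S z -> (gdist e x z)%:R <= 2 * r + 1 -> (n <= m <= 2 * n)%N ->
    pr (L z) [set s | r <= (gdist e z (s m))%:R] <= eta.
  have := exit_le e_sym e_conn LP Sx (le_trans ler01 r1) tail.
  rewrite (_ : 2 * r = A * f); last by rewrite /r mulrC divfK.
  by rewrite /eta mulrA.
move=> Sz xz /andP[nm m2n].
have nmR : n%:R <= m%:R :> R by rewrite ler_nat.
have m2nR : m%:R <= 2 * n%:R :> R by rewrite -natrM ler_nat.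
have m0 : 0 < m%:R :> R := lt_le_trans n0 nmR.
have Nz : N z <= 2 * scale n.
  by apply: N_good => //; rewrite (le_trans xz)//; move: phin r1; rewrite /r; lra.
have scm : scale m <= 2 * scale n :> R.
  by apply: le_trans (powRV_double b1 (ltW n0)); apply: (powRV_mono b1) => //; exact: ltW.
have scm0 : 0 < scale m :> R by exact: powR_gt0.
apply: (le_trans (farP z m r Sz _ _ r1 _ _)).
- exact: leq_trans n1N nm.
- by rewrite (le_trans Nz)// (le_trans scn).
- exact: le_trans Nz r2.
- exact: le_trans scm r2.
rewrite /eta ler_wpM2l ?(ltW K10)// ler_expR lerN2.
have -> : 2 * lnln n%:R = K2 * (2 / K2 * lnln n%:R) :> R by field; exact: lt0r_neq0.
rewrite ler_wpM2l ?(ltW K20)//.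
apply: (@le_trans _ _ ((A / 4) `^ q * lnln n%:R)); first by rewrite ler_wpM2r// ltW.
have A4_0 : 0 <= A / 4 by rewrite divr_ge0// ltW.
rewrite -(phi_scale_powR b1 A4_0 n0 l0).
apply: powR_le; [exact: ltW|by rewrite divr_ge0 ?powR_ge0// mulr_ge0// divr_ge0// ltW|].
have sc0 : 0 < scale n :> R by exact: powR_gt0.
rewrite ler_pdivlMr// mulrAC ler_pdivrMr// -/f.
have : 0 <= A * f by rewrite mulr_ge0// ltW.
rewrite /r; nra.
Unshelve. all: by end_near. Qed.

(** In a time of order [r^beta] the walk leaves a ball of radius [r] with probability
    at least one half, so it stays there for a time [n] with a probability
    exponentially small in [n / r^beta]. *)
Lemma pr_confined : exists kap r0 : R, 0 < kap /\ forall r n, r0 <= r ->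
  pr (L x) [set s | forall l, (l <= n)%N -> (gdist e x (s l))%:R <= r] <=
    2 * expR (- (ln 2 * (n%:R / (2 * kap * r `^ beta)))).
Proof.
have al := alpha_gt0 SG; have c12p := sg_c12 SG; have c13p := sg_c13 SG.
pose C := 2 * c13 * c12; have C0 : 0 < C by rewrite !mulr_gt0.
(* At time [m >= kap * r `^ beta] the diagonal heat kernel bound times the volume
   of a ball of radius [2 r] is at most one half. *)
pose kap := (2 * C `^ (1 / alpha)) `^ beta.
have kap_base : 0 < 2 * C `^ (1 / alpha) by rewrite mulr_gt0// powR_gt0.
have kap0 : 0 < kap by rewrite powR_gt0.
have fact : \forall r \near +oo, [/\ 1 <= r, rho0 <= r, 2 / kap <= r `^ (beta - 1) &
    1 / kap <= r `^ beta].
  near=> r; split.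
  - by near: r; apply: nbhs_pinfty_ge; exact: num_real.
  - by near: r; apply: nbhs_pinfty_ge; exact: num_real.
  - by near: r; apply: near_le_powR; rewrite subr_gt0.
  - by near: r; exact: near_le_powR.
have [M [_ MP]] := fact.
exists kap, (M + 1); split=> // r n rM.
have [r1 r_rho rb1 rb] := MP r (lt_le_trans (ltr_pwDr ltr01 (lexx M)) rM).
have r0 : 0 < r := lt_le_trans ltr01 r1.
have rbeta0 : 0 < r `^ beta by exact: powR_gt0.
have krb : 1 <= kap * r `^ beta by rewrite mulrC -ler_pdivrMr.
have kr2 : 2 * r <= kap * r `^ beta.
  rewrite -(mulr_powRB1 (ltW r0) b0) mulrCA [leLHS]mulrC ler_wpM2l ?(ltW r0)//.
  by rewrite mulrC -ler_pdivrMr.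
pose m := (Num.truncn (kap * r `^ beta)).+1.
have m_ge : kap * r `^ beta <= m%:R by rewrite ltW// truncnS_gt.
have m_le : m%:R <= 2 * kap * r `^ beta.
  rewrite /m -natr1 -mulrA mulr_natl mulr2n lerD//.
  by rewrite truncn_le// (le_trans ler01).
have m0 : (0 < m)%N by [].
have half z : S z -> (gdist e x z)%:R <= r ->
    pr (L z) [set s | (gdist e x (s m))%:R <= r] <= 1 / 2.
  move=> Sz xz.
  have Nz : N z <= 2 * r.
    apply: (le_trans (N_good r_rho Sz xz)); rewrite ler_wpM2l//.
    by rewrite -[leRHS](powRr1 (ltW r0)) ler_powR.
  have Nm : N z <= m%:R by rewrite (le_trans Nz)// (le_trans kr2).
  have r21 : 1 <= 2 * r by lra.
  pose D := [set y | (gdist e x y)%:R <= r].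
  have D_in y : D y -> (0 : R) <= (gdist e z y)%:R <= 2 * r.
    rewrite /D /= => xy; rewrite ler0n/= (le_trans (gdist_triangleR (R := R) e_conn z x y))//.
    by rewrite (gdist_sym e_sym e_conn z); lra.
  apply: (le_trans (pr_at_le e_conn ball_finite LP SG Sz m0 Nm r21 Nz (lexx 0) D_in)).
  rewrite mul0r powR0 ?(gt_eqF q0)// mulr0 oppr0 expR0 mulr1.
  have m_alpha : 0 < m%:R `^ (alpha / beta) :> R by rewrite powR_gt0// ltr0n.
  rewrite mulrA ler_pdivrMr//.
  suff : C * (2 * r) `^ alpha <= m%:R `^ (alpha / beta) by rewrite /C; lra.
  have sc : 2 * C `^ (1 / alpha) * r <= scale m.
    apply: powR_powRV_le => //; first by rewrite mulr_ge0// ltW.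
    by rewrite powRM ?(ltW kap_base) ?(ltW r0).
  have -> : m%:R `^ (alpha / beta) = scale m `^ alpha :> R.
    by rewrite -powRrM; congr powR; field; exact: lt0r_neq0.
  apply: (@le_trans _ _ ((2 * C `^ (1 / alpha) * r) `^ alpha)); last first.
    by apply: powR_le => //; [exact: ltW|rewrite mulr_ge0// ltW].
  rewrite -[C in leLHS](powRK al (ltW C0)) -powRM ?powR_ge0 ?mulr_ge0 ?(ltW r0)//.
  by rewrite mulrA [_ * 2]mulrC.
pose F k := [set s : nat -> V | forall i, (i <= k)%N -> (gdist e x (s (i * m)%N))%:R <= r].
have Fdet k : determined (k * m) (F k).
  by move=> s t st Fs i ik; rewrite -st ?leq_mul2r ?ik ?orbT//; exact: Fs.
have mF k : measurable (F k : set (paths v0)) by exact: measurable_determined (Fdet k).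
have Fle k : pr (L x) (F k) <= (1 / 2) ^+ k.
  elim: k => [|k IH]; first by rewrite expr0 pr_le1.
  have mB : measurable ([set s | (gdist e x (s m))%:R <= r] : set (paths v0)).
    exact: (measurable_at m [set w | (gdist e x w)%:R <= r]).
  apply: (@le_trans _ _ (pr (L x) (F k `&`
      future (k * m) @^-1` [set s | (gdist e x (s m))%:R <= r]))).
    apply: le_pr => //; first by apply: measurableI => //; exact: measurable_future.
    move=> s Fs; split=> [i ik|]; first by apply: Fs; exact: leqW.
    by have := Fs k.+1 (leqnn _); rewrite /= /future mulSn addnC.
  apply: (@le_trans _ _ (pr (L x) (F k) * (1 / 2))); last by rewrite exprSr ler_wpM2r.
  apply: (markov_le LP) => // s Fs adm; apply: half; last exact: Fs.
  exact: (admissible_in Sx adm).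
have [k km_le km_gt] : exists2 k, (k * m <= n)%N & (n < k.+1 * m)%N.
  by exists (n %/ m)%N; [exact: leq_divM|exact: ltn_ceil].
apply: (@le_trans _ _ (pr (L x) (F k))).
  apply: le_pr; [|exact: mF|move=> s sl i ik; apply: sl].
    apply: (@measurable_determined _ _ n) => s t st sl l ln; rewrite -st//.
    exact: sl.
  by rewrite (leq_trans _ km_le)// leq_mul2r ik orbT.
apply: (le_trans (Fle k)).
have -> : (1 / 2) ^+ k = 2 * expR (- (ln 2 * k.+1%:R)) :> R.
  rewrite expRN expRM_natr lnK ?posrE// exprS div1r exprVn.
  by field; rewrite expf_neq0.
rewrite ler_wpM2l// ler_expR lerN2 ler_wpM2l ?(ltW ln2_gt0)//.
have den : 0 < 2 * kap * r `^ beta by rewrite !mulr_gt0.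
rewrite ler_pdivrMr//; apply: (@le_trans _ _ (k.+1%:R * m%:R)).
  by rewrite -natrM ler_nat ltnW.
by rewrite ler_wpM2l.
Unshelve. all: by end_near. Qed.

End CoreEstimates.

Section LowerEstimates.
Context {R : realType} {V : countType} {v0 : V} {e : rel V} {S : set V}
        {p : V -> V -> R} {L : V -> probability (paths v0) R} {mu N : V -> R}
        {alpha beta eps c11 c12 c13 c14 c15 c16 : R}.
Hypotheses (e_sym : symmetric e) (e_conn : connected_graph e).
Hypothesis ball_finite : forall x (r : R), finite_set (gball e x r).
Hypothesis LP : markov_laws e S p L.
Hypothesis SG :
  subgaussian e S mu N L alpha beta eps c11 c12 c13 c14 c15 c16.
Variables (x : V) (rho0 : R).
Hypothesis Sx : S x.
Hypothesis N_good : forall rho z, rho0 <= rho -> S z -> (gdist e x z)%:R <= rho ->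
  N z <= 2 * rho `^ (1 / beta).

Local Notation q := (beta / (beta - 1)).
Local Notation phi := (rate (1 / beta) (1 - 1 / beta)).
Local Notation scale n := (n%:R `^ (1 / beta)).

Let b1 : 1 < beta. Proof. exact: beta_gt1 SG. Qed.
Let b0 : 0 < beta. Proof. exact: beta_gt0 SG. Qed.
Let q0 : 0 < q. Proof. exact: q_gt0 SG. Qed.
Let ib0 : 0 < 1 / beta. Proof. by rewrite divr_gt0. Qed.
Let ib1 : 1 / beta <= 1. Proof. by rewrite ler_pdivrMr// mul1r ltW. Qed.

Let square_near_mul (G : R) : 0 <= G ->
  \forall k \near \oo, G * (square_time k)%:R <= (square_time k.+1)%:R.
Proof.
move=> G0; have := @near_square_time R G 0 G0 (lexx 0).
by apply: filterS => k; rewrite powRr0 mulr1.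
Qed.

Let time_gap k : (square_time k.+1 - square_time k)%:R =
  (square_time k.+1)%:R - (square_time k)%:R :> R.
Proof. by rewrite natrB// square_time_le. Qed.

(** By the lower heat kernel bound, a displacement [c phi] over one time interval
    has conditional probability of order [exp (- log log / 2)], that is [1 / k]. *)
Lemma pr_far_phi : exists c delta : R, [/\ 0 < c, 0 < delta, delta <= 1 &
  \forall k \near \oo, forall z, S z -> (gdist e x z <= square_time k)%N ->
    delta / k.+1%:R <= pr (L z) [set s | c * phi (square_time k.+1)%:R <=
      (gdist e (s 0%N) (s (square_time k.+1 - square_time k)%N))%:R]].
Proof.
have al := alpha_gt0 SG; have c16p := sg_c16 SG; have c15p := sg_c15 SG.
have c12p := sg_c12 SG; have e0 := sg_eps SG.
pose Lam := @annulus_ratio R alpha c11 c12.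
have Lam2 : 2 <= Lam by exact: annulus_ratio_ge2.
have Lam0 : 0 < Lam by rewrite (lt_le_trans _ Lam2).
(* [c16 * (2 * Lam * c) `^ q = 1 / 2], the exponent asked for. *)
pose c := (1 / (2 * c16)) `^ (1 / q) / (2 * Lam).
have c0 : 0 < c by rewrite divr_gt0 ?powR_gt0 ?divr_gt0 ?mulr_gt0.
have cq : (2 * Lam * c) `^ q = 1 / (2 * c16).
  have -> : 2 * Lam * c = (1 / (2 * c16)) `^ (1 / q).
    by rewrite /c mulrC divfK// lt0r_neq0// mulr_gt0.
  by rewrite powRK// divr_ge0// mulr_ge0// ltW.
have Lc0 : 0 < 2 * Lam * c := mulr_gt0 (mulr_gt0 (ltr0Sn _ 1) Lam0) c0.
have Lc_ge0 := ltW Lc0; clearbody c.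
pose kappa := c15 * c12 / 2 * c `^ alpha.
have kappa0 : 0 < kappa by rewrite mulr_gt0 ?powR_gt0// divr_gt0// mulr_gt0.
exists c, (Num.min 1 kappa); split=> //.
- by rewrite lt_min ltr01.
- by rewrite ge_min lexx.
have eb : 1 + eps < beta by rewrite addrC; exact: sg_eps_beta SG.
have f1 : \forall k \near \oo, [/\ 1 < (square_time k.+1)%:R :> R,
    1 <= lnln (square_time k.+1)%:R :> R, 1 / c <= (square_time k.+1)%:R :> R &
    (2 * Lam * c * phi (square_time k.+1)%:R) `^ (1 + eps) <= (square_time k.+1)%:R].
  apply: (near_square_timeS (P := fun t => [/\ 1 < t, 1 <= lnln t, 1 / c <= t &
    (2 * Lam * c * phi t) `^ (1 + eps) <= t])).
  near=> t; split.
  - by near: t; apply: nbhs_pinfty_gt; exact: num_real.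
  - by near: t; exact: near_le_lnln.
  - by near: t; apply: nbhs_pinfty_ge; exact: num_real.
  - near: t; apply: near_phi_powR_le => //; by rewrite addr_gt0.
have fc : \forall k \near \oo, 1 / c <= (square_time k.+1)%:R `^ (1 / beta).
  exact: (near_square_timeS (P := fun t => 1 / c <= t `^ (1 / beta)) (near_le_powR _ ib0)).
have frho : \forall k \near \oo, rho0 <= (square_time k)%:R.
  apply: (near_seq square_time_ge (P := fun t => rho0 <= t)).
  by apply: nbhs_pinfty_ge; exact: num_real.
have G0 : 0 <= Num.max 4 ((2 / c) `^ beta) by rewrite le_max ler0n.
have fG := square_near_mul G0.
apply: filterS3 (filterI f1 fc) frho fG => k [[T1 l1 _ phiT] Tc] rho_t tT z Sz.
have tk1 : 1 <= (square_time k)%:R :> R by rewrite ler1n square_time_gt0.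
have := time_gap k.
have := @inv_succ_le_expR R k.
rewrite -(ler_nat R).
set n := (square_time k.+1 - square_time k)%N.
move: ((square_time k.+1)%:R : R) T1 l1 phiT Tc tT => T T1 l1 phiT Tc tT.
move: ((square_time k)%:R : R) tk1 rho_t tT => t t1 rho_t tT inv_le nE xz.
have t0 : 0 < t := lt_le_trans ltr01 t1.
have T0 : 0 < T := lt_trans ltr01 T1.
have l0 : 0 < lnln T := lt_le_trans ltr01 l1.
have t4 : 4 * t <= T.
  by apply: le_trans tT; rewrite ler_wpM2r ?(ltW t0)// le_max lexx.
have tc : 2 * t `^ (1 / beta) <= c * T `^ (1 / beta).
  have : ((2 / c) `^ beta * t) `^ (1 / beta) <= T `^ (1 / beta).
    apply: (powRV_mono b1); first by rewrite mulr_ge0 ?powR_ge0// ltW.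
    by apply: le_trans tT; rewrite ler_wpM2r ?(ltW t0)// le_max lexx orbT.
  rewrite powRM ?powR_ge0 ?(ltW t0)// powRKV ?divr_ge0 ?(ltW c0)//.
  by rewrite -(ler_pM2l c0) mulrA mulrCA divff ?mulr1// gt_eqF.
have nT2 : T <= 2 * n%:R by rewrite nE; lra.
have nT : n%:R <= T by rewrite nE; lra.
have n0 : 0 < n%:R :> R by lra.
have n1 : (1 <= n)%N by rewrite -(ltr_nat R).
have Nz : N z <= 2 * t `^ (1 / beta) by exact: N_good.
have Nn : N z <= n%:R.
  have : t `^ (1 / beta) <= t by rewrite -[leRHS](powRr1 (ltW t0)) ler_powR.
  by rewrite nE; lra.
have phi_T : T `^ (1 / beta) <= phi T by exact: phi_ge_scale.
set r := c * phi T.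
have rT : c * T `^ (1 / beta) <= r by rewrite ler_wpM2l// ltW.
have r1 : 1 <= r.
  by apply: le_trans rT; rewrite mulrC -ler_pdivrMr.
have Nr : N z <= r by rewrite (le_trans Nz)// (le_trans tc).
have r0 : 0 < r := lt_le_trans ltr01 r1.
have Lr0 : 0 <= Lam * r by rewrite mulr_ge0// ltW.
have rn : (Lam * r) `^ (1 + eps) <= n%:R.
  have : 2 * (Lam * r) `^ (1 + eps) <= T.
    apply: le_trans phiT.
    have -> : 2 * Lam * c * phi T = 2 * (Lam * r) by rewrite /r; ring.
    rewrite (@powRM _ 2 (Lam * r))// ler_wpM2r ?powR_ge0// -[leLHS]powRr1// ler_powR ?ler1n//.
    by rewrite lerDl ltW.
  by rewrite nE; lra.
have low := pr_far_ge e_conn ball_finite LP SG Sz n1 Nn r1 Nr rn.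
apply: (@le_trans _ _ (pr (L z) [set s | r <= (gdist e z (s n))%:R])); last first.
  apply: (le_pr_admissible LP Sz).
  - exact: (measurable_at n [set w | r <= (gdist e z w)%:R]).
  - by apply: (@measurable_determined _ _ n) => s s' ss' /=; rewrite !ss'.
  - by move=> s /(_ 0%N)[s0 _] /=; rewrite s0.
apply: le_trans low.
have sn0 : 0 < scale n :> R by exact: powR_gt0.
have sT : T `^ (1 / beta) <= 2 * scale n.
  by apply: le_trans (powRV_double b1 (ltW n0)); apply: (powRV_mono b1) => //; exact: ltW.
have snT : scale n <= T `^ (1 / beta) by apply: (powRV_mono b1) => //; exact: ltW.
have expo : expR (- (1 / 2 * lnln T)) <= expR (- (c16 * (Lam * r / scale n) `^ q)).
  rewrite ler_expR lerN2.
  apply: (@le_trans _ _ (c16 * ((2 * Lam * c) `^ q * lnln T))); last first.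
    by rewrite cq le_eqVlt; apply/orP; left; apply/eqP; field; rewrite gt_eqF.
  rewrite ler_wpM2l ?(ltW c16p)// -(phi_scale_powR b1 Lc_ge0 T0 l0).
  apply: powR_le; [exact: ltW|by rewrite divr_ge0// ltW|].
  rewrite ler_pdivrMr// mulrAC ler_pdivlMr ?powR_gt0//.
  rewrite (_ : 2 * Lam * c * phi T * scale n = (Lam * r) * (2 * scale n)); last by rewrite /r; ring.
  by rewrite ler_wpM2l.
have ratio : c `^ alpha <= r `^ alpha / n%:R `^ (alpha / beta).
  rewrite ler_pdivlMr ?powR_gt0//.
  have -> : n%:R `^ (alpha / beta) = scale n `^ alpha :> R.
    by rewrite -powRrM; congr powR; field; exact: lt0r_neq0.
  rewrite -powRM ?(ltW c0) ?powR_ge0//; apply: powR_le; [exact: ltW|by rewrite mulr_ge0 ?powR_ge0// ltW|].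
  by apply: le_trans rT; rewrite ler_wpM2l// ltW.
have cc0 : 0 <= c15 * c12 / 2 by rewrite divr_ge0// mulr_ge0// ltW.
apply: (@le_trans _ _ (kappa * expR (- (1 / 2 * lnln T)))).
  apply: ler_pM => //; [by rewrite le_min ler01 ltW|by rewrite ge_min lexx orbT].
by rewrite /kappa; apply: ler_pM => //; [rewrite mulr_ge0// powR_ge0|rewrite ler_wpM2l].
Unshelve. all: by end_near. Qed.

End LowerEstimates.

Section StayEstimates.
Context {R : realType} {V : countType} {v0 : V} {e : rel V} {S : set V}
        {p : V -> V -> R} {L : V -> probability (paths v0) R} {mu N : V -> R}
        {alpha beta eps c11 c12 c13 c14 c15 c16 : R}.
Hypotheses (e_sym : symmetric e) (e_conn : connected_graph e).
Hypothesis ball_finite : forall x (r : R), finite_set (gball e x r).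
Hypothesis LP : markov_laws e S p L.
Hypothesis SG :
  subgaussian e S mu N L alpha beta eps c11 c12 c13 c14 c15 c16.
Variables (x : V) (rho0 : R).
Hypothesis Sx : S x.
Hypothesis N_good : forall rho z, rho0 <= rho -> S z -> (gdist e x z)%:R <= rho ->
  N z <= 2 * rho `^ (1 / beta).

Local Notation q := (beta / (beta - 1)).
Local Notation psi := (rate (1 / beta) (- (1 / beta))).
Local Notation scale n := (n%:R `^ (1 / beta)).

Let b1 : 1 < beta. Proof. exact: beta_gt1 SG. Qed.
Let b0 : 0 < beta. Proof. exact: beta_gt0 SG. Qed.
Let q0 : 0 < q. Proof. exact: q_gt0 SG. Qed.
Let ib0 : 0 < 1 / beta. Proof. by rewrite divr_gt0. Qed.

(** One block of time [a^beta]: the walk is likely enough to end near [y] and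
    unlikely to make an excursion of size [2 H a], once [H] is large. *)
Lemma pr_block_stay : exists H delta a0 : R, [/\ 0 < H, 0 < delta, delta <= 1 &
  forall (a : R) (y z : V) (m := (Num.truncn (a `^ beta)).+1), a0 <= a ->
    S y -> S z -> (gdist e z y)%:R <= a ->
    (forall w, S w -> (gdist e y w)%:R <= (2 * H + 2) * a -> N w <= a / 2) ->
    delta <= pr (L z) [set s | (gdist e y (s m))%:R <= a /\
      forall l, (l <= m)%N -> (gdist e (s 0%N) (s l))%:R <= 2 * H * a]].
Proof.
have [K1 [K2 [K10 K20 farP]]] := far_le e_conn ball_finite LP SG.
have al := alpha_gt0 SG; have c16p := sg_c16 SG; have c15p := sg_c15 SG.
have c11p := sg_c11 SG; have e0 := sg_eps SG.
pose D := c15 * c11 / 4 * (1 / 4) `^ alpha * expR (- (c16 * 2 `^ q)).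
have D0 : 0 < D by rewrite !mulr_gt0 ?powR_gt0 ?expR_gt0.
(* [2 * D] bounds below the probability of ending near [y]; the radius [h] makes
   an excursion at most half as likely. *)
pose h := 1 + 2 * K1 / (K2 * D).
have h1 : 1 <= h by rewrite lerDl divr_ge0// mulr_ge0// ltW.
have hK : 2 * (K1 * expR (- (K2 * h `^ q))) <= D.
  have h0 : 0 < h := lt_le_trans ltr01 h1.
  have hq : h <= h `^ q by apply: le1r_powR => //; exact/ltW/(q_gt1 SG).
  have hKD : 2 * K1 <= K2 * h * D.
    have -> : K2 * h * D = K2 * D + 2 * K1.
      by rewrite /h; field; rewrite !gt_eqF.
    by rewrite lerDr mulr_ge0// ltW.
  rewrite mulrA expRN ler_pdivrMr ?expR_gt0// (le_trans hKD)// mulrC ler_wpM2l ?(ltW D0)//.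
  apply: (@le_trans _ _ (K2 * h `^ q)); first by rewrite ler_wpM2l// ltW.
  by rewrite (le_trans _ (expR_ge1Dx _))// lerDr.
clearbody h.
have fact : \forall a \near +oo, [/\ 4 <= a, 1 <= a `^ beta &
    (2 `^ (1 + eps)) <= a `^ (beta - (1 + eps))].
  near=> a; split.
  - by near: a; apply: nbhs_pinfty_ge; exact: num_real.
  - by near: a; exact: near_le_powR.
  - by near: a; apply: near_le_powR; rewrite subr_gt0 addrC; exact: sg_eps_beta SG.
have [M [_ MP]] := fact.
exists (4 * h), (Num.min 1 D), (M + 1); split.
- by rewrite mulr_gt0// (lt_le_trans ltr01).
- by rewrite lt_min ltr01.
- by rewrite ge_min lexx.
move=> a y z m aM Sy Sz zy Ny.
have [a4 ab1 a_eps] := MP a (lt_le_trans (ltr_pwDr ltr01 (lexx M)) aM).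
have a0 : 0 < a by lra.
have m_gt : a `^ beta <= m%:R by rewrite ltW// truncnS_gt.
have m_le : m%:R <= 2 * a `^ beta.
  by rewrite /m -natr1 mulr_natl mulr2n lerD// truncn_le// powR_ge0.
have m1 : (1 <= m)%N by [].
clearbody m.
have m0 : 0 < m%:R :> R by rewrite ltr0n.
have sm_ge : a <= scale m by apply: powR_powRV_le => //; exact: ltW.
have sm_le : scale m <= 2 * a.
  apply: (@le_trans _ _ ((2 * a `^ beta) `^ (1 / beta))); first by apply: (powRV_mono b1) => //; exact: ltW.
  by apply: (le_trans (powRV_double b1 (powR_ge0 _ _))); rewrite powRKV// ltW.
have sm0 : 0 < scale m :> R by exact: powR_gt0.
have aam : a <= m%:R.
  by apply: le_trans m_gt; apply: le1r_powR; [lra|exact: ltW].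
have yz : (gdist e y z)%:R <= a by rewrite (gdist_sym e_sym e_conn).
have ha : 4 <= 4 * h * a by nra.
have Nz : N z <= a / 2 by apply: Ny => //; nra.
have Nyy : N y <= a / 2 by apply: Ny => //; rewrite gdistxx; nra.
have an : (2 * a) `^ (1 + eps) <= m%:R.
  apply: le_trans m_gt; rewrite (@powRM _ 2 a) ?(ltW a0)//.
  have -> : a `^ beta = a `^ (beta - (1 + eps)) * a `^ (1 + eps).
    by rewrite -powR_split// subrK.
  by rewrite ler_wpM2r// powR_ge0.
pose G := [set s : nat -> V | (gdist e y (s m))%:R <= a].
have mG : measurable (G : set (paths v0)) by exact: (measurable_at m [set w | (gdist e y w)%:R <= a]).
have prG : 2 * D <= pr (L z) G.
  have zm : N z <= m%:R by lra.
  have a2 : 2 <= a by lra.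
  have ya : N y <= a - 1 by lra.
  apply: le_trans (pr_ball_ge e_sym e_conn ball_finite LP SG Sy Sz m1 zm a2 ya zy an).
  have -> : 2 * D = c15 * c11 / 2 * (1 / 4) `^ alpha * expR (- (c16 * 2 `^ q)).
    by rewrite /D; field.
  have cc0 : 0 <= c15 * c11 / 2 by rewrite divr_ge0// mulr_ge0// ltW.
  apply: ler_pM; [by rewrite mulr_ge0// powR_ge0|exact: expR_ge0| |].
    rewrite ler_wpM2l// ler_pdivlMr ?powR_gt0//.
    have -> : m%:R `^ (alpha / beta) = scale m `^ alpha :> R.
      by rewrite -powRrM; congr powR; field; exact: lt0r_neq0.
    rewrite -powRM ?powR_ge0 ?divr_ge0//; apply: powR_le; [exact: ltW|by rewrite mulr_ge0 ?divr_ge0// ltW|].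
    by lra.
  rewrite ler_expR lerN2 ler_wpM2l ?(ltW c16p)//.
  by apply: powR_le; [exact: ltW|rewrite divr_ge0 ?mulr_ge0// ltW|rewrite ler_pdivrMr// ler_wpM2l].
pose B := [set s : nat -> V | exists2 l, (l <= m)%N & 2 * (4 * h * a) <= (gdist e z (s l))%:R].
have mB : measurable (B : set (paths v0)).
  by apply: (@measurable_determined _ _ m) => s t st [l lm sl]; exists l => //; rewrite -st.
have prB : pr (L z) B <= D.
  apply: le_trans hK; apply: (exit_le e_sym e_conn LP Sz); first by lra.
  move=> w n Sw zw /andP[mn n2m].
  have mnR : m%:R <= n%:R :> R by rewrite ler_nat.
  have n2mR : n%:R <= 2 * m%:R :> R by rewrite -natrM ler_nat.
  have n0 : 0 < n%:R :> R := lt_le_trans m0 mnR.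
  have sn_le : scale n <= 4 * a.
    apply: (@le_trans _ _ ((2 * m%:R) `^ (1 / beta))); first by apply: (powRV_mono b1) => //; exact: ltW.
    by apply: (le_trans (powRV_double b1 (ltW m0))); lra.
  have Nw : N w <= a / 2.
    apply: Ny => //; apply: (le_trans (gdist_triangleR (R := R) e_conn y z w)).
    by lra.
  have ra : 4 * a <= 4 * h * a by rewrite ler_wpM2r ?(ltW a0)// ler_peMr.
  apply: (le_trans (farP w n (4 * h * a) Sw _ _ _ _ _)).
  - exact: leq_trans m1 mn.
  - by lra.
  - by lra.
  - by lra.
  - by lra.
  rewrite ler_wpM2l ?(ltW K10)// ler_expR lerN2 ler_wpM2l ?(ltW K20)//.
  apply: powR_le; [exact: ltW|by rewrite (le_trans ler01)|].
  rewrite ler_pdivlMr ?powR_gt0// [4 * h]mulrC -mulrA ler_wpM2l// (le_trans ler01)//.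
have split := pr_split (L z) mG mB.
have GB : pr (L z) (G `&` B) <= D by apply: le_trans prB; apply: le_pr => //; exact: measurableI.
apply: (@le_trans _ _ (pr (L z) (G `&` ~` B))).
  by rewrite ge_min; apply/orP; right; lra.
apply: (le_pr_admissible LP Sz).
- by apply: measurableI => //; exact: measurableC.
- apply: (@measurable_determined _ _ m) => s t st [sm sl]; split; first by rewrite -st.
  by move=> l lm; rewrite -!st//; exact: sl.
- move=> s /(_ 0%N)[s0 _] [Gs nBs]; split=> // l lm; rewrite s0 leNgt; apply/negP => ls.
  by apply: nBs; exists l => //; rewrite mulrA ltW.
Unshelve. all: by end_near. Qed.

(** Chaining blocks that end near their common centre [y]. *)
Lemma pr_stay_ge : exists H delta a0 : R, [/\ 0 < H, 0 < delta, delta <= 1 &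
  forall (a : R) (y : V) (k : nat) (m := (Num.truncn (a `^ beta)).+1), a0 <= a ->
    S y -> (forall w, S w -> (gdist e y w)%:R <= (2 * H + 2) * a -> N w <= a / 2) ->
    delta ^+ k <= pr (L y) [set s | forall l, (l <= k * m)%N ->
      (gdist e (s 0%N) (s l))%:R <= (2 * H + 1) * a]].
Proof.
have [H [delta [a0 [H0 d0 d1 block]]]] := pr_block_stay.
exists H, delta, (Num.max 0 a0); split => // a y k m; rewrite ge_max => /andP[a_ge0 aa0] Sy Ny.
pose F k := [set s : nat -> V | (gdist e y (s (k * m)%N))%:R <= a /\
  forall l, (l <= k * m)%N -> (gdist e y (s l))%:R <= (2 * H + 1) * a].
have Fdet i : determined (i * m) (F i).
  by move=> s t st [sm sl]; split=> [|l lm]; rewrite -st//; exact: sl.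
have mF i : measurable (F i : set (paths v0)) by exact: measurable_determined (Fdet i).
suff Fge : delta ^+ k <= pr (L y) (F k).
  apply: (le_trans Fge); apply: (le_pr_admissible LP Sy) => //.
    apply: (@measurable_determined _ _ (k * m)) => s t st sl l lm; rewrite -!st//; exact: sl.
  by move=> s /(_ 0%N)[s0 _] [_ sl] l lm; rewrite s0; exact: sl.
elim: k => [|k IH].
  rewrite expr0 (pr1_admissible LP Sy)//.
  move=> s /(_ 0%N)[s0 _]; split; first by rewrite mul0n s0 gdistxx.
  by move=> l; rewrite mul0n leqn0 => /eqP->; rewrite s0 gdistxx// mulr_ge0// addr_ge0// mulr_ge0// ltW.
pose B := [set s : nat -> V | (gdist e y (s m))%:R <= a /\
      forall l, (l <= m)%N -> (gdist e (s 0%N) (s l))%:R <= 2 * H * a].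
have mB : measurable (B : set (paths v0)).
  apply: (@measurable_determined _ _ m) => s t st [sm sl]; split; first by rewrite -st.
  by move=> l lm; rewrite -!st//; exact: sl.
apply: (@le_trans _ _ (pr (L y) (F k `&` future (k * m) @^-1` B))).
  rewrite exprSr; apply: (le_trans (ler_wpM2r (ltW d0) IH)).
  apply: (markov_ge LP) => // s [sm _] adm; apply: block => //.
    exact: (admissible_in Sy adm).
  by rewrite (gdist_sym e_sym e_conn).
apply: le_pr => //; first by apply: measurableI => //; exact: measurable_future.
move=> s [[sm sl] [Bm Bl]]; split; first by move: Bm; rewrite /future mulSn addnC.
move=> l lm; have [lk|kl] := leqP l (k * m); first exact: sl.
apply: (le_trans (gdist_triangleR (R := R) e_conn y (s (k * m)%N) _)).
have := Bl (l - k * m)%N; rewrite /future addn0 subnKC ?(ltnW kl)// leq_subLR addnC -mulSn.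
by move=> /(_ lm); rewrite mulrDl mul1r; move: sm; lra.
Qed.

(** The interval is covered by about [log log n] blocks of length of order
    [psi^beta = n / log log n], and each block has a fixed cost, so the probability is
    a power of [1 / log n]; the constant [C] is chosen large enough to make the
    exponent at most 1/2. *)
Lemma pr_stay_psi : exists C delta : R, [/\ 0 < C, 0 < delta, delta <= 1 &
  \forall k \near \oo, forall z, S z -> (gdist e x z <= square_time k)%N ->
    delta / k.+1%:R <= pr (L z) [set s | forall l,
      (l <= square_time k.+1 - square_time k)%N ->
      (gdist e (s 0%N) (s l))%:R <= C * psi (square_time k.+1)%:R]].
Proof.
have [H [delta [a0 [H0 d0 d1 stay]]]] := pr_stay_ge.
have lnd : ln delta <= 0 by exact: ln_le0.
(* There are [lnln T / Cb] blocks, and [delta ^ (1 / Cb) >= exp (- 1 / 2)]. *)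
pose Cb := 1 - 2 * ln delta; have Cb0 : 0 < Cb by rewrite /Cb; lra.
pose C := Cb `^ (1 / beta); have C0 : 0 < C by exact: powR_gt0.
have CbE : C `^ beta = Cb by rewrite powRK// ltW.
have HC0 : 0 < (2 * H + 1) * C by rewrite mulr_gt0// addr_gt0// mulr_gt0.
exists ((2 * H + 1) * C), delta; split=> //.
pose G1 := 2 * 4 `^ beta; have G10 : 0 < G1 by rewrite mulr_gt0 ?powR_gt0.
have facta : \forall a \near +oo, [/\ a0 <= a, 1 <= a, rho0 <= a &
    G1 * (2 * H + 2) <= a `^ (beta - 1)].
  near=> a; split.
  - by near: a; apply: nbhs_pinfty_ge; exact: num_real.
  - by near: a; apply: nbhs_pinfty_ge; exact: num_real.
  - by near: a; apply: nbhs_pinfty_ge; exact: num_real.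
  - by near: a; apply: near_le_powR; rewrite subr_gt0.
have [M [_ MP]] := facta.
have f1 : \forall k \near \oo, [/\ 1 < (square_time k.+1)%:R :> R,
    1 <= lnln (square_time k.+1)%:R :> R & (M + 1) / C <= psi (square_time k.+1)%:R].
  apply: (near_square_timeS (P := fun t => [/\ 1 < t, 1 <= lnln t & (M + 1) / C <= psi t])).
  near=> t; split.
  - by near: t; apply: nbhs_pinfty_gt; exact: num_real.
  - by near: t; exact: near_le_lnln.
  - by near: t; exact: near_rate_ge.
have G2 : 0 <= G1 / Cb by rewrite divr_ge0// ltW.
have f2 := @near_square_time R (G1 / Cb) 1 G2 ler01.
apply: filterS2 f1 f2 => k [T1 l1 psiM] tT z Sz.
have tk0 : 0 <= (square_time k)%:R :> R by [].
have := @inv_succ_le_expR R k.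
rewrite -(ler_nat R).
have : (square_time k.+1 - square_time k)%:R <= (square_time k.+1)%:R :> R.
  by rewrite ler_nat leq_subr.
move: (square_time k.+1 - square_time k)%N => n.
move: ((square_time k.+1)%:R : R) T1 l1 psiM tT => T T1 l1 psiM tT.
move: ((square_time k)%:R : R) tk0 tT => t t0 tT nT inv_le xz.
have T0 : 0 < T := lt_trans ltr01 T1.
have l0 : 0 < lnln T := lt_le_trans ltr01 l1.
pose a := C * psi T.
have aM : M + 1 <= a by rewrite /a mulrC -ler_pdivrMr.
have [aa0 a1 arho a_big] := MP a (lt_le_trans (ltr_pwDr ltr01 (lexx M)) aM).
have abE : a `^ beta = Cb * (T / lnln T).
  by rewrite /a powRM ?(ltW C0) ?mulr_ge0 ?powR_ge0// CbE (psi_powR b1 T0 l0).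
have a_gt0 : 0 < a := lt_le_trans ltr01 a1.
rewrite -mulrA -/a; clearbody a.
have ab0 : 0 < a `^ beta by exact: powR_gt0.
have Ny w : S w -> (gdist e z w)%:R <= (2 * H + 2) * a -> N w <= a / 2.
  move=> Sw zw; pose rho := t + (2 * H + 2) * a.
  have Ha0 : 0 <= H * a by rewrite mulr_ge0// ltW.
  have rho_ge : rho0 <= rho by apply: (le_trans arho); rewrite /rho; lra.
  have xw : (gdist e x w)%:R <= rho.
    by apply: (le_trans (gdist_triangleR (R := R) e_conn x z w)); rewrite /rho lerD.
  apply: (le_trans (N_good rho_ge Sw xw)).
  suff : rho `^ (1 / beta) <= a / 4 by lra.
  rewrite -[leRHS](powRKV b0); last by rewrite divr_ge0// ltW.
  apply: (powRV_mono b1); first by rewrite /rho; lra.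
  have four : 0 < 4 `^ beta :> R by exact: powR_gt0.
  have aE : (a / 4) `^ beta * 4 `^ beta = a `^ beta.
    by rewrite -powRM ?divr_ge0 ?(ltW a_gt0)// divfK.
  rewrite -(ler_pM2r four) aE.
  have p1 : G1 * t <= a `^ beta.
    rewrite abE mulrA ler_pdivlMr//.
    have -> : G1 * t * lnln T = Cb * (G1 / Cb * t * lnln T) by field; rewrite gt_eqF.
    by rewrite ler_wpM2l ?(ltW Cb0)//; move: tT; rewrite powRr1// ltW.
  have p2 : G1 * ((2 * H + 2) * a) <= a `^ beta.
    rewrite -(mulr_powRB1 (ltW a_gt0) b0) mulrA mulrC.
    by rewrite ler_wpM2l// ltW.
  by move: p1 p2; rewrite /G1 /rho; lra.
pose m := (Num.truncn (a `^ beta)).+1.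
have m_gt : a `^ beta <= m%:R by rewrite ltW// truncnS_gt.
have [i im_ge im_lt] : exists2 i, (n <= i * m)%N & (i%:R * a `^ beta <= n%:R + a `^ beta).
  exists (n %/ m).+1; first exact/ltnW/ltn_ceil.
  rewrite -natr1 mulrDl mul1r lerD2r (@le_trans _ _ ((n %/ m)%:R * m%:R))//.
    by rewrite ler_wpM2l.
  by rewrite -natrM ler_nat leq_divM.
apply: (@le_trans _ _ (delta ^+ i)); last first.
  apply: (le_trans (stay a z i aa0 Sz Ny)).
  apply: le_pr.
  - apply: (@measurable_determined _ _ (i * m)) => s s' ss' sl l lm; rewrite -!ss'//; exact: sl.
  - apply: (@measurable_determined _ _ n) => s s' ss' sl l lm; rewrite -!ss'//; exact: sl.
  - by move=> s sl l ln; apply: sl; exact: leq_trans im_ge.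
have i_le : i%:R <= lnln T / Cb + 1.
  have : i%:R * a `^ beta <= T + a `^ beta by lra.
  rewrite -ler_pdivlMr// mulrDl divff ?gt_eqF// abE => /le_trans; apply.
  rewrite lerD2r le_eqVlt; apply/orP; left; apply/eqP; field.
  by rewrite !gt_eqF.
apply: (@le_trans _ _ (delta * expR (- (1 / 2 * lnln T)))); first by rewrite ler_wpM2l// ltW.
rewrite -[delta ^+ i](lnK (_ : _ \is Num.pos)) ?posrE ?exprn_gt0// lnXn//.
rewrite -{1}[delta](lnK (_ : _ \is Num.pos)) ?posrE// -expRD ler_expR -[leRHS]mulr_natr.
have : ln delta * (lnln T / Cb + 1) <= ln delta * i%:R by exact: ler_wnM2l.
apply: le_trans; rewrite mulrDr mulr1 addrC lerD2r.
have -> : ln delta * (lnln T / Cb) = ln delta / Cb * lnln T by rewrite mulrA mulrAC.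
by rewrite -mulNr ler_wpM2r ?(ltW l0)// ler_pdivlMr// /Cb; lra.
Unshelve. all: by end_near. Qed.

End StayEstimates.

(** * Law of the iterated logarithm in a good environment *)

Section ChainLIL.
Context {R : realType} {V : countType} {v0 : V} {e : rel V} {S : set V}
        {p : V -> V -> R} {L : V -> probability (paths v0) R} {mu N : V -> R}
        {alpha beta eps c11 c12 c13 c14 c15 c16 : R}.
Hypotheses (e_sym : symmetric e) (e_conn : connected_graph e).
Hypothesis ball_finite : forall x (r : R), finite_set (gball e x r).
Hypothesis LP : markov_laws e S p L.
Hypothesis SG :
  subgaussian e S mu N L alpha beta eps c11 c12 c13 c14 c15 c16.
Variables (x : V) (rho0 : R).
Hypothesis Sx : S x.
Hypothesis N_good : forall rho z, rho0 <= rho -> S z -> (gdist e x z)%:R <= rho ->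
  N z <= 2 * rho `^ (1 / beta).

Local Notation phi := (rate (1 / beta) (1 - 1 / beta)).
Local Notation psi := (rate (1 / beta) (- (1 / beta))).
Let b1 : 1 < beta. Proof. exact: beta_gt1 SG. Qed.
Let b0 : 0 < beta. Proof. exact: beta_gt0 SG. Qed.
Let ib0 : 0 < 1 / beta. Proof. by rewrite divr_gt0. Qed.

Local Notation time j := ((2 ^ j)%:R : R).

Let pow2_near (P : R -> Prop) : (\forall t \near +oo, P t) ->
  \forall j \near \oo, P (time j).
Proof. by apply: near_seq => j; exact/ltnW/ltn_expl. Qed.

Let square_near (P : R -> Prop) : (\forall t \near +oo, P t) ->
  \forall k \near \oo, P (square_time k)%:R.
Proof. exact: near_seq square_time_ge. Qed.

Let lnln_near : \forall t \near +oo, (1 : R) < t /\ 1 <= lnln t.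
Proof.
near=> t; split; first by near: t; apply: nbhs_pinfty_gt; exact: num_real.
by near: t; exact: near_le_lnln.
Unshelve. all: by end_near. Qed.

Let rate_gt0 (a b t : R) : 1 < t -> 1 <= lnln t -> 0 < rate a b t.
Proof.
by move=> t1 l1; rewrite mulr_gt0 ?powR_gt0// (lt_le_trans ltr01)// ltW.
Qed.

Lemma max_dist_leR s n (r : R) : 0 <= r ->
  (forall l, (l <= n)%N -> (gdist e (s 0%N) (s l))%:R <= r) ->
  (max_dist e s n)%:R <= r.
Proof.
move=> r0 sr; apply: (@le_trans _ _ (Num.truncn r)%:R); last by rewrite truncn_le.
by rewrite ler_nat; apply: max_dist_le => l ln; rewrite truncn_ge_nat// sr.
Qed.

Definition confined_phi (A : R) (J : nat) : set (nat -> V) :=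
  [set s | forall j l, (J <= j)%N -> (l <= 2 ^ j)%N ->
     (gdist e x (s l))%:R < A * phi (time j)].

Lemma pr_confined_phi : exists A J, [/\ 0 < A,
  measurable (confined_phi A J : set (paths v0)) & 0 < pr (L x) (confined_phi A J)].
Proof.
have [A [K [A0 K0 EP]]] := pr_exceeds_phi e_sym e_conn ball_finite LP SG Sx N_good.
pose E j := @exceeds R V e x (2 ^ j) (A * phi (time j)).
have mE j : measurable (E j : set (paths v0)).
  apply: (@measurable_determined _ _ (2 ^ j)); exact: determined_exceeds.
have EJ : \forall j \near \oo, pr (L x) (E j) <= K * expR (- (2 * lnln (time j))).
  have [n0 _ nP] := EP; exists n0 => // j /= nj; apply: nP => /=.
  by rewrite (leq_trans nj)// ltnW// ltn_expl.
have [J PJ] := dyadic_union K0 mE EJ.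
have mU : measurable (\bigcup_k E (J + k)%N : set (paths v0)) by exact: bigcup_measurable.
have UE : confined_phi A J = ~` \bigcup_k E (J + k)%N.
  apply/seteqP; split=> s.
    by move=> sA [k _ [l lk]]; rewrite leNgt sA// leq_addr.
  move=> nU j l Jj lj; rewrite ltNge; apply/negP => sl; apply: nU.
  by exists (j - J)%N => //; rewrite subnKC//; exists l.
exists A, J; rewrite UE; split => //; first exact: measurableC.
by rewrite prC// subr_gt0.
Qed.

(** A bound at the dyadic times is a bound at all times, since the maximum up to
    the next power of 2 is controlled and [phi] at most quadruples in between. *)
Lemma limsup_ratio_le : exists C : R,
  0 < pr (L x) [set s | limsup_ratio e beta s <= C%:E]%E.
Proof.
have [A [J [A0 mA prA]]] := pr_confined_phi.
exists (4 * A); apply: (lt_le_trans prA); apply: (le_pr_admissible LP Sx) => //.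
  rewrite -[X in measurable X]setTI; apply: emeasurable_fun_infty_c => //.
  exact: (@measurable_limsup_ratio R V v0 e).
move=> s /(_ 0%N)[s0 _] sA; rewrite /= (@limsup_ratioE R V e beta s); apply: limn_esup_le.
have near2 := near_seq (t := id) (fun n => leqnn n) (near_phi_double b1).
have near3 := near_seq (t := id) (fun n => leqnn n) lnln_near.
have near4 : \forall n \near \oo, (2 ^ J <= n)%N by exists (2 ^ J)%N.
apply: filterS3 near2 near3 near4 => n phi2 [n1 l1] Jn.
have n0 : (0 < n)%N by rewrite (leq_trans _ Jn)// expn_gt0.
pose j := (trunc_log 2 n).+1.
have nj : (n < 2 ^ j)%N by exact: trunc_log_ltn.
have jn : (2 ^ j <= 2 * n)%N by rewrite expnS leq_mul2l trunc_logP.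
have Jj : (J <= j)%N by rewrite -(leq_exp2l _ _ (ltnSn 1)) (leq_trans Jn)// ltnW.
have nR : 0 < phi n%:R by exact: rate_gt0.
rewrite /dist_ratio s0 ler_pdivrMr// (le_trans (ltW (sA j n Jj (ltnW nj))))//.
rewrite (_ : 4 * A * phi n%:R = A * (4 * phi n%:R)); last by ring.
rewrite ler_wpM2l ?(ltW A0)//; apply: le_trans phi2; apply: phi_le => //.
- by rewrite (lt_trans n1)// ltr_nat.
- have njR : n%:R <= time j by rewrite ler_nat ltnW.
  by rewrite (lt_le_trans ltr01)// (le_trans l1)// lnln_le.
- by rewrite -natrM ler_nat.
Qed.

(** With [r = c psi n] the confinement bound is [exp (- 2 log log n)] for small [c],
    which is summable along the powers of 2. *)
Lemma liminf_ratio_ge : exists2 c : R, 0 < c &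
  0 < pr (L x) [set s | c%:E <= liminf_ratio e beta s]%E.
Proof.
have [kap [r0 [kap0 conf]]] := pr_confined e_sym e_conn ball_finite LP SG Sx N_good.
(* The exponent in [pr_confined] is then [ln 2 / (2 * kap * cb) = 2] times
   [log log]. *)
pose cb : R := ln 2 / (4 * kap).
have cb0 : 0 < cb by rewrite divr_gt0 ?ln2_gt0// mulr_gt0.
pose c := cb `^ (1 / beta); have c0 : 0 < c by exact: powR_gt0.
have cbE : c `^ beta = cb by rewrite powRK// ltW.
clearbody c.
exists (c / 2); first by rewrite divr_gt0.
pose E j := [set s : nat -> V | forall l, (l <= 2 ^ j)%N ->
  (gdist e x (s l))%:R <= c * psi (time j)].
have mE j : measurable (E j : set (paths v0)).
  by apply: (@measurable_determined _ _ (2 ^ j)) => s t st sl l lj; rewrite -st//; exact: sl.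
have EJ : \forall j \near \oo, pr (L x) (E j) <= 2 * expR (- (2 * lnln (time j))).
  have large := pow2_near (near_rate_ge (- (1 / beta)) (r0 / c) ib0).
  apply: filterS2 (pow2_near lnln_near) large => j [t1 l1] rj.
  have t0 : 0 < time j := lt_trans ltr01 t1.
  have l0 : 0 < lnln (time j) := lt_le_trans ltr01 l1.
  apply: (le_trans (conf (c * psi (time j)) (2 ^ j)%N _)).
    by rewrite mulrC -ler_pdivrMr.
  rewrite powRM ?(ltW c0) ?mulr_ge0 ?powR_ge0// cbE (psi_powR b1 t0 l0).
  rewrite le_eqVlt; apply/orP; left; apply/eqP; congr (_ * expR (- _)).
  move: (time j) (lnln (time j)) t0 l0 => T l T0 l0; rewrite /cb.
  by field; rewrite !gt_eqF ?ln2_gt0.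
have [J PJ] := dyadic_union (ltr0Sn _ 1) mE EJ.
have mU : measurable (\bigcup_k E (J + k)%N : set (paths v0)) by exact: bigcup_measurable.
apply: (@lt_le_trans _ _ (pr (L x) (~` \bigcup_k E (J + k)%N))); first by rewrite prC// subr_gt0.
apply: (le_pr_admissible LP Sx); first exact: measurableC.
  rewrite -[X in measurable X]setTI; apply: emeasurable_fun_c_infty => //.
  exact: (@measurable_liminf_ratio R V v0 e).
move=> s /(_ 0%N)[s0 _] nU; rewrite /= (@liminf_ratioE R V e beta s); apply: limn_einf_ge.
have [J1 _ factJ] := pow2_near lnln_near.
have near3 := near_seq (t := id) (fun n => leqnn n) lnln_near.
have near4 : \forall n \near \oo, (2 ^ maxn J J1 <= n)%N by exists (2 ^ maxn J J1)%N.
apply: filterS2 near3 near4 => n [n1 l1] Jn.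
have n0 : (0 < n)%N by rewrite (leq_trans _ Jn)// expn_gt0.
pose j := trunc_log 2 n.
have nj : (n < 2 ^ j.+1)%N by exact: trunc_log_ltn.
have jn : (2 ^ j <= n)%N by exact: trunc_logP.
have : (maxn J J1 <= j)%N.
  by rewrite -ltnS -(ltn_exp2l _ _ (ltnSn 1)) (leq_ltn_trans Jn).
rewrite geq_max => /andP[Jj J1j].
have [tj lj] := factJ j J1j; clearbody j.
have nR : 0 < psi n%:R by exact: rate_gt0.
rewrite /max_ratio ler_pdivlMr//.
have [l lj2 sl] : exists2 l, (l <= 2 ^ j)%N & c * psi (time j) < (gdist e x (s l))%:R.
  apply: contrapT => nl; apply: nU; exists (j - J)%N => //; rewrite subnKC// => l lj2.
  by rewrite leNgt; apply/negP => sl; apply: nl; exists l.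
apply: (@le_trans _ _ (gdist e x (s l))%:R); last first.
  by rewrite ler_nat -s0; apply: max_dist_ge; exact: leq_trans lj2 jn.
apply: le_trans (ltW sl); rewrite -mulrA ler_wpM2l ?(ltW c0)// ler_pdivrMl//.
apply: psi_le_double => //.
- exact: lt_le_trans ltr01 lj.
- by rewrite ler_nat.
- by rewrite -natrM ler_nat -expnS ltnW.
Qed.

Let square_det k : (square_time k <= square_time k.+1)%N.
Proof. exact: square_time_le. Qed.

(** Infinitely often the walk moves by [c phi] between two square times, so that it
    is at distance at least [c / 2 * phi] from its start at one of the two. *)
Lemma limsup_ratio_ge : exists2 c : R, 0 < c &
  0 < pr (L x) [set s | c%:E <= limsup_ratio e beta s]%E.
Proof.
have [c [delta [c0 d0 d1 EP]]] := pr_far_phi e_conn ball_finite LP SG N_good.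
exists (c / 2); first by rewrite divr_gt0.
pose E k := [set s : nat -> V | c * phi (square_time k.+1)%:R <=
  (gdist e (s 0%N) (s (square_time k.+1 - square_time k)%N))%:R].
have Edet k : determined (square_time k.+1 - square_time k) (E k).
  by move=> s t st; rewrite /E /= !st.
have io := conditional_io e_conn LP Sx square_time_le d0 d1 Edet EP.
apply: (lt_le_trans ltr01); rewrite -[leLHS]io.
apply: (le_pr_admissible LP Sx).
- apply: bigcap_measurableType => m _; apply: bigcup_measurable => k _.
  by apply: measurable_future; exact: measurable_determined (Edet (m + k)%N).
- rewrite -[X in measurable X]setTI; apply: emeasurable_fun_c_infty => //.
  exact: (@measurable_limsup_ratio R V v0 e).
move=> s _ sio; rewrite /= (@limsup_ratioE R V e beta s); apply: limn_esup_ge => m.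
have [k0 _ fact] := square_near lnln_near.
have [i _] := sio (maxn m k0) I; set k := (maxn m k0 + i)%N.
have mk : (m <= k)%N by rewrite (leq_trans (leq_maxl m k0))// leq_addr.
have k0k : (k0 <= k)%N by rewrite (leq_trans (leq_maxr m k0))// leq_addr.
clearbody k; rewrite /E /future /= addn0 subnKC// => far.
have [t1 lt1] := fact k k0k.
have [T1 lT1] := fact k.+1 (leqW k0k).
have phiT := rate_gt0 (1 / beta) (1 - 1 / beta) T1 lT1.
have phit := rate_gt0 (1 / beta) (1 - 1 / beta) t1 lt1.
have phi_mono : phi (square_time k)%:R <= phi (square_time k.+1)%:R.
  by apply: phi_le => //; [exact: lt_le_trans ltr01 lt1|rewrite ler_nat].
have tri := gdist_triangleR (R := R) e_conn (s (square_time k)) (s 0%N) (s (square_time k.+1)).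
rewrite (gdist_sym e_sym e_conn (s (square_time k)) (s 0%N)) in tri.
have [large|small] := leP (c / 2 * phi (square_time k.+1)%:R)
    (gdist e (s 0%N) (s (square_time k.+1)))%:R.
  exists (square_time k.+1); last by rewrite /dist_ratio ler_pdivlMr.
  by rewrite (leq_trans mk)// (leq_trans (leqnSn k))// square_time_ge.
exists (square_time k); first by rewrite (leq_trans mk)// square_time_ge.
rewrite /dist_ratio ler_pdivlMr//.
apply: (@le_trans _ _ (c / 2 * phi (square_time k.+1)%:R)).
  by rewrite ler_wpM2l// divr_ge0// ltW.
move: far tri small; set f := phi _ ; lra.
Qed.

(** With positive probability the walk is within [A phi t <= A psi T] of its start at
    every square time [t], where [T] is the next one; and almost surely it then
    stays within [C psi T] of its position up to time [T], for infinitely many [T]. *)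
Lemma liminf_ratio_le : exists C : R,
  0 < pr (L x) [set s | liminf_ratio e beta s <= C%:E]%E.
Proof.
have [A [J [A0 mA prA]]] := pr_confined_phi.
have [C [delta [C0 d0 d1 EP]]] := pr_stay_psi e_sym e_conn ball_finite LP SG N_good.
exists (A + C).
pose E k := [set s : nat -> V | forall l, (l <= square_time k.+1 - square_time k)%N ->
  (gdist e (s 0%N) (s l))%:R <= C * psi (square_time k.+1)%:R].
have Edet k : determined (square_time k.+1 - square_time k) (E k).
  by move=> s t st sl l lk; rewrite -!st//; exact: sl.
have io := conditional_io e_conn LP Sx square_time_le d0 d1 Edet EP.
set IO := \bigcap_m _ in io.
have mIO : measurable (IO : set (paths v0)).
  apply: bigcap_measurableType => m _; apply: bigcup_measurable => k _.
  by apply: measurable_future; exact: measurable_determined (Edet (m + k)%N).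
have prI : 0 < pr (L x) (confined_phi A J `&` IO).
  have := pr_split (L x) mA mIO.
  have : pr (L x) (confined_phi A J `&` ~` IO) <= pr (L x) (~` IO).
    by apply: le_pr; [apply: measurableI => //; exact: measurableC|exact: measurableC|move=> s []].
  rewrite prC// io subrr; lra.
apply: (lt_le_trans prI); apply: (le_pr_admissible LP Sx).
- exact: measurableI.
- rewrite -[X in measurable X]setTI; apply: emeasurable_fun_infty_c => //.
  exact: (@measurable_liminf_ratio R V v0 e).
move=> s /(_ 0%N)[s0 _] [sA sio].
rewrite /= (@liminf_ratioE R V e beta s); apply: limn_einf_le => m.
have [k0 _ fact] := square_near lnln_near.
have [k1 _ fact1] := @near_square_time R 1 beta ler01 (ltW b0).
have [i _] := sio (maxn m (maxn J (maxn k0 k1))) I; set k := (_ + i)%N.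
have : (maxn m (maxn J (maxn k0 k1)) <= k)%N by exact: leq_addr.
rewrite !geq_max => /and4P[mk Jk k0k k1k].
clearbody k; rewrite /E /future /= => stay.
have [t1 lt1] := fact k k0k.
have [T1 lT1] := fact k.+1 (leqW k0k).
have psiT := rate_gt0 (1 / beta) (- (1 / beta)) T1 lT1.
have phi_psi : phi (square_time k)%:R <= psi (square_time k.+1)%:R.
  apply: phi_le_psi => //; [exact: lt_le_trans ltr01 lt1|by rewrite ler_nat|].
  by have := fact1 k k1k; rewrite mul1r.
have Jk2 : (J <= k ^ 2)%N.
  by rewrite (leq_trans Jk)//; case: (k) => // k'; rewrite expnS leq_pmulr// expn_gt0.
have early l : (l <= square_time k)%N -> (gdist e x (s l))%:R <= A * phi (square_time k)%:R.
  by move=> lk; rewrite ltW//; exact: sA Jk2 lk.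
have A_le : A * phi (square_time k)%:R <= A * psi (square_time k.+1)%:R by rewrite ler_wpM2l// ltW.
have Cp : 0 < C * psi (square_time k.+1)%:R by exact: mulr_gt0.
have Ap : 0 < A * psi (square_time k.+1)%:R by exact: mulr_gt0.
exists (square_time k.+1).
  by rewrite (leq_trans mk)// (leq_trans (leqnSn k))// square_time_ge.
rewrite /max_ratio ler_pdivrMr// mulrDl; apply: max_dist_leR; first by rewrite addr_ge0// ltW.
move=> l lT; rewrite s0; have [lt|tl] := leqP l (square_time k).
  by apply: (le_trans (early l lt)); lra.
apply: (le_trans (gdist_triangleR (R := R) e_conn x (s (square_time k)) (s l))).
have := stay (l - square_time k)%N; rewrite addn0 subnKC ?(ltnW tl)// leq_sub2r// => /(_ isT).
by have := early (square_time k) (leqnn _); lra.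
Qed.

(** By the zero-one law each ratio is almost surely constant, so bounds that hold
    with positive probability make the constant finite and positive. *)
Lemma chain_lil : exists C1 C2 : R, [/\ 0 < C1, 0 < C2,
  forall y, S y -> pr (L y) [set s | limsup_ratio e beta s = C1%:E] = 1 &
  forall y, S y -> pr (L y) [set s | liminf_ratio e beta s = C2%:E] = 1].
Proof.
have [delta d0 ov] := subgaussian_overlapping e_sym e_conn ball_finite SG.
have [c1 c1_gt0 low1] := limsup_ratio_ge; have [C1 up1] := limsup_ratio_le.
have [c2 c2_gt0 low2] := liminf_ratio_ge; have [C2 up2] := liminf_ratio_le.
have [D1 cD1 D1P] := invariant_variable e_conn LP ball_finite d0 ov Sx
  (@measurable_limsup_ratio R V v0 e beta) (limsup_ratio_future e_sym e_conn b0) low1 up1.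
have [D2 cD2 D2P] := invariant_variable e_conn LP ball_finite d0 ov Sx
  (@measurable_liminf_ratio R V v0 e beta) (liminf_ratio_future e_sym e_conn b0) low2 up2.
by exists D1, D2; split=> //; [exact: lt_le_trans cD1|exact: lt_le_trans cD2].
Qed.

End ChainLIL.

(** * Good environments *)

Section GoodEnvironment.
Context {R : realType} {V : countType} {e : rel V}.
Context {d : measure_display} {T : measurableType d}.
Variables (P : probability T R) (Omega0 : set T) (N : V -> T -> R) (x0 : V).
Variables (alpha beta c : R) (f : nat -> R).
Hypotheses (Omega0_meas : measurable Omega0)
           (N_meas : forall x, measurable_fun Omega0 (N x)).
Hypothesis ball_finite : forall x (r : R), finite_set (gball e x r).
Hypotheses (b0 : 0 < beta) (c0 : 0 < c).
Hypothesis ball_card_le : forall r : R, 1 <= r ->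
  (#|` fset_set (gball e x0 r)|)%:R <= c * r `^ alpha.
Hypothesis N_tail : forall x n, (1 <= n)%N ->
  (P (Omega0 `&` [set omega | (n%:R <= N x omega)%R]) <= (f n)%:E)%E.
Hypothesis f_sum : (\sum_(1 <= n <oo) (n%:R `^ (alpha * beta) * f n)%:E < +oo)%E.

Let large n x := Omega0 `&` [set omega | (n%:R <= N x omega)%R].

(** A ball of radius [n `^ beta] has at most of order [n `^ (alpha * beta)] vertices, so the
    moment condition on [f] is what makes these events summable. *)
Definition bad_environment (n : nat) : set T :=
  if n is 0 then set0 else \bigcup_(x in gball e x0 (n%:R `^ beta)) large n x.

Let mlarge n x : measurable (large n x).
Proof.
rewrite (_ : large n x = Omega0 `&` N x @^-1` `[n%:R, +oo[).
  by apply: N_meas.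
by apply/seteqP; split=> omega [ H0 /=]; rewrite in_itv/= andbT.
Qed.

Lemma measurable_bad_environment n : measurable (bad_environment n).
Proof.
by case: n => [|n]; [exact: measurable0|apply: fin_bigcup_measurable].
Qed.

Let f_ge0 n : (1 <= n)%N -> 0 <= f n.
Proof. by move=> n1; rewrite -lee_fin (le_trans _ (N_tail x0 n1))// measure_ge0. Qed.

Lemma bad_environment_le n : (1 <= n)%N ->
  (P (bad_environment n) <= (c * (n%:R `^ (alpha * beta) * f n))%:E)%E.
Proof.
case: n => // n n1; have fin := ball_finite x0 (n.+1%:R `^ beta).
apply: (le_trans (content_sub_fsum P fin (fun x _ => mlarge n.+1 x) (measurable_bad_environment n.+1) _)).
  by [].
apply: (@le_trans _ _ (\sum_(x \in gball e x0 (n.+1%:R `^ beta)) (f n.+1)%:E)%E).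
  by apply: lee_fsum => // x _; exact: N_tail.
rewrite fsumEFin// lee_fin fsbig_finite//= big_const_seq count_predT iter_addr_0.
rewrite -[f n.+1 *+ _]mulr_natl mulrA ler_wpM2r ?f_ge0//.
have n1b : 1 <= n.+1%:R `^ beta by rewrite -[leLHS](powRr0 n.+1%:R) ler_powR ?ler1n// ltW.
by apply: (le_trans (ball_card_le n1b)); rewrite mulrC -powRrM [beta * _]mulrC mulrC.
Qed.

(** Borel--Cantelli along the integer scales. Passing from real [rho] to the
    integer above [rho `^ (1 / beta)] costs the factor 2. *)
Lemma ae_good_environment : P Omega0 = 1%E ->
  {ae P, forall omega, Omega0 omega /\ exists rho0 : R, forall rho z,
     rho0 <= rho -> (gdist e x0 z)%:R <= rho ->
     N z omega <= 2 * rho `^ (1 / beta)}.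
Proof.
move=> PO; exists (~` Omega0 `|` lim_sup_set bad_environment); split.
- apply: measurableU; first exact: measurableC.
  apply: bigcap_measurableType => n _; apply: bigcup_measurable => k _.
  exact: measurable_bad_environment.
- rewrite measureU0//; last 1 first.
  + apply: lim_sup_set_cvg0; first exact: measurable_bad_environment.
    rewrite nneseries_recl//.
    rewrite measure0 add0e.
    apply: (@le_lt_trans _ _ (c%:E * \sum_(1 <= n <oo) (n%:R `^ (alpha * beta) * f n)%:E)%E).
      rewrite eseries_cond [in leRHS]eseries_cond.
      rewrite -nneseriesZl; last first.
        by move=> n /andP[_ n1]; rewrite lee_fin mulr_ge0 ?powR_ge0 ?f_ge0.
      apply: lee_nneseries => [n _ _|n /andP[_ n1]]; first exact: measure_ge0.
      by rewrite -EFinM; exact: bad_environment_le.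
    by rewrite lte_mul_pinfty// lee_fin ltW.
  + by rewrite [LHS]probability_setC// PO subee.
  + exact: measurableC.
  + apply: bigcap_measurableType => n _; apply: bigcup_measurable => k _.
    exact: measurable_bad_environment.
move=> omega /=; apply: contra_notP => /not_orP[/contrapT Oo nlim]; split=> //.
have [n0 n0P] : exists n0 : nat, forall n, (n0 <= n)%N -> ~ bad_environment n omega.
  apply: contrapT => H; apply: nlim => n _; apply: contrapT => nb.
  by apply: H; exists n => m nm bm; apply: nb; exists m.
exists (n0%:R `^ beta + 1) => rho z rho_ge zrho.
have rho1 : 1 <= rho by rewrite (le_trans _ rho_ge)// lerDr powR_ge0.
have rho0 : 0 <= rho := le_trans ler01 rho1.
have s1 : 1 <= rho `^ (1 / beta).
  by rewrite -[leLHS](powRr0 rho) ler_powR// divr_ge0// ltW.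
pose n := (Num.truncn (rho `^ (1 / beta))).+1.
have nlb : rho `^ (1 / beta) < n%:R by exact: truncnS_gt.
have nub : n%:R <= 2 * rho `^ (1 / beta).
  have : (Num.truncn (rho `^ (1 / beta)))%:R <= rho `^ (1 / beta) :> R.
    by rewrite truncn_le// (le_trans ler01).
  by rewrite /n -natr1; lra.
apply: le_trans nub; rewrite leNgt; apply/negP => nN.
apply: (n0P n).
  rewrite -(ler_nat R) ltW// (le_lt_trans _ nlb)//.
  apply: powR_powRV_le => //; apply: le_trans rho_ge; by rewrite lerDl.
exists z; last by split=> //; exact: ltW.
apply: (le_trans zrho); rewrite -[leLHS](powRK b0)//.
by apply: powR_le; [exact: ltW|exact: powR_ge0|exact: ltW].
Qed.

End GoodEnvironment.

(** * The chain in a fixed environment *)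

Section PathLaw.
Context {R : realType} {V : countType} {v0 : V}.
Context {d : measure_display} {W : measurableType d} {X : nat -> W -> V}.
Variable Q : V -> probability W R.
Hypothesis X_meas : forall n y, measurable (X n @^-1` [set y]).

Definition trajectory (h : W) : paths v0 := fun n => X n h.

Lemma measurable_trajectory : measurable_fun setT trajectory.
Proof.
apply: measurable_to_paths => n t.
rewrite (_ : _ @^-1` _ = \bigcap_(i in `I_n.+1) (X i @^-1` [set t i])); last first.
  by apply/seteqP; split=> h Xt i; exact: Xt.
by apply: bigcap_measurableType => i _; exact: X_meas.
Qed.

(** Only the law of the trajectory matters, and the Markov and zero-one arguments
    need the time shift, which exists on path space only. *)
Definition path_law (x : V) : probability (paths v0) R :=
  distribution (Q x) (mfun_Sub (mem_set measurable_trajectory)).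

Lemma pr_path_law x (A : set (paths v0)) :
  pr (path_law x) A = pr (Q x) (trajectory @^-1` A).
Proof. by []. Qed.

End PathLaw.

Section FixedEnvironment.
Context {R : realType} {V : countType} {e : rel V} {c : V -> V -> R} {x0 : V}.
Hypotheses (e_lf : locally_finite e).
Hypotheses (c_sym : forall x y, e x y -> c x y = c y x)
           (c_ge0 : forall x y, e x y -> 0 <= c x y) (e_sym : symmetric e).

Local Notation S := (open_cluster e c x0).
Local Notation mu := (vweight e c).

Lemma open_cluster_base : S x0.
Proof. by exists [::]. Qed.

Lemma open_cluster_step x y : S x -> e x y -> 0 < c x y -> S y.
Proof.
move=> [s [es <-]] exy cxy; exists (rcons s y); rewrite rcons_path es last_rcons.
by rewrite exy cxy.
Qed.

Lemma vweight_ge0 x : 0 <= mu x.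
Proof. by apply: fsumr_ge0 => y; exact: c_ge0. Qed.

Lemma vweight_gt0 x y : e x y -> 0 < c x y -> 0 < mu x.
Proof.
move=> exy cxy; apply: (lt_le_trans cxy); rewrite -[leLHS](fsbig_set1 (GRing.add : Monoid.com_law (0 : R)) y (c x)).
by apply: ler_fsum_subset => [|z ->|z /c_ge0]//; exact: e_lf.
Qed.

(** A vertex of weight 0 is isolated in the open graph, so its cluster is a
    single vertex and has volume 0. *)
Lemma open_cluster_weight x r : S x -> 0 < volume e c x0 x r -> 0 < mu x.
Proof.
move=> Sx vol; rewrite lt_neqAle vweight_ge0 andbT eq_sym; apply/eqP => mu0.
have isolated y : e x y -> ~ 0 < c x y.
  by move=> exy /(vweight_gt0 exy); rewrite mu0 ltxx.
have x0x : x0 = x.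
  case: Sx => s []; case/lastP: s => [_ <-//|s y]; rewrite rcons_path last_rcons.
  move=> /andP[_ /andP[ey cy] yx]; rewrite {}yx in ey cy.
  exfalso; apply: (isolated (last x0 s)); first by rewrite e_sym.
  by rewrite -c_sym.
have only y : S y -> y = x.
  move=> [s []]; rewrite x0x; case: s => [_ <-//|z s /= /andP[/andP[ez cz] _]].
  by have := isolated z ez.
move: vol; rewrite /volume fsbig1 ?ltxx// => y [_ /only->].
exact: mu0.
Qed.

Section Chain.
Context {d : measure_display} {W : measurableType d} {X : nat -> W -> V}.
Variable Q : V -> probability W R.
Hypothesis X_meas : forall n y, measurable (X n @^-1` [set y]).
Hypothesis mu_gt0 : forall x, S x -> 0 < mu x.
Hypothesis Q_law : forall x, S x ->
  markov_chain_from (Q x) X (transition e c) x.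

Local Notation L := (path_law (v0 := x0) Q X_meas).

Lemma path_law_markov : markov_laws e S (transition e c) L.
Proof.
split=> [x Sx|x n s Sx|x y Sx].
- have [_ start _] := Q_law Sx.
  by rewrite pr_path_law /pr (_ : _ @^-1` _ = X 0%N @^-1` [set x])// start.
- have [_ _ step] := Q_law Sx.
  have mc k := measurable_trajectory (v0 := x0) X_meas measurableT (measurable_cyl x0 k s).
  apply: EFin_inj; rewrite EFinM !pr_path_law -!prE; last 2 first.
  + by have := mc n; rewrite setTI.
  + by have := mc n.+1; rewrite setTI.
  exact: step.
- rewrite /transition; case: ifP => // exy; last by rewrite eqxx.
  move=> cmu; split=> //; apply: (open_cluster_step Sx exy).
  rewrite lt_neqAle c_ge0// andbT eq_sym; apply: contraNneq cmu => ->.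
  by rewrite mul0r.
Qed.

Lemma pr_path_law_at n x y : S y ->
  pr (L x) [set s | s n = y] = mu y * heat_kernel e c Q X n x y.
Proof.
by move=> Sy; rewrite /heat_kernel mulrC divfK// gt_eqF// mu_gt0.
Qed.

Section LIL.
Variables (N : V -> R) (alpha beta eps c11 c12 c13 c14 c15 c16 : R).
Hypotheses (e_conn : connected_graph e).
Hypothesis ball_finite : forall x (r : R), finite_set (gball e x r).
Hypotheses (alpha_ge1 : 1 <= alpha) (eps_gt0 : 0 < eps) (eps_beta : eps + 1 < beta).
Hypotheses (c11_gt0 : 0 < c11) (c12_gt0 : 0 < c12) (c13_gt0 : 0 < c13)
           (c14_gt0 : 0 < c14) (c15_gt0 : 0 < c15) (c16_gt0 : 0 < c16).
Hypothesis vol_bounds : forall x r, S x -> 1 <= r -> N x <= r ->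
  c11 * r `^ alpha <= volume e c x0 x r <= c12 * r `^ alpha.
Hypothesis hk_upper : forall x y n, S x -> S y -> (1 <= n)%N ->
  Num.max (gdist e x y)%:R (N x) <= n%:R ->
  heat_kernel e c Q X n x y <= c13 / n%:R `^ (alpha / beta) *
    expR (- (c14 * ((gdist e x y)%:R / n%:R `^ (1 / beta)) `^ (beta / (beta - 1)))).
Hypothesis hk_lower : forall x y n, S x -> S y -> (1 <= n)%N ->
  Num.max ((gdist e x y)%:R `^ (1 + eps)) (N x) <= n%:R ->
  c15 / n%:R `^ (alpha / beta) *
    expR (- (c16 * ((gdist e x y)%:R / n%:R `^ (1 / beta)) `^ (beta / (beta - 1)))) <=
  heat_kernel e c Q X n x y + heat_kernel e c Q X n.+1 x y.
Variable rho0 : R.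
Hypothesis N_good : forall rho z, rho0 <= rho -> (gdist e x0 z)%:R <= rho ->
  N z <= 2 * rho `^ (1 / beta).

Lemma path_law_subgaussian :
  subgaussian e S mu N L alpha beta eps c11 c12 c13 c14 c15 c16.
Proof.
split=> // [y Sy|x y n Sx Sy n1 dn Nn|x y n Sx Sy n1 dn Nn].
- exact/ltW/mu_gt0.
- rewrite pr_path_law_at// ler_wpM2l ?vweight_ge0// hk_upper// ge_max Nn andbT.
  by rewrite ler_nat.
- rewrite !pr_path_law_at// -mulrDr ler_wpM2l ?vweight_ge0// hk_lower//.
  by rewrite ge_max Nn dn.
Qed.

Lemma environment_lil : exists C1 C2 : R, [/\ 0 < C1, 0 < C2,
  forall x, S x ->
    {ae Q x, forall h, limsup_ratio e beta (fun n => X n h) = C1%:E} &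
  forall x, S x ->
    {ae Q x, forall h, liminf_ratio e beta (fun n => X n h) = C2%:E}].
Proof.
have good rho z : rho0 <= rho -> S z -> (gdist e x0 z)%:R <= rho ->
  N z <= 2 * rho `^ (1 / beta) by move=> r0 _; exact: N_good.
have [C1 [C2 [C1_gt0 C2_gt0 sup inf]]] := chain_lil e_sym e_conn ball_finite
  path_law_markov path_law_subgaussian open_cluster_base good.
have transfer Z (C : \bar R) x : measurable_fun [set: paths x0] Z ->
    pr (L x) [set s | Z s = C] = 1 ->
    {ae Q x, forall h, Z (fun n => X n h) = C}.
  move=> mZ Z1; apply: (pr1_ae (A := trajectory (v0 := x0) @^-1` [set s | Z s = C])).
  - rewrite -[X in measurable X]setTI.
    apply: (measurable_trajectory X_meas) => //.
    by rewrite -[X in measurable X]setTI; exact: (mZ measurableT _ (emeasurable_set1 C)).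
  - exact: Z1.
  - by [].
exists C1, C2; split=> // x Sx.
- exact: transfer (@measurable_limsup_ratio R V x0 e beta) (sup x Sx).
- exact: transfer (@measurable_liminf_ratio R V x0 e beta) (inf x Sx).
Qed.

End LIL.
End Chain.
End FixedEnvironment.

(** * Almost every environment *)

Theorem theorem1p2 (R : realType)
  (* the graph *)
  (V : countType) (e : rel V)
  (e_sym : symmetric e) (e_irr : irreflexive e)
  (V_inf : infinite_set [set: V])
  (e_lf : locally_finite e) (e_conn : connected_graph e)
  (alpha c1 c2 : R) (alpha_ge1 : 1 <= alpha) (c1_gt0 : 0 < c1) (c2_gt0 : 0 < c2)
  (ball_card : forall (x : V) (r : R), 1 <= r ->
     c1 * r `^ alpha <= (#|` fset_set (gball e x r)|)%:R <= c2 * r `^ alpha)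
  (* the random conductances *)
  (d : measure_display) (T : measurableType d) (P : probability T R)
  (w : V -> V -> {RV P >-> R})
  (w_sym : forall (omega : T) (x y : V), e x y -> w x y omega = w y x omega)
  (w_ge0 : forall (omega : T) (x y : V), e x y -> 0 <= w x y omega)
  (x0 : V)
  (* the Markov chains X^omega and their laws P_x^omega *)
  (d' : measure_display) (W : measurableType d')
  (X : T -> nat -> W -> V) (Px : T -> V -> probability W R)
  (Px_law : forall (omega : T) (x : V),
     open_cluster e (env w omega) x0 x -> 0 < vweight e (env w omega) x ->
     markov_chain_from (Px omega x) (X omega) (transition e (env w omega)) x)
  (* the assumptions *)
  (Omega0 : set T) (Omega0_meas : measurable Omega0) (Omega0_full : P Omega0 = 1%E)
  (c11 c12 c13 c14 c15 c16 beta eps : R)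
  (c11_gt0 : 0 < c11) (c12_gt0 : 0 < c12) (c13_gt0 : 0 < c13)
  (c14_gt0 : 0 < c14) (c15_gt0 : 0 < c15) (c16_gt0 : 0 < c16)
  (beta_gt0 : 0 < beta) (eps_gt0 : 0 < eps) (eps_beta : eps + 1 < beta)
  (N : V -> T -> R) (N_meas : forall x : V, measurable_fun Omega0 (N x))
  (vol_bounds : forall (omega : T) (x : V) (r : R), Omega0 omega ->
     open_cluster e (env w omega) x0 x -> 1 <= r -> N x omega <= r ->
     c11 * r `^ alpha <= volume e (env w omega) x0 x r <= c12 * r `^ alpha)
  (hk_upper : forall (omega : T) (x y : V) (n : nat), Omega0 omega ->
     open_cluster e (env w omega) x0 x -> open_cluster e (env w omega) x0 y ->
     (1 <= n)%N -> Num.max (gdist e x y)%:R (N x omega) <= n%:R ->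
     heat_kernel e (env w omega) (Px omega) (X omega) n x y <=
       c13 / n%:R `^ (alpha / beta) *
       expR (- (c14 * ((gdist e x y)%:R / n%:R `^ (1 / beta))
                        `^ (beta / (beta - 1)))))
  (hk_lower : forall (omega : T) (x y : V) (n : nat), Omega0 omega ->
     open_cluster e (env w omega) x0 x -> open_cluster e (env w omega) x0 y ->
     (1 <= n)%N ->
     Num.max ((gdist e x y)%:R `^ (1 + eps)) (N x omega) <= n%:R ->
     c15 / n%:R `^ (alpha / beta) *
       expR (- (c16 * ((gdist e x y)%:R / n%:R `^ (1 / beta))
                        `^ (beta / (beta - 1)))) <=
     heat_kernel e (env w omega) (Px omega) (X omega) n x y
       + heat_kernel e (env w omega) (Px omega) (X omega) n.+1 x y)
  (f : nat -> R)
  (f_noninc : forall m n : nat, (1 <= m)%N -> (m <= n)%N -> f n <= f m)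
  (N_tail : forall (x : V) (n : nat), (1 <= n)%N ->
     (P (Omega0 `&` [set omega | (n%:R <= N x omega)%R]) <= (f n)%:E)%E)
  (f_sum : (\sum_(1 <= n <oo) (n%:R `^ (alpha * beta) * f n)%:E < +oo)%E) :
  {ae P, forall omega : T, exists C1 C2 : R,
     [/\ 0 < C1, 0 < C2,
         forall x : V, open_cluster e (env w omega) x0 x ->
           {ae Px omega x, forall h : W,
              limsup_ratio e beta (fun n => X omega n h) = C1%:E} &
         forall x : V, open_cluster e (env w omega) x0 x ->
           {ae Px omega x, forall h : W,
              liminf_ratio e beta (fun n => X omega n h) = C2%:E}]}.
Proof.
have ball_finite := gball_finite c1_gt0 (fun x r r1 => proj1 (andP (ball_card x r r1))).
have ball_card_le (r : R) : 1 <= r ->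
  (#|` fset_set (gball e x0 r)|)%:R <= c2 * r `^ alpha.
  by move=> /(ball_card x0)/andP[].
have := ae_good_environment Omega0_meas N_meas ball_finite beta_gt0 c2_gt0
  ball_card_le N_tail f_sum Omega0_full.
apply: filterS => omega [Oo [rho0 N_good]].
pose c := env w omega.
have c_sym x y : e x y -> c x y = c y x by exact: w_sym.
have c_ge0 x y : e x y -> 0 <= c x y by exact: w_ge0.
(* A vertex of the cluster has positive weight because its large balls have
   positive volume. *)
have mu_gt0 x : open_cluster e c x0 x -> 0 < vweight e c x.
  move=> Sx; pose r := Num.max 1 (N x omega).
  apply: (open_cluster_weight (x0 := x0) e_lf c_sym c_ge0 e_sym (r := r)) => //.
  have r1 : 1 <= r by rewrite le_max lexx.
  have rN : N x omega <= r by rewrite le_max lexx orbT.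
  have /andP[vol _] := vol_bounds omega x r Oo Sx r1 rN.
  by apply: lt_le_trans vol; rewrite mulr_gt0// powR_gt0// (lt_le_trans ltr01).
have Q_law x : open_cluster e c x0 x ->
  markov_chain_from (Px omega x) (X omega) (transition e c) x.
  by move=> Sx; apply: Px_law => //; exact: mu_gt0.
have [X_meas _ _] := Q_law x0 (open_cluster_base (e := e) (c := c)).
exact: (environment_lil c_ge0 e_sym X_meas mu_gt0 Q_law e_conn ball_finite
  alpha_ge1 eps_gt0 eps_beta c11_gt0 c12_gt0 c13_gt0 c14_gt0 c15_gt0 c16_gt0
  (fun x r => vol_bounds omega x r Oo) (fun x y n => hk_upper omega x y n Oo)
  (fun x y n => hk_lower omega x y n Oo) N_good).
Qed.
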